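(* Let $m\ge 1$ and $n\ge m$ be integers, and let $P_m(\mathbb{R})$ be the cone of $m\times m$ real symmetric positive-definite matrices. Consider the statistical manifold of inverse Wishart distributions in dimension $m$ with $n$ degrees of freedom, with probability density functions $$p(X;\Sigma)=\frac{(\det\Sigma)^{n/2}\,(\det X)^{-(n+m+1)/2}\exp\left(-\frac12\operatorname{tr}(\Sigma X^{-1})\right)}{2^{nm/2}\,\Gamma_m(n/2)},\qquad X\in P_m(\mathbb{R}),$$ parametrised by $\Sigma=(\sigma_{i,j})\in P_m(\mathbb{R})$ through the coordinate vector $\xi=(\sigma_{1,1},\dots,\sigma_{1,m},\sigma_{2,2},\dots,\sigma_{2,m},\dots,\sigma_{m,m})\in\mathbb{R}^{m(m+1)/2}$. Its Fisher matrix is $$G(\xi)=\frac n2\,D_m^{\mathsf T}\left(\Sigma^{-1}\otimes\Sigma^{-1}\right)D_m,$$ and for all $\Sigma_1,\Sigma_2\in P_m(\mathbb{R})$ the Fisher--Rao distance is $$d_{\mathrm{FR}}(\Sigma_1,\Sigma_2)=\sqrt{\frac n2}\,\left\|\log\left(\Sigma_1^{-1/2}\Sigma_2\Sigma_1^{-1/2}\right)\right\|_F=\sqrt{\frac n2\sum_{k=1}^m(\log\lambda_k)^2},$$ where $\lambda_1,\dots,\lambda_m$ are the eigenvalues of $\Sigma_1^{-1/2}\Sigma_2\Sigma_1^{-1/2}$.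
   Context: $\Gamma_m(z)=\pi^{m(m-1)/4}\prod_{j=1}^m\Gamma\left(z+\frac{1-j}{2}\right)$ is the multivariate Gamma function; $\otimes$ is the Kronecker product; $\log$ of a matrix is the matrix logarithm; $\|A\|_F=\sqrt{\operatorname{tr}(AA^{\mathsf T})}$. For an $m\times m$ matrix $A$, $\operatorname{vec}(A)\in\mathbb{R}^{m^2}$ is the concatenation of its columns; for symmetric $A=(a_{i,j})$, $\nu(A)=(a_{1,1},\dots,a_{1,m},a_{2,2},\dots,a_{2,m},\dots,a_{m,m})\in\mathbb{R}^{m(m+1)/2}$; $D_m$ is the unique $m^2\times\frac{m(m+1)}2$ matrix with $D_m\nu(A)=\operatorname{vec}(A)$ for every symmetric $A$. Densities on $P_m(\mathbb{R})$ are with respect to Lebesgue measure in the coordinates $\nu(X)$. For a parametric family $p_\xi$ of probability densities parametrised by $\xi$ in an open set $\Xi\subseteq\mathbb{R}^d$, the Fisher matrix is $G(\xi)=[g_{ij}(\xi)]$ with $g_{ij}(\xi)=\mathbb{E}_{p_\xi}\left[\frac{\partial\log p_\xi}{\partial\xi^i}\frac{\partial\log p_\xi}{\partial\xi^j}\right]$. The Fisher--Rao distance $d_{\mathrm{FR}}(\xi_1,\xi_2)$ is the infimum of the lengths $\int_0^1\sqrt{\dot\xi(t)^{\mathsf T}G(\xi(t))\dot\xi(t)}\,\mathrm{d}t$ over piecewise differentiable curves $\xi:[0,1]\to\Xi$ with $\xi(0)=\xi_1$, $\xi(1)=\xi_2$; $d_{\mathrm{FR}}(\Sigma_1,\Sigma_2)$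 denotes the distance between the corresponding coordinate vectors. *)

(* Defs.v *)
From HB Require Import structures.
From mathcomp Require Import all_boot all_order all_algebra.
From mathcomp Require Import all_classical all_reals all_analysis.
From mathcomp Require Import mxtens.

Set Implicit Arguments.
Unset Strict Implicit.
Unset Printing Implicit Defensive.

Import Order.TTheory GRing.Theory Num.Theory.
Import numFieldNormedType.Exports.

Local Open Scope classical_set_scope.
Local Open Scope ring_scope.

Definition posdef {R : realType} (m : nat) : set 'M[R]_m :=
  [set A | A^T = A /\ forall x : 'cV[R]_m, x != 0 -> 0 < (x^T *m A *m x) 0 0].

Definition frobenius {R : realType} (m : nat) (A : 'M[R]_m) : R :=
  Num.sqrt (\tr (A *m A^T)).

Definition mxexp {R : realType} (m : nat) (A : 'M[R]_m) : 'M[R]_m :=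
  limn (series (fun k => (k`!)%:R^-1 *: A ^+ k)).

(* The inverse of mxexp : Sym_m -> P_m, which is a bijection; on P_m this is
   the principal logarithm. *)
Definition mxlog {R : realType} (m : nat) (A : 'M[R]_m) : 'M[R]_m :=
  xget 0 [set L : 'M[R]_m | L^T = L /\ mxexp L = A].

(* The square root on P_m: the unique positive-definite B with B B = A. *)
Definition mxsqrt {R : realType} (m : nat) (A : 'M[R]_m) : 'M[R]_m :=
  xget 0 [set B : 'M[R]_m | posdef B /\ B *m B = A].

(* (1,1), ..., (1,m), (2,2), ..., (2,m), ..., (m,m), with indices from 0. *)
Definition upper_seq (m : nat) : seq ('I_m * 'I_m)%type :=
  [seq ij : ('I_m * 'I_m)%type <- [seq (i, j) | i <- enum 'I_m, j <- enum 'I_m]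
  | (ij.1 <= ij.2)%N].

Definition tri (m : nat) : nat := (m * m.+1)./2.

Lemma size_upper_seq (m : nat) : size (upper_seq m) == tri m.
Proof.
rewrite /upper_seq size_filter count_flatten -map_comp sumnE big_map big_enum /=.
have -> : tri m = (\sum_(i < m) i.+1)%N.
  rewrite /tri mulnC -(bin2 m.+1) -triangular_sum big_nat_recl //= big_mkord.
  by rewrite add0n.
rewrite (reindex_inj rev_ord_inj) /=; apply/eqP/eq_bigr => i _.
rewrite count_map -sum1_count big_enum_cond /=.
have := @big_geq_mkord _ _ addn (m - i.+1) m predT (fun=> 1%N).
rewrite /= => <-; rewrite sum_nat_const_nat muln1 subKn //.
Qed.

Definition upper_idx (m : nat) : (tri m).-tuple ('I_m * 'I_m)%type :=
  Tuple (size_upper_seq m).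

Lemma upper_idx_inj (m : nat) : injective (tnth (upper_idx m)).
Proof.
apply/tuple_uniqP; rewrite /= filter_uniq //.
by apply: allpairs_uniq; rewrite ?enum_uniq // => -[? ?] [? ?].
Qed.

Lemma upper_idx_surj (m : nat) (i j : 'I_m) :
  (i <= j)%N -> exists k, tnth (upper_idx m) k = (i, j).
Proof.
move=> ij; have : (i, j) \in upper_idx m.
  rewrite /= mem_filter /= ij; apply/allpairsP.
  by exists (i, j); rewrite !mem_enum.
by case/tnthP => k ->; exists k.
Qed.

Lemma upper_idx_le (m : nat) (k : 'I_(tri m)) :
  ((tnth (upper_idx m) k).1 <= (tnth (upper_idx m) k).2)%N.
Proof.
by have := mem_tnth k (upper_idx m); rewrite /= mem_filter => /andP[].
Qed.

Definition nu {R : realType} (m : nat) (A : 'M[R]_m) : 'cV[R]_(tri m) :=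
  \col_k A (tnth (upper_idx m) k).1 (tnth (upper_idx m) k).2.

(* The symmetric matrix with given upper-triangular coordinates: nuK, symm_ofK. *)
Definition symm_of {R : realType} (m : nat) (x : 'cV[R]_(tri m)) : 'M[R]_m :=
  \matrix_(i, j) \sum_(k | (tnth (upper_idx m) k == (i, j))
                        || (tnth (upper_idx m) k == (j, i))) x k 0.

Lemma symm_of_sym {R : realType} (m : nat) (x : 'cV[R]_(tri m)) :
  (symm_of x)^T = symm_of x.
Proof. by apply/matrixP => i j; rewrite !mxE; apply: eq_bigl => k; rewrite orbC. Qed.

Lemma symm_of_upper {R : realType} (m : nat) (x : 'cV[R]_(tri m)) k :
  symm_of x (tnth (upper_idx m) k).1 (tnth (upper_idx m) k).2 = x k 0.
Proof.
rewrite mxE (big_pred1 k) // => l; rewrite -surjective_pairing.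
rewrite (inj_eq (@upper_idx_inj m)) /=.
have [->|lk] := eqVneq l k; first by [].
apply/negbTE/negP => /eqP e; case/negP: lk; apply/eqP.
apply: (@upper_idx_inj m); rewrite e.
have := upper_idx_le l; rewrite e /= => h.
have E : (tnth (upper_idx m) k).1 = (tnth (upper_idx m) k).2.
  by apply/val_inj/anti_leq; rewrite h upper_idx_le.
by rewrite [RHS]surjective_pairing E.
Qed.

Lemma symm_ofK {R : realType} (m : nat) (x : 'cV[R]_(tri m)) :
  nu (symm_of x) = x.
Proof. by apply/colP => k; rewrite mxE symm_of_upper. Qed.

Lemma nuK {R : realType} (m : nat) (A : 'M[R]_m) : A^T = A ->
  symm_of (nu A) = A.
Proof.
move=> As; apply/matrixP => i j.
wlog ij : i j / (i <= j)%N.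
  move=> H; have [/H //|/ltnW/H] := leqP i j.
  by rewrite -[in RHS]As -[in LHS]symm_of_sym [LHS]mxE [RHS]mxE.
have [k ek] := upper_idx_surj ij.
by have := symm_of_upper (nu A) k; rewrite [nu A k 0]mxE ek.
Qed.

(* mxvec concatenates rows, hence the transpose. *)
Definition vec {R : realType} (m : nat) (A : 'M[R]_m) : 'cV[R]_(m * m) :=
  (mxvec A^T)^T.

Definition duplication_mx (R : realType) (m : nat) : 'M[R]_(m * m, tri m) :=
  xget 0 [set D | forall A : 'M[R]_m, A^T = A -> D *m nu A = vec A].

Lemma duplication_mxP (R : realType) (m : nat) (D : 'M[R]_(m * m, tri m)) :
  (forall A : 'M[R]_m, A^T = A -> D *m nu A = vec A) <-> D = duplication_mx R m.
Proof.
pose P := [set D : 'M[R]_(m * m, tri m) |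
  forall A : 'M[R]_m, A^T = A -> D *m nu A = vec A].
have uP (D1 D2 : 'M[R]_(m * m, tri m)) : P D1 -> P D2 -> D1 = D2.
  move=> h1 h2; apply/matrixP => i k.
  have : D1 *m nu (symm_of (delta_mx k 0)) = D2 *m nu (symm_of (delta_mx k 0)).
    by rewrite h1 ?h2 // symm_of_sym.
  by rewrite symm_ofK -!colE => /colP/(_ i); rewrite !mxE.
have Pd : P (duplication_mx R m).
  rewrite /duplication_mx; case: xgetP => [//|/(_ (\matrix_(r, k)
    vec (symm_of (delta_mx k 0)) r 0))[] A As].
  apply/colP => r; case/mxvec_indexP: r => i j.
  rewrite /vec mxE [RHS]mxE mxvecE mxE -[in RHS](nuK As) mxE.
  rewrite [RHS]big_mkcond; apply: eq_bigr => k _.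
  rewrite 2!mxE mxvecE 2!mxE.
  under eq_bigr => l _ do rewrite mxE eqxx andbT.
  case: ifPn => kij.
    rewrite (bigD1 k) //= eqxx big1 ?addr0 ?mul1r // => l /andP[_ /negbTE->] //.
  rewrite big1 ?mul0r // => l Pl; have [lk|//] := eqVneq l k.
  by move: kij; rewrite -lk Pl.
by split=> [h|->]; [exact: uP|exact: Pd].
Qed.

(* Lebesgue measure on R^n, as an iterated product; see lebesgueRn_box. *)
Fixpoint lebesgueRn (R : realType) (n : nat) :
    set (n.-tuple (measurableTypeR R)) -> \bar R :=
  match n with
  | 0 => \d_([tuple] : 0.-tuple (measurableTypeR R))
  | n'.+1 => pushforward (@lebesgue_measure R \x^ @lebesgueRn R n')%E
      (fun xt : measurableTypeR R * n'.-tuple (measurableTypeR R) =>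
         [tuple of xt.1 :: xt.2])
  end.

Section lebesgueRn_measure.
Context (R : realType).
Local Open Scope ereal_scope.

Let lebesgueRn_measure n : [/\ @lebesgueRn R n set0 = 0,
  forall A, 0 <= @lebesgueRn R n A & semi_sigma_additive (@lebesgueRn R n)].
Proof.
elim: n => [|n [h0 hge0 hsa]] /=.
  by split; [exact: measure0|move=> A; exact: measure_ge0|
    exact: measure_semi_sigma_additive].
pose M : {measure set (n.-tuple (measurableTypeR R)) -> \bar R} :=
  HB.pack (@lebesgueRn R n) (isMeasure.Build _ _ _ (@lebesgueRn R n) h0 hge0 hsa).
have mc : measurable_fun setT
    (fun xt : measurableTypeR R * n.-tuple (measurableTypeR R) =>
      [tuple of xt.1 :: xt.2]).
  exact: (@measurable_cons _ _ _ _ fst n snd).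
pose P : {measure set _ -> \bar R} := pushforward (@lebesgue_measure R \x^ M) 
  (fun xt : measurableTypeR R * n.-tuple (measurableTypeR R) =>
      [tuple of xt.1 :: xt.2]).
split; [exact: (measure0 (P mc))|move=> A; exact: (measure_ge0 (P mc))|
  exact: (@measure_semi_sigma_additive _ _ _ (P mc))].
Qed.

Let lebesgueRn0 n : @lebesgueRn R n set0 = 0.
Proof. by case: (lebesgueRn_measure n). Qed.
Let lebesgueRn_ge0 n A : 0 <= @lebesgueRn R n A.
Proof. by case: (lebesgueRn_measure n). Qed.
Let lebesgueRn_sigma_additive n : semi_sigma_additive (@lebesgueRn R n).
Proof. by case: (lebesgueRn_measure n). Qed.

HB.instance Definition _ n := isMeasure.Build _ _ _ (@lebesgueRn R n)
  (@lebesgueRn0 n) (@lebesgueRn_ge0 n) (@lebesgueRn_sigma_additive n).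

Lemma lebesgueRn_box n (A : 'I_n -> set (measurableTypeR R)) :
  (forall i, measurable (A i)) ->
  lebesgueRn [set t | forall i, A i (tnth t i)] =
  \prod_(i < n) lebesgue_measure (A i).
Proof.
elim: n A => [|n IHn] A mA.
  by rewrite big_ord0 /= diracE mem_set //= => -[].
rewrite big_ord_recl -IHn => [|i]; last exact: mA.
rewrite -product_measure2E //; last first.
  rewrite (_ : mkset _ = \bigcap_(i in [set` 'I_n])
      ((fun t => tnth t i) @^-1` A (lift ord0 i))).
    apply: fin_bigcap_measurable => // i _.
    by rewrite -[X in measurable X]setTI; apply: measurable_tnth.
  apply/seteqP; split => t /= h i; first by move=> _; exact: h.
  by apply: h; rewrite /= inE.
rewrite /= /pushforward; congr (_ _); apply/seteqP.
split=> -[x t] /= h.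
  by split=> [|i]; [have := h ord0|have := h (lift ord0 i); rewrite tnthS].
case: h => hx ht i; case: (unliftP ord0 i) => [j ->|->] //.
by rewrite tnthS.
Qed.

End lebesgueRn_measure.

(* A family p xi of functions on the subset S of a measure space (T, mu),
   with parameter xi in R^k. *)
Section fisher.
Context {R : realType} {d : measure_display} {T : measurableType d} {k : nat}.
Variables (mu : {measure set T -> \bar R}) (S : set T) (p : 'cV[R]_k -> T -> R).

Definition is_density (f : T -> R) : Prop :=
  [/\ measurable S, measurable_fun S f, forall x, S x -> 0 <= f x
    & (\int[mu]_(x in S) (f x)%:E = 1)%E].

Definition score (xi : 'cV[R]_k) (i : 'I_k) (x : T) : R :=
  'D_(delta_mx i 0) (fun z : 'cV[R]_k => ln (p z x)) xi.

(* Derivatives and integrals are total functions: this says that those in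
   fisher_matrix are meaningful. *)
Definition fisher_defined (xi : 'cV[R]_k) : Prop :=
  (forall x i, S x ->
     derivable (fun z : 'cV[R]_k => ln (p z x)) xi (delta_mx i 0)) /\
  (forall i j,
     mu.-integrable S (fun x => (score xi i x * score xi j x * p xi x)%:E)).

Definition fisher_matrix (xi : 'cV[R]_k) : 'M[R]_k :=
  \matrix_(i, j) \int[mu]_(x in S) (score xi i x * score xi j x * p xi x).

End fisher.

(* There is a subdivision 0 = t_0 < ... < t_r = 1 such that c is differentiable
   on each closed interval [t_i, t_(i+1)] (one-sidedly at its ends), that is,
   agrees there with a function g differentiable at all of its points. *)
Definition piecewise_differentiable {R : realType} (k : nat)
    (c : R -> 'cV[R]_k) : Prop :=
  exists s : seq R, [/\ sorted <%R (0 :: s), last 0 s = 1 &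
    forall i, (i < size s)%N -> exists g : R -> 'cV[R]_k,
      forall t, (0 :: s)`_i <= t <= (0 :: s)`_i.+1 ->
        g t = c t /\ derivable g t 1].

(* The finitely many breakpoints of c, where derive1 c is unspecified, are
   negligible. *)
Definition curve_length {R : realType} (k : nat)
    (G : 'cV[R]_k -> 'M[R]_k) (c : R -> 'cV[R]_k) : \bar R :=
  (\int[lebesgue_measure]_(t in `[0%R, 1%R])
     (Num.sqrt (((derive1 c t)^T *m G (c t) *m derive1 c t) 0 0))%:E)%E.

Definition riemannian_dist {R : realType} (k : nat) (Xi : set 'cV[R]_k)
    (G : 'cV[R]_k -> 'M[R]_k) (a b : 'cV[R]_k) : \bar R :=
  ereal_inf [set curve_length G c | c in
    [set c : R -> 'cV[R]_k | [/\ piecewise_differentiable c,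
       forall t, 0 <= t <= 1 -> Xi (c t), c 0 = a & c 1 = b]]].

Definition fisher_rao_dist {R : realType} {d : measure_display}
    {T : measurableType d} {k : nat} (mu : {measure set T -> \bar R}) (S : set T)
    (p : 'cV[R]_k -> T -> R) (Xi : set 'cV[R]_k) (a b : 'cV[R]_k) : \bar R :=
  riemannian_dist Xi (fisher_matrix mu S p) a b.

(* Euler's Gamma function, for z > 0. *)
Definition Gamma {R : realType} (z : R) : R :=
  \int[lebesgue_measure]_(t in `]0, +oo[) (t `^ (z - 1) * expR (- t)).

Definition multiGamma {R : realType} (m : nat) (z : R) : R :=
  pi `^ ((m * (m - 1))%:R / 4) *
  \prod_(1 <= j < m.+1) Gamma (z + (1 - j%:R) / 2).

Definition inv_wishart {R : realType} (m n : nat) (X Sigma : 'M[R]_m) : R :=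
  \det Sigma `^ (n%:R / 2) * \det X `^ (- ((n + m + 1)%:R / 2)) *
  expR (- (2^-1 * \tr (Sigma *m invmx X))) /
  (2 `^ ((n * m)%:R / 2) * multiGamma m (n%:R / 2)).

(* The same density in the coordinates xi = nu Sigma and x = nu X. *)
Definition inv_wishart_coord {R : realType} (m n : nat) (xi : 'cV[R]_(tri m))
    (x : (tri m).-tuple (measurableTypeR R)) : R :=
  inv_wishart n (symm_of (\col_k tnth x k)) (symm_of xi).

Definition posdef_sample (R : realType) (m : nat) :
    set ((tri m).-tuple (measurableTypeR R)) :=
  [set x | posdef (symm_of (\col_k (tnth x k : R)))].

Definition posdef_param (R : realType) (m : nat) : set 'cV[R]_(tri m) :=
  [set nu Sigma | Sigma in @posdef R m].

(* Main.v *)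
(** Normalization.  Write X = [[a, b^T], [b, C]] and let S = C - b b^T / a be
    its Schur complement; let alpha, beta, T be the corner, the rest of the first
    column and the Schur complement of Sigma.  Then det X = a det S and
    [tr (Sigma X^-1) = alpha / a + (alpha / a^2) y^T S^-1 y + tr (T S^-1)] with
    y = b - (a / alpha) beta.  After the shift C -> S the integral over b is
    Gaussian, the one over a is an inverse Gamma integral, and what is left is the
    same integral for T, with the same n and one dimension less.

    Fisher matrix.  Write Sigma = P P^T and a symmetric direction as
    H = P diag(mu) P^T.  Along Sigma + t H the densities form an exponential family
    whose statistic is the score s_H, so by the normalization
    [E e^(t s_H) = exp (sum_k (n/2) (t mu_k - ln (1 + t mu_k)))].  The second
    derivative at 0 is E s_H^2 = (n/2) tr ((Sigma^-1 H)^2), and polarization gives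
    the Fisher matrix.

    Distance.  The metric is n/2 times the affine-invariant one, so we may assume
    Sigma_1 = 1 and Sigma_2 = diag (e^l_k).  The curve diag (e^(t l_k)) has the
    length claimed.  No curve is shorter: if p_k are the pivots of a matrix (its
    successive Schur complement corners), then
    [sum_k (d ln p_k)^2 <= tr ((A^-1 dA)^2)], so sum_k l_k ln p_k, which increases
    by |l|^2 along the curve, grows at most at rate |l| times the speed. *)

Require Import Defs.
From HB Require Import structures.
From mathcomp Require Import all_boot all_order all_algebra.
From mathcomp Require Import all_classical all_reals all_analysis.
From mathcomp Require Import measurable_realfun.
From mathcomp Require Import spectral sesquilinear complex.
From mathcomp Require Import mxtens.
From mathcomp Require Import ring lra.

Set Implicit Arguments.
Unset Strict Implicit.
Unset Printing Implicit Defensive.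

Import Order.TTheory GRing.Theory Num.Theory.
Import numFieldNormedType.Exports.

Local Open Scope classical_set_scope.
Local Open Scope ring_scope.

(** * Symmetric matrices and Schur complements *)

(** The admissible curves shape the lower bound. They are only piecewise differentiable, so their
    derivatives may be discontinuous and non-integrable; [le_integral_derive], a one-sided
    inequality, replaces the fundamental theorem of calculus. The calibrating function must be
    differentiable along all such curves: ordered eigenvalues may fail to be where they cross,
    whereas pivots are rational functions of the entries and positive on the whole cone. They still
    see the full distance because a congruence makes the geodesic diagonal, where pivots and
    eigenvalues coincide.

    The moment generating function replaces a direct computation of moments of the inverse of X: the
    normalization, known for every parameter, already contains them. Its second derivative is
    reached through symmetric second differences and dominated convergence, with exponential moments
    as majorants.

    The recursion on the dimension keeps n because the Gaussian integral over the first column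
    contributes (det S)^(1/2), which lowers the exponent (n + m + 1)/2 to that of the next
    dimension. The condition n >= m makes the parameters (n - j)/2, j < m, of the inverse Gamma
    integrals positive. *)

Lemma symmetric_eigenvalue (R : realType) (m : nat) (A : 'M[R]_m.+1) :
  A^T = A -> exists a : R, eigenvalue A a.
Proof.
(* Over the complex numbers the matrix is Hermitian, so its spectral values are real. Characteristic
   polynomials commute with the embedding of R, hence such a value is already a root over R. *)
move=> As; pose B := map_mx (real_complex R) A.
have Bh : B \is hermsymmx.
  apply/is_hermitianmxP; rewrite expr0 scale1r.
  apply/matrixP => i j; rewrite !mxE /= -[in LHS]As mxE.
  by apply/eqP; rewrite eq_complex /= oppr0 !eqxx.
have /hermitian_normalmx /orthomx_spectralP := Bh.
have /mxOverP/(_ 0 0) := hermitian_spectral_diag_real Bh.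
set s := spectral_diag B; set P := spectralmx B => sr eB.
have Pu : P \in unitmx by exact: spectral_unit.
have : eigenvalue B (s 0 0).
  apply/eigenvalueP; exists (row 0 P).
    rewrite eB !mulmxA -!row_mul mulmxV // mul1mx.
    by rewrite row_mul row_diag_mx -scalemxAl -rowE.
  apply: contraL Pu => /eqP r0; rewrite unitmxE (expand_det_row _ 0) big1 ?unitr0 // => j _.
  by move: r0 => /rowP/(_ j); rewrite !mxE => ->; rewrite mul0r.
rewrite eigenvalue_root_char -(RRe_real sr) -map_char_poly fmorph_root.
by rewrite -eigenvalue_root_char => h; exists (complex.Re (s 0 0)).
Qed.

Lemma sqnorm_ge0 (R : realType) (n : nat) (w : 'cV[R]_n) :
  0 <= (w^T *m w) 0 0.
Proof. by rewrite mxE sumr_ge0 // => i _; rewrite mxE -expr2 sqr_ge0. Qed.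

Lemma sqnorm_eq0 (R : realType) (n : nat) (w : 'cV[R]_n) :
  ((w^T *m w) 0 0 == 0) = (w == 0).
Proof.
apply/eqP/eqP => [|->]; last by rewrite mulmx0 mxE.
rewrite mxE => /eqP; rewrite psumr_eq0 => [/allP w0|i _]; last first.
  by rewrite mxE -expr2 sqr_ge0.
apply/colP => i; have := w0 i (mem_index_enum _).
by rewrite !mxE -expr2 sqrf_eq0 => /eqP.
Qed.

(** The reflection in the hyperplane orthogonal to e - v exchanges the unit vectors e and v; for v =
    e the identity serves. *)
Lemma householder (R : realType) (n : nat) (v : 'cV[R]_n.+1) :
  v^T *m v = 1%:M ->
  exists Q : 'M[R]_n.+1, [/\ Q^T = Q, Q *m Q = 1%:M & Q *m delta_mx 0 0 = v].
Proof.
move=> v1; pose e : 'cV[R]_n.+1 := delta_mx 0 0; pose w := e - v.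
have [w0|wN0] := eqVneq w 0.
  exists 1%:M; rewrite trmx1 mul1mx; split => //.
  by apply/eqP; rewrite mul1mx -subr_eq0 -/e -/w w0.
have e1 : e^T *m e = 1%:M.
  by rewrite trmx_delta mul_delta_mx; apply/matrixP => i j; rewrite !mxE !ord1.
have ev : e^T *m v = (v 0 0)%:M.
  by rewrite trmx_delta -rowE; apply/matrixP => i j; rewrite !mxE !ord1.
have ve : v^T *m e = (v 0 0)%:M.
  by rewrite -[LHS]trmxK trmx_mul trmxK ev tr_scalar_mx.
(* c is |w|^2. Since w^T e = c/2, the reflection subtracts exactly w from e. *)
pose c := 2 - 2 * v 0 0.
have wT : w^T = e^T - v^T by rewrite /w linearB.
have wwE : w^T *m w = c%:M.
  rewrite wT /w mulmxBl !mulmxBr e1 v1 ev ve /c.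
  by rewrite -!raddfB /=; congr (_%:M); rewrite /c; ring.
have we : w^T *m e = (c / 2)%:M.
  rewrite wT mulmxBl e1 ve -raddfB /=; congr (_%:M); rewrite /c; by field.
have cN0 : c != 0 by rewrite -sqnorm_eq0 wwE mxE mulr1n in wN0.
exists (1%:M - (2 / c) *: (w *m w^T)); split.
- by rewrite linearB /= linearZ /= trmx_mul trmxK trmx1.
- rewrite mulmxBl mul1mx mulmxBr mulmx1 -!scalemxAl -!scalemxAr mulmxA.
  rewrite -(mulmxA w) wwE mul_mx_scalar -scalemxAl !scalerA.
  have -> : 2 / c * (2 / c * c) = 2 / c + 2 / c by field.
  by rewrite scalerDl; apply/matrixP => i j; rewrite !mxE; ring.
- rewrite mulmxBl mul1mx -scalemxAl -mulmxA we mul_mx_scalar scalerA.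
  have -> : 2 / c * (c / 2) = 1 by field.
  by rewrite scale1r /w opprB addrCA subrr addr0.
Qed.

Lemma diag_mx_row_mx (R : realType) (p q : nat) (d : 'rV[R]_p) (e : 'rV[R]_q) :
  diag_mx (row_mx d e) = block_mx (diag_mx d) 0 0 (diag_mx e).
Proof.
apply/matrixP => i j; rewrite !mxE.
case: (splitP i) => k ik; rewrite !mxE; case: (splitP j) => l jl; rewrite !mxE.
- have -> : i = lshift q k by exact/val_inj.
  have -> : j = lshift q l by exact/val_inj.
  by rewrite (inj_eq (@lshift_inj _ _)).
- by rewrite -val_eqE /= ik jl ltn_eqF // ltn_addr.
- by rewrite -val_eqE /= ik jl gtn_eqF // ltn_addr.
- have -> : i = rshift p k by exact/val_inj.
  have -> : j = rshift p l by exact/val_inj.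
  by rewrite (inj_eq (@rshift_inj _ _)).
Qed.

(** Deflation: conjugating by the reflection that takes e_0 to a unit eigenvector makes the first
    column a multiple of e_0, symmetry clears the first row, and induction treats the remaining
    block. *)
Lemma real_spectral (R : realType) (m : nat) (A : 'M[R]_m) : A^T = A ->
  exists Q : 'M[R]_m, exists d : 'rV[R]_m,
    Q *m Q^T = 1%:M /\ A = Q *m diag_mx d *m Q^T.
Proof.
elim: m A => [A _|m IHm A As].
  by exists 1%:M, 0; split; apply/matrixP => -[].
have [a /eigenvalueP[u uA uN0]] := symmetric_eigenvalue As.
pose s := (u *m u^T) 0 0.
have s_gt0 : 0 < s.
  by rewrite /s -[X in X *m _]trmxK lt_neqAle eq_sym sqnorm_eq0 sqnorm_ge0 trmx_eq0 uN0.
pose v := (Num.sqrt s)^-1 *: u^T.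
have v1 : v^T *m v = 1%:M.
  have vT : v^T = (Num.sqrt s)^-1 *: u by rewrite /v linearZ /= trmxK.
  rewrite vT /v -scalemxAl -scalemxAr scalerA -invfM.
  rewrite -expr2 sqr_sqrtr ?ltW // [u *m _]mx11_scalar -/s.
  by rewrite -scalemx1 scalerA mulVf ?scale1r // gt_eqF.
have Av : A *m v = a *: v.
  by rewrite /v -scalemxAr -[A in LHS]As -trmx_mul uA linearZ /= !scalerA mulrC.
have [Q [Qs QQ Qe]] := householder v1.
have [B eB] : exists B, B = Q *m A *m Q by eexists.
have Bs : B^T = B by rewrite eB !trmx_mul Qs As mulmxA.
have Be : B *m delta_mx 0 0 = a *: (delta_mx 0 0 : 'cV_m.+1).
  by rewrite eB -mulmxA Qe -mulmxA Av -Qe -scalemxAr mulmxA QQ mul1mx.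
pose C : 'M[R]_m := drsubmx (B : 'M[R]_(1 + m)).
have Cs : C^T = C by rewrite /C trmx_drsub Bs.
have BE : B = block_mx a%:M 0 0 C :> 'M[R]_(1 + m).
  have B0 i : B i 0 = a *+ (i == 0).
    have /colP/(_ i) := Be; rewrite -colE !mxE => ->.
    by rewrite eqxx andbT mulr_natr.
  rewrite -[LHS](@submxK _ 1 m 1 m); congr block_mx; apply/matrixP => i j.
  - by rewrite !mxE !ord1 lshift0 B0 eqxx.
  - by rewrite !mxE -Bs mxE !ord1 lshift0 B0 .
  - by rewrite !mxE !ord1 lshift0 B0.
have [P [d [PP CE]]] := IHm C Cs.
pose P1 : 'M[R]_(1 + m) := block_mx 1%:M 0 0 P.
have P1T : P1^T = block_mx 1%:M 0 0 P^T by rewrite tr_block_mx !trmx0 trmx1.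
have P1P1 : P1 *m P1^T = 1%:M.
  rewrite P1T mulmx_block !mulmx0 !mul0mx !addr0 !add0r mul1mx PP.
  by rewrite -scalar_mx_block.
have P1B : P1 *m diag_mx (row_mx (a%:M : 'rV_1) d) *m P1^T = B.
  rewrite P1T diag_mx_row_mx !mulmx_block !mulmx0 !mul0mx !addr0 !add0r mul1mx.
  rewrite mulmx1 !mul0mx -CE BE; congr block_mx.
  by apply/matrixP => i j; rewrite !mxE !ord1.
have AB : A = Q *m B *m Q by rewrite eB !mulmxA QQ mul1mx -mulmxA QQ mulmx1.
exists (Q *m P1), (row_mx (a%:M : 'rV_1) d); split.
  by rewrite trmx_mul Qs mulmxA -(mulmxA Q) P1P1 mulmx1.
by rewrite AB -P1B trmx_mul Qs !mulmxA.
Qed.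

(** * Schur complements, positivity and the affine-invariant quadratic form *)

Definition schur (R : realType) (m : nat) (A : 'M[R]_(1 + m)) : 'M[R]_m :=
  drsubmx A - (A 0 0)^-1 *: (dlsubmx A *m ursubmx A).

Definition schur_elim (R : realType) (m : nat) (A : 'M[R]_(1 + m)) : 'cV[R]_m :=
  (A 0 0)^-1 *: dlsubmx A.

Definition unitri (R : realType) (m : nat) (v : 'cV[R]_m) : 'M[R]_(1 + m) :=
  block_mx 1%:M 0 v 1%:M.

Lemma unitriD (R : realType) (m : nat) (v w : 'cV[R]_m) :
  unitri v *m unitri w = unitri (v + w).
Proof. by rewrite mulmx_block !(mulmx1, mul1mx, mulmx0, mul0mx, addr0, add0r). Qed.

Lemma unitri0 (R : realType) (m : nat) : unitri (0 : 'cV[R]_m) = 1%:M.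
Proof. by rewrite /unitri -scalar_mx_block. Qed.

Lemma unitri_unit (R : realType) (m : nat) (v : 'cV[R]_m) : unitri v \in unitmx.
Proof. by rewrite unitmxE det_lblock !det1 mulr1 unitr1. Qed.

Lemma invmx_unitri (R : realType) (m : nat) (v : 'cV[R]_m) :
  invmx (unitri v) = unitri (- v).
Proof.
by rewrite -[LHS]mulmx1 -unitri0 -(subrr v) -unitriD mulmxA mulVmx ?unitri_unit // mul1mx.
Qed.

Lemma tr_unitri (R : realType) (m : nat) (v : 'cV[R]_m) :
  (unitri v)^T = block_mx 1%:M v^T 0 1%:M.
Proof. by rewrite tr_block_mx !trmx1 trmx0. Qed.

Lemma unitri_congr (R : realType) (m : nat) (v : 'cV[R]_m) (a : R)
    (b : 'rV[R]_m) (c : 'cV[R]_m) (S : 'M[R]_m) :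
  unitri v *m block_mx a%:M b c S *m (unitri v)^T =
  block_mx a%:M (a *: v^T + b) (a *: v + c)
    (a *: (v *m v^T) + c *m v^T + v *m b + S).
Proof.
rewrite tr_unitri mulmx_block !(mul0mx, mul1mx, addr0) mulmx_block.
rewrite !(mulmx0, mulmx1, addr0) mul_scalar_mx mul_mx_scalar.
by rewrite mulmxDl -scalemxAl !addrA.
Qed.

Lemma block_mx11 (R : realType) (m : nat) (A : 'M[R]_(1 + m)) :
  A = block_mx (A 0 0)%:M (ursubmx A) (dlsubmx A) (drsubmx A).
Proof.
rewrite -[LHS]submxK; congr block_mx.
by apply/matrixP => i j; rewrite !mxE !ord1 !lshift0.
Qed.

(** One step of the LDL^T factorization. The outer factors are unipotent and act by congruence, so
    determinants and positivity can be read off the block diagonal factor. *)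
Lemma schurE (R : realType) (m : nat) (A : 'M[R]_(1 + m)) :
  A^T = A -> A 0 0 != 0 ->
  A = unitri (schur_elim A) *m block_mx (A 0 0)%:M 0 0 (schur A)
      *m (unitri (schur_elim A))^T.
Proof.
move=> As a0; rewrite unitri_congr !(mul0mx, mulmx0, addr0).
rewrite {1}[LHS]block_mx11 /schur_elim; congr block_mx.
- by rewrite linearZ /= scalerA mulfV // scale1r trmx_dlsub As.
- by rewrite scalerA mulfV // scale1r.
- rewrite linearZ /= -scalemxAl -scalemxAr !scalerA mulfV // mul1r.
  by rewrite /schur trmx_dlsub As addrC subrK.
Qed.

Lemma schur_sym (R : realType) (m : nat) (A : 'M[R]_(1 + m)) :
  A^T = A -> (schur A)^T = schur A.
Proof.
move=> As; rewrite /schur linearB /= linearZ /= trmx_mul trmx_drsub trmx_dlsub.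
by rewrite trmx_ursub As.
Qed.

Lemma det_schur (R : realType) (m : nat) (A : 'M[R]_(1 + m)) :
  A^T = A -> A 0 0 != 0 -> \det A = A 0 0 * \det (schur A).
Proof.
move=> As a0; rewrite {1}(schurE As a0) !det_mulmx det_tr !det_lblock !det1.
by rewrite !mul1r mulr1 det_scalar1.
Qed.

Lemma posdef_sym (R : realType) (m : nat) (A : 'M[R]_m) : posdef A -> A^T = A.
Proof. by case. Qed.

Lemma posdef_unit (R : realType) (m : nat) (A : 'M[R]_m) :
  posdef A -> A \in unitmx.
Proof.
move=> [As Ap]; rewrite -row_free_unit -kermx_eq0; apply/rowV0P => v.
move/sub_kermxP => vA; apply/eqP; apply: contraT => vN0.
have := Ap v^T; rewrite trmx_eq0 => /(_ vN0).
by rewrite trmxK vA mul0mx mxE ltxx.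
Qed.

Lemma posdef_congr (R : realType) (m : nat) (P A : 'M[R]_m) :
  P \in unitmx -> posdef A -> posdef (P *m A *m P^T).
Proof.
move=> Pu [As Ap]; split; first by rewrite !trmx_mul trmxK As mulmxA.
move=> x xN0; have := Ap (P^T *m x); rewrite trmx_mul trmxK !mulmxA; apply.
apply: contra xN0 => /eqP h; apply/eqP.
by rewrite -[x]mul1mx -(@mulVmx _ _ P^T) ?unitmx_tr // -mulmxA h mulmx0.
Qed.

Lemma posdef_congrE (R : realType) (m : nat) (P A : 'M[R]_m) :
  P \in unitmx -> posdef (P *m A *m P^T) <-> posdef A.
Proof.
move=> Pu; split=> [h|]; last exact: posdef_congr.
have := @posdef_congr _ _ (invmx P) _ _ h; rewrite unitmx_inv => /(_ Pu).
by rewrite !mulmxA mulVmx // mul1mx -mulmxA -trmx_mul mulVmx // trmx1 mulmx1.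
Qed.

Lemma quad_block (R : realType) (m : nat) (a : R) (S : 'M[R]_m)
    (x : 'cV[R]_1) (y : 'cV[R]_m) :
  ((col_mx x y)^T *m block_mx a%:M 0 0 S *m col_mx x y) 0 0 =
  a * x 0 0 ^+ 2 + (y^T *m S *m y) 0 0.
Proof.
rewrite tr_col_mx mul_row_block !(mulmx0, addr0, add0r) mul_row_col.
rewrite mxE mul_mx_scalar -scalemxAl mxE; congr (_ * _ + _).
by rewrite mxE big_ord1 mxE expr2.
Qed.

Lemma posdef_block (R : realType) (m : nat) (a : R) (S : 'M[R]_m) :
  posdef (block_mx a%:M 0 0 S : 'M[R]_(1 + m)) <-> 0 < a /\ posdef S.
Proof.
split=> [[bs bp]|[a0 [Ss Sp]]].
  split; last split.
  - have := bp (col_mx 1%:M 0); rewrite quad_block mulmx0 !mxE /= mulr1n.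
    rewrite expr1n mulr1 addr0; apply; rewrite col_mx_eq0 negb_and.
    by rewrite (_ : 1%:M != 0) //; exact: (oner_neq0 'M[R]_1).
  - by move: bs; rewrite tr_block_mx => /eq_block_mx[].
  move=> x xN0; have := bp (col_mx 0 x); rewrite quad_block mxE expr0n mulr0 add0r.
  by apply; rewrite col_mx_eq0 negb_and xN0 orbT.
split; first by rewrite tr_block_mx !trmx0 Ss tr_scalar_mx.
move=> x; rewrite -[x]vsubmxK quad_block col_mx_eq0 negb_and => xN0.
have [u0|uN0] := eqVneq (dsubmx x) 0.
  rewrite u0 mulmx0 [X in _ + X]mxE addr0 pmulr_rgt0 // exprn_even_gt0 //=.
  move: xN0; rewrite u0 eqxx orbF; apply: contra => /eqP h.
  by apply/eqP/colP => i; rewrite ord1 h [RHS]mxE.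
by rewrite ltr_wpDl ?Sp // mulr_ge0 ?sqr_ge0 ?ltW.
Qed.

Lemma posdef00 (R : realType) (m : nat) (A : 'M[R]_m.+1) : posdef A -> 0 < A 0 0.
Proof.
move=> [_ /(_ (delta_mx 0 0))]; rewrite trmx_delta -rowE -colE !mxE; apply.
by apply/eqP => /colP/(_ 0)/eqP; rewrite !mxE !eqxx oner_eq0.
Qed.

Lemma posdef_schur (R : realType) (m : nat) (A : 'M[R]_(1 + m)) : A^T = A ->
  posdef A <-> 0 < A 0 0 /\ posdef (schur A).
Proof.
move=> As; split=> [Ap|[a0 Sp]].
  have a0 := posdef00 Ap; split=> //; move: Ap.
  rewrite {1}(schurE As (lt0r_neq0 a0)) => /posdef_congrE.
  by rewrite unitri_unit => /(_ isT)/posdef_block[].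
rewrite (schurE As (lt0r_neq0 a0)); apply/posdef_congrE; first exact: unitri_unit.
exact/posdef_block.
Qed.

Lemma posdef_diag (R : realType) (m : nat) (d : 'rV[R]_m) :
  posdef (diag_mx d) <-> forall i, 0 < d 0 i.
Proof.
have dE (x : 'cV[R]_m) :
    (x^T *m diag_mx d *m x) 0 0 = \sum_i d 0 i * x i 0 ^+ 2.
  rewrite mul_mx_diag mxE; apply: eq_bigr => i _.
  by rewrite !mxE mulrC mulrA mulrC -expr2.
split=> [[_ dp] i|dp].
  have := dp (delta_mx i 0); rewrite dE (bigD1 i) //= big1 => [|j ji]; last first.
    by rewrite mxE (negbTE ji) expr0n mulr0.
  rewrite mxE !eqxx expr1n mulr1 addr0; apply.
  by apply/eqP => /colP/(_ i)/eqP; rewrite !mxE !eqxx oner_eq0.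
split; first exact: tr_diag_mx.
move=> x xN0; rewrite dE lt_neqAle eq_sym sumr_ge0 ?andbT => [|i _]; last first.
  by rewrite mulr_ge0 ?sqr_ge0 ?ltW.
apply: contra xN0; rewrite psumr_eq0 => [/allP h|i _]; last first.
  by rewrite mulr_ge0 ?sqr_ge0 ?ltW.
apply/eqP/colP => i; have := h i (mem_index_enum _).
by rewrite mulf_eq0 gt_eqF //= sqrf_eq0 mxE => /eqP.
Qed.

(** First A = P P^T with P = Q D^(1/2). An orthogonal diagonalization of P^-1 H P^-T can then be
    absorbed into P, since an orthogonal factor on the right leaves P P^T unchanged. *)
Lemma simultaneous_diag (R : realType) (m : nat) (A H : 'M[R]_m) :
  posdef A -> H^T = H ->
  exists P : 'M[R]_m, exists d : 'rV[R]_m,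
    [/\ P \in unitmx, A = P *m P^T & H = P *m diag_mx d *m P^T].
Proof.
move=> Ap Hs; have [Q [d [QQ AE]]] := real_spectral (posdef_sym Ap).
have Qu : Q \in unitmx by case/mulmx1_unit: QQ.
have dp : forall i, 0 < d 0 i.
  by apply/posdef_diag; apply/(posdef_congrE _ Qu); rewrite -AE.
pose e : 'rV[R]_m := \row_i Num.sqrt (d 0 i).
have ee : diag_mx e *m diag_mx e = diag_mx d.
  rewrite mulmx_diag; congr diag_mx; apply/rowP => i.
  by rewrite !mxE -expr2 sqr_sqrtr // ltW.
have eu : diag_mx e \in unitmx.
  apply/posdef_unit/posdef_diag => i; by rewrite mxE sqrtr_gt0.
pose P := Q *m diag_mx e.
have Pu : P \in unitmx by rewrite unitmx_mul Qu.
have AP : A = P *m P^T.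
  by rewrite /P trmx_mul tr_diag_mx mulmxA -(mulmxA Q) ee.
pose K := invmx P *m H *m (invmx P)^T.
have Ks : K^T = K by rewrite /K !trmx_mul trmxK Hs mulmxA.
have HK : H = P *m K *m P^T.
  rewrite /K !mulmxA mulmxV // mul1mx -mulmxA -trmx_mul mulmxV // trmx1.
  by rewrite mulmx1.
have [Q' [f [QQ' KE]]] := real_spectral Ks.
exists (P *m Q'), f; split.
- by rewrite unitmx_mul Pu; case/mulmx1_unit: QQ'.
- by rewrite trmx_mul mulmxA -(mulmxA P) QQ' mulmx1.
- by rewrite trmx_mul HK KE !mulmxA.
Qed.

(** The squared length of the tangent vector H at A in the affine-invariant metric. *)
Definition mnorm2 (R : realType) (m : nat) (A H : 'M[R]_m) : R :=
  \tr (invmx A *m H *m (invmx A *m H)).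

Lemma invmx_congr (R : realType) (m : nat) (P A : 'M[R]_m) :
  P \in unitmx -> A \in unitmx ->
  invmx (P *m A *m P^T) = (invmx P)^T *m invmx A *m invmx P.
Proof.
move=> Pu Au; have PAu : P *m A *m P^T \in unitmx.
  by rewrite !unitmx_mul unitmx_tr Pu Au.
have PT : P^T *m (invmx P)^T = 1%:M by rewrite -trmx_mul mulVmx // trmx1.
have h : P *m A *m P^T *m ((invmx P)^T *m invmx A *m invmx P) = 1%:M.
  by rewrite -!mulmxA (mulmxA P^T) PT mul1mx (mulmxA A) mulmxV // mul1mx mulmxV.
by rewrite -[LHS]mulmx1 -h mulKmx.
Qed.

Lemma mnorm2_congr (R : realType) (m : nat) (P A H : 'M[R]_m) :
  P \in unitmx -> A \in unitmx ->
  mnorm2 (P *m A *m P^T) (P *m H *m P^T) = mnorm2 A H.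
Proof.
move=> Pu Au; rewrite /mnorm2 invmx_congr //.
have -> : (invmx P)^T *m invmx A *m invmx P *m (P *m H *m P^T) =
    (invmx P)^T *m (invmx A *m H) *m P^T.
  by rewrite !mulmxA mulmxKV.
have PT : P^T *m (invmx P)^T = 1%:M by rewrite -trmx_mul mulVmx // trmx1.
move: (invmx P)^T PT (invmx A *m H) => L PT M.
have -> : L *m M *m P^T *m (L *m M *m P^T) = L *m (M *m M *m P^T).
  by rewrite !mulmxA -(mulmxA (L *m M)) PT mulmx1.
by rewrite mxtrace_mulC -!mulmxA PT mulmx1.
Qed.

Lemma mnorm2_diag (R : realType) (m : nat) (P : 'M[R]_m) (d : 'rV[R]_m) :
  P \in unitmx -> mnorm2 (P *m P^T) (P *m diag_mx d *m P^T) = \sum_i d 0 i ^+ 2.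
Proof.
move=> Pu; rewrite -{1}[P]mulmx1 mnorm2_congr ?unitmx1 //.
rewrite /mnorm2 invmx1 !mul1mx mulmx_diag mxtrace_diag.
by apply: eq_bigr => i _; rewrite mxE expr2.
Qed.

Lemma mnorm2_ge0 (R : realType) (m : nat) (A H : 'M[R]_m) :
  posdef A -> H^T = H -> 0 <= mnorm2 A H.
Proof.
move=> Ap Hs; have [P [d [Pu -> ->]]] := simultaneous_diag Ap Hs.
by rewrite mnorm2_diag // sumr_ge0 // => i _; rewrite sqr_ge0.
Qed.

Lemma posdef_inv (R : realType) (m : nat) (A : 'M[R]_m) :
  posdef A -> posdef (invmx A).
Proof.
move=> Ap; have Au := posdef_unit Ap.
rewrite -[invmx A]mulmx1 -(mulmxV Au) mulmxA -[X in _ *m X]trmxK trmx_inv (posdef_sym Ap).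
by apply: posdef_congr; rewrite ?unitmx_inv.
Qed.

Lemma invmx_block_diag (R : realType) (m : nat) (a : R) (S : 'M[R]_m) :
  a != 0 -> S \in unitmx ->
  invmx (block_mx a%:M 0 0 S : 'M[R]_(1 + m)) = block_mx a^-1%:M 0 0 (invmx S).
Proof.
move=> a0 Su; set B := block_mx _ _ _ _; set C := block_mx _ _ _ _.
have BC : B *m C = 1%:M.
  rewrite /B /C mulmx_block !(mulmx0, mul0mx, addr0, add0r) mulmxV //.
  by rewrite -scalar_mxM mulfV // -scalar_mx_block.
have [Bu _] := mulmx1_unit BC.
by rewrite -[LHS]mulmx1 -BC mulKmx.
Qed.

Lemma mnorm2_block (R : realType) (m : nat) (a : R) (S : 'M[R]_m) (h : R)
    (k : 'cV[R]_m) (K : 'M[R]_m) :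
  a != 0 -> S \in unitmx ->
  mnorm2 (block_mx a%:M 0 0 S : 'M[R]_(1 + m)) (block_mx h%:M k^T k K) =
  (h / a) ^+ 2 + 2 / a * (k^T *m invmx S *m k) 0 0 + mnorm2 S K.
Proof.
move=> a0 Su; rewrite /mnorm2 invmx_block_diag // !mulmx_block.
rewrite !(mulmx0, mul0mx, addr0, add0r) mxtrace_block !mxtraceD.
rewrite -!scalar_mxM mxtrace_scalar.
have h1 : \tr ((a^-1)%:M *m k^T *m (invmx S *m k)) =
    a^-1 * (k^T *m invmx S *m k) 0 0.
  by rewrite mul_scalar_mx -scalemxAl mxtraceZ mulmxA /mxtrace big_ord1.
rewrite [X in _ + (X + _)]mxtrace_mulC h1.
by rewrite mulr1n; field.
Qed.

(** The differential of [schur] at A in the direction H. It is also the lower right block of L H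
    L^T, where L is the elimination matrix that makes L A L^T block diagonal. *)
Definition dschur (R : realType) (m : nat) (A H : 'M[R]_(1 + m)) : 'M[R]_m :=
  let v := schur_elim A in
  H 0 0 *: (v *m v^T) - dlsubmx H *m v^T - v *m ursubmx H + drsubmx H.

Lemma dschur_sym (R : realType) (m : nat) (A H : 'M[R]_(1 + m)) :
  H^T = H -> (dschur A H)^T = dschur A H.
Proof.
move=> Hs; rewrite /dschur; move: (schur_elim A) => v.
rewrite !(linearD, linearN, linearZ) /= !trmx_mul !trmxK.
rewrite trmx_drsub trmx_dlsub trmx_ursub Hs.
by congr (_ + _); rewrite -!addrA; congr (_ + _); rewrite addrC.
Qed.

(* The factor 1/a times a positive quadratic form that is dropped here is the
   contribution of the variation of the eliminated column. *)
Lemma mnorm2_schur (R : realType) (m : nat) (A H : 'M[R]_(1 + m)) :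
  posdef A -> H^T = H ->
  (H 0 0 / A 0 0) ^+ 2 + mnorm2 (schur A) (dschur A H) <= mnorm2 A H.
Proof.
move=> Ap Hs; have As := posdef_sym Ap.
have [a0 Sp] := (posdef_schur As).1 Ap.
set L := unitri (- schur_elim A).
have Lu : L \in unitmx by exact: unitri_unit.
rewrite -(mnorm2_congr H Lu (posdef_unit Ap)).
have -> : L *m A *m L^T = block_mx (A 0 0)%:M 0 0 (schur A).
  rewrite {1}(schurE As (lt0r_neq0 a0)) /L -invmx_unitri !mulmxA.
  rewrite mulVmx ?unitri_unit // mul1mx -mulmxA -trmx_mul mulVmx ?unitri_unit //.
  by rewrite trmx1 mulmx1.
rewrite [X in L *m X *m _]block_mx11 /L unitri_congr.
set k := _ + dlsubmx H.
have <- : k^T = H 0 0 *: (- schur_elim A)^T + ursubmx H.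
  by rewrite /k linearD linearZ /= trmx_dlsub Hs.
have -> : H 0 0 *: (- schur_elim A *m (- schur_elim A)^T) +
    dlsubmx H *m (- schur_elim A)^T + - schur_elim A *m ursubmx H + drsubmx H =
    dschur A H.
  by rewrite linearN /= !mulmxN !mulNmx opprK.
rewrite mnorm2_block ?lt0r_neq0 // ?posdef_unit // lerD2r lerDl.
apply: mulr_ge0; first by rewrite divr_ge0 // ltW.
have [_ Sq] := posdef_inv Sp; have [->|kN0] := eqVneq k 0.
  by rewrite mulmx0 mxE.
exact/ltW/Sq.
Qed.

Lemma schur_entry (R : realType) (m : nat) (A : 'M[R]_m.+1) (i j : 'I_m) :
  schur (A : 'M[R]_(1 + m)) i j = A (lift ord0 i) (lift ord0 j) -
    (A 0 0)^-1 * (A (lift ord0 i) 0 * A 0 (lift ord0 j)).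
Proof. by rewrite !mxE big_ord1 !mxE !rshift1 !lshift0. Qed.

Lemma dschur_entry (R : realType) (m : nat) (A H : 'M[R]_m.+1) (i j : 'I_m) :
  A^T = A ->
  dschur (A : 'M[R]_(1 + m)) (H : 'M[R]_(1 + m)) i j =
  let u k := A (lift ord0 k) 0 / A 0 0 in
  let v k := A 0 (lift ord0 k) / A 0 0 in
  H 0 0 * (u i * v j) - H (lift ord0 i) 0 * v j - u i * H 0 (lift ord0 j)
  + H (lift ord0 i) (lift ord0 j).
Proof.
move=> As; rewrite !mxE !big_ord1 !mxE !rshift1 !lshift0 /=.
by rewrite -[in A (lift ord0 j) 0]As !mxE ![(A 0 0)^-1 * _]mulrC.
Qed.

(* Junk value 1 for [k >= m]. *)
Fixpoint pivot (R : realType) (m : nat) : 'M[R]_m -> nat -> R :=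
  match m with
  | 0 => fun _ _ => 1
  | m'.+1 => fun A k => if k is k'.+1 then pivot (schur (A : 'M[R]_(1 + m'))) k'
                        else A ord0 ord0
  end.

Lemma pivot_gt0 (R : realType) (m : nat) (A : 'M[R]_m) (k : nat) :
  posdef A -> 0 < pivot A k.
Proof.
elim: m A k => [|m IHm] A k Ap /=; first exact: ltr01.
have [a0 Sp] := (posdef_schur (posdef_sym Ap)).1 Ap.
by case: k => [|k] //; exact: IHm.
Qed.

Lemma pivot_diag (R : realType) (m : nat) (d : 'rV[R]_m) (k : 'I_m) :
  pivot (diag_mx d) k = d 0 k.
Proof.
elim: m d k => [d []//|m IHm] d k /=.
case: (unliftP ord0 k) => [j ->|->] /=; last by rewrite !mxE eqxx.
have -> : schur (diag_mx d : 'M[R]_(1 + m)) = diag_mx (\row_i d 0 (lift ord0 i)).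
  apply/matrixP => p q; rewrite !mxE big1 => [|i _]; last first.
    by rewrite !mxE ord1 -val_eqE /= mulr0n mul0r.
  by rewrite mulr0 subr0 !rshift1 (inj_eq lift_inj).
by rewrite add0n IHm mxE.
Qed.

(** The first pivot is the corner, with velocity [H 0 0]; the others are the pivots of the curve of
    Schur complements, whose velocity is [dschur]. Each level of the induction spends one instance
    of [mnorm2_schur]. *)
Lemma pivot_derive (R : realType) (m : nat) (c : R -> 'M[R]_m) (H : 'M[R]_m)
    (t : R) :
  (forall s, (c s)^T = c s) -> H^T = H ->
  (forall i j, is_derive t 1 (fun s => c s i j) (H i j)) -> posdef (c t) ->
  exists d : 'I_m -> R,
    (forall k : 'I_m, is_derive t 1 (fun s => pivot (c s) k) (d k)) /\
    \sum_k (d k / pivot (c t) k) ^+ 2 <= mnorm2 (c t) H.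
Proof.
elim: m c H => [|m IHm] c H cs Hs cH cp.
  by exists (fun=> 0); split=> [[]//|]; rewrite big_ord0 mnorm2_ge0.
have [a0 Sp] := (posdef_schur (cs t)).1 cp.
have [||||d [dP dle]] := IHm (fun s => schur (c s : 'M[R]_(1 + m))) (dschur (c t :
    'M[R]_(1 + m)) H).
- by move=> s; exact: schur_sym.
- exact: dschur_sym.
- move=> i j; rewrite dschur_entry //; under eq_fun do rewrite schur_entry.
  have D1 := is_deriveV (lt0r_neq0 a0) (cH 0 0).
  have D2 := is_deriveM (cH (lift ord0 i) 0) (cH 0 (lift ord0 j)).
  have D := is_deriveB (cH (lift ord0 i) (lift ord0 j)) (is_deriveM D1 D2).
  apply: is_derive_eq D _.
  have a0' := lt0r_neq0 a0; rewrite /= /GRing.scale /= mulrfctE.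
  by field.
- by [].
exists (fun k => if unlift ord0 k is Some j then d j else H 0 0); split.
  move=> k; case: unliftP => [j ->|->] /=; first exact: dP.
  exact: cH.
rewrite big_ord_recl unlift_none; apply: le_trans (mnorm2_schur cp Hs).
rewrite lerD2l; apply: le_trans dle.
by rewrite le_eqVlt; apply/orP; left; apply/eqP; apply: eq_bigr => k _; rewrite liftK.
Qed.

(** * Integrals of derivatives *)

Lemma ge0_integral_itv_split (R : realType) (h : R -> \bar R) (a b c : R) :
  a <= b -> b <= c -> measurable_fun `[a, c] h ->
  (forall x, x \in `[a, c] -> (0 <= h x)%E) ->
  (\int[lebesgue_measure]_(x in `[a, c]) h x =
   \int[lebesgue_measure]_(x in `[a, b]) h x +
   \int[lebesgue_measure]_(x in `[b, c]) h x)%E.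
Proof.
move=> ab bc mh h0.
have acE : `[a, c]%classic = `[a, b]%classic `|` `]b, c]%classic.
  by rewrite -itv_bndbnd_setU // bnd_simp.
have mbc : measurable_fun `]b, c] h.
  by apply: measurable_funS mh => //; rewrite acE; exact: subsetUr.
rewrite acE ge0_integral_setU //=.
- by congr (_ + _)%E; exact: integral_itv_obnd_cbnd.
- by move: mh; rewrite acE.
- move=> x H; apply: h0; rewrite in_itv /=.
  case: H; rewrite in_itv /= => /andP[ax xc]; first by rewrite ax (le_trans xc).
  by rewrite xc (le_trans ab (ltW ax)).
- apply/disj_setPS => x [] /=; rewrite !in_itv /= => /andP[_ xb] /andP[bx _].
  by move: xb; rewrite leNgt bx.
Qed.

(** A connectedness argument on the set of x for which the bound holds on [[u, x]]. Its supremum s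
    belongs to it by the local bound to the left of s, and s < v would contradict the local bound to
    the right of s. *)
Lemma local_growth_integral (R : realType) (u v : R) (f : R -> R)
    (h : R -> \bar R) :
  u <= v -> measurable_fun `[u, v] h ->
  (forall x, x \in `[u, v] -> (0 <= h x)%E) ->
  (forall x, x \in `[u, v] -> exists2 r : R, 0 < r &
     forall y, y \in `[u, v] -> `|y - x| < r ->
       (x <= y -> ((f y - f x)%:E <=
         \int[lebesgue_measure]_(z in `[x, y]) h z)%E) /\
       (y <= x -> ((f x - f y)%:E <=
         \int[lebesgue_measure]_(z in `[y, x]) h z)%E)) ->
  ((f v - f u)%:E <= \int[lebesgue_measure]_(z in `[u, v]) h z)%E.
Proof.
move=> uv mh h0 loc.
pose T := [set x : R | x \in `[u, v] /\
  ((f x - f u)%:E <= \int[lebesgue_measure]_(z in `[u, x]) h z)%E].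
have step x y : x <= y -> y \in `[u, v] -> T x ->
    ((f y - f x)%:E <= \int[lebesgue_measure]_(z in `[x, y]) h z)%E -> T y.
  move=> xy yuv [xuv Tx] H; split=> //.
  move: xuv yuv; rewrite !in_itv /= => /andP[ux xv] /andP[uy yv].
  rewrite (@ge0_integral_itv_split _ _ u x y) //.
  - have -> : f y - f u = (f x - f u) + (f y - f x) by ring.
    by rewrite EFinD; apply: leeD.
  - apply: measurable_funS mh => //; apply: subset_itvl; by rewrite bnd_simp.
  - move=> z; rewrite in_itv /= => /andP[uz zy]; apply: h0.
    by rewrite in_itv /= uz (le_trans zy).
have Tu : T u.
  split; first by rewrite in_itv /= lexx.
  by rewrite subrr integral_ge0 // => z /= zu; apply: h0; move: zu; rewrite !in_itv /=
      => /andP[-> /le_trans ->].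
have Tub : ubound T v by move=> x [] /=; rewrite in_itv /= => /andP[].
have supT : has_sup T by split; [exists u|exists v].
set s := sup T.
have suv : s \in `[u, v].
  rewrite in_itv /=; apply/andP; split.
    by apply: sup_upper_bound.
  by apply: sup_le_ub => //; exists u.
have [r r0 Hr] := loc s suv.
have Ts : T s.
  have [x Tx sx] := sup_adherent r0 supT.
  have xs : x <= s by exact: sup_upper_bound.
  have xuv := Tx.1.
  have [|_ /(_ xs)] := Hr x xuv; last exact: step.
  by rewrite ler0_norm ?subr_le0 // opprB ltrBlDr -ltrBlDl.
have [->//|sv] := eqVneq v s; first exact: Ts.2.
have {}sv : s < v by move: suv; rewrite in_itv /= lt_neqAle eq_sym sv => /andP[].
pose y := Num.min v (s + r / 2).
have sy : s < y by rewrite lt_min sv ltrDl divr_gt0.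
have yuv : y \in `[u, v].
  move: suv; rewrite !in_itv /= => /andP[us _].
  by rewrite (le_trans us (ltW sy)) ge_min lexx.
have [|/(_ (ltW sy)) Hy _] := Hr y yuv.
  rewrite gtr0_norm ?subr_gt0 // ltrBlDl gt_min ltrD2l.
  by rewrite ltr_pdivrMr // ltr_pMr // ltr1n orbT.
have : y <= s by apply: sup_upper_bound => //; apply: step Ts Hy => //; exact: ltW.
by rewrite leNgt sy.
Qed.

Lemma nneseries_ge_term (R : realType) (f : nat -> \bar R) (n : nat) :
  (forall k, (0 <= f k)%E) -> (f n <= \sum_(0 <= k <oo) f k)%E.
Proof.
move=> f0; apply: le_trans (nneseries_lim_ge n.+1 _); last by move=> *; exact: f0.
by rewrite big_nat_recr //= leeDr // sume_ge0.
Qed.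

Lemma setIitvcc_split (R : realType) (u v : R) (phi : R -> R) (e : R) :
  0 < e -> (forall x, x \in `[u, v] -> 0 <= phi x) ->
  `[u, v]%classic = \bigcup_k
    (`[u, v]%classic `&` phi @^-1` `[k%:R * e, k.+1%:R * e[%classic).
Proof.
move=> e0 phi0; apply/seteqP; split=> [x xuv|x [k _ []//]].
have /andP[] := trunc_itv (divr_ge0 (phi0 x xuv) (ltW e0)).
set k := Num.trunc _ => k1 k2; exists k => //; split=> //=.
by rewrite in_itv /= -ler_pdivlMr // k1 -ltr_pdivrMr.
Qed.

(* [f'] need not be integrable.  By outer regularity of the level sets of [phi]
   there is a lower semicontinuous [h > phi] with almost the same integral, and
   increments of [f] are locally bounded by integrals of [h]. *)
Lemma le_integral_derive (R : realType) (u v : R) (f f' phi : R -> R) :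
  u <= v -> (forall t, t \in `[u, v] -> is_derive t 1 f (f' t)) ->
  measurable_fun `[u, v] phi -> (forall t, t \in `[u, v] -> 0 <= phi t) ->
  (forall t, t \in `[u, v] -> f' t <= phi t) ->
  ((f v - f u)%:E <= \int[lebesgue_measure]_(t in `[u, v]) (phi t)%:E)%E.
Proof.
move=> uv df mphi phi0 f'phi; apply/lee_addgt0Pr => e0 e0_gt0.
pose mu := @lebesgue_measure R.
pose D : set (measurableTypeR R) := `[u, v]%classic.
have mD : measurable D by exact: measurable_itv.
(* Rounding phi up to the next multiple of e costs at most e (v - u), and the open covers cost e in
   total: together e0. *)
pose e := e0 / (v - u + 1).
have vu1 : 0 < v - u + 1 by rewrite ltr_wpDl // subr_ge0.
have e_gt0 : 0 < e by rewrite divr_gt0.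
pose E k := D `&` phi @^-1` `[k%:R * e, k.+1%:R * e[%classic.
have mE k : measurable (E k).
  by apply: mphi => //; exact: measurable_itv.
have muDE k : (mu (E k) <= mu D)%E by apply: le_measure; rewrite ?inE //; exact: subIsetl.
have muD : mu D = (v - u)%:E.
  rewrite /mu /D lebesgue_measure_itv /= lte_fin.
  by case: ltP => // vu; rewrite (@le_anti _ _ u v) ?uv ?vu // subrr.
have muE k : (mu (E k) < +oo)%E by rewrite (le_lt_trans (muDE k)) // muD ltry.
pose c k := k.+1%:R * e.
have c_gt0 k : 0 < c k by rewrite mulr_gt0.
(* The excess of U_k over E_k will be weighted by c_k, which leaves e / 2^(k+1): a summable
   error. *)
have /choice[U HU] : forall k, exists U : set R,
    [/\ open U, E k `<=` U & (mu (U `\` E k) < (e / (2 ^ k.+1)%:R / c k)%:E)%E].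
  move=> k; apply: lebesgue_regularity_outer => //; first exact: mE.
  by rewrite !divr_gt0 // ltr0n expn_gt0.
have mU k : measurable (U k : set (measurableTypeR R)).
  by apply: open_measurable; case: (HU k).
pose h (x : R) : \bar R := (\sum_(0 <= k <oo) (c k)%:E * (\1_(U k) x)%:E)%E.
have h_ge0 x k : (0 <= (c k)%:E * (\1_(U k) x)%:E :> \bar R)%E.
  by rewrite mule_ge0 // lee_fin ltW.
have mh1 (B : set (measurableTypeR R)) k :
    measurable_fun B (fun x => ((c k)%:E * (\1_(U k) x)%:E)%E).
  apply: emeasurable_funM; first exact: measurable_cst.
  by apply/measurable_EFinP; exact: measurable_indic.
have mh (B : set (measurableTypeR R)) : measurable_fun B h.
  by apply: ge0_emeasurable_sum => // k _.
apply: (@le_trans _ _ (\int[mu]_(x in D) h x)%E).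
  apply: local_growth_integral => //; first exact: mh.
    by move=> x _; exact: nneseries_ge0.
  move=> x xuv; have [k _ [_ xEk]] : (\bigcup_k E k) x.
    by rewrite -setIitvcc_split.
  have [oU EU _] := HU k.
  have Ux : U k x by apply: EU.
  have f'c : f' x < c k.
    by apply: le_lt_trans (f'phi x xuv) _; move: xEk; rewrite /= in_itv /= => /andP[].
  (* Caratheodory's slope g satisfies f y - f x = g y (y - x) and is continuous at x with g x = f' x
     < c_k. Near x the slope thus stays below c_k while the points stay in the open set U_k, where h
     >= c_k. *)
  have /is_derive1_caratheodory[g [gE gc gx]] := df x xuv.
  have : \forall y \near x, g y < c k.
    by apply: (cvgr_lt _ gc); rewrite gx.
  have : \forall y \near x, U k y by exact: open_nbhs_nbhs.
  move=> near1 near2; have near12 : nbhs x (U k `&` (fun y => g y < c k)) by exact: filterI.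
  have [r /= r0 Hr] := (nbhs_ballP _ _).1 near12.
  have cint a b : a <= b -> (forall y, a <= y <= b -> U k y) ->
     ((c k * (b - a))%:E <= \int[mu]_(z in `[a, b]) h z)%E.
    move=> ab abU; apply: (@le_trans _ _ (\int[mu]_(z in `[a, b]) (c k)%:E)%E).
      rewrite integral_cst //= lebesgue_measure_itv /= lte_fin.
      case: ltP => // ba; rewrite (@le_anti _ _ a b) ?ab ?ba // subrr.
      by rewrite mulr0 mule0.
    apply: ge0_le_integral => //; first by move=> y _; rewrite lee_fin ltW.
    move=> y; rewrite /= in_itv /= => /abU yU.
    apply: le_trans (nneseries_ge_term k (h_ge0 y)).
    by rewrite indicE mem_set // mule1.
  exists r => // y yuv yr; split=> xy.
    apply: le_trans (cint x y xy _); last first.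
      move=> z /andP[xz zy]; apply: (Hr z _).1; rewrite /ball /= distrC.
      by rewrite (le_lt_trans _ yr) // !ger0_norm ?subr_ge0 ?lerB // (le_trans xz).
    rewrite lee_fin gE ler_wpM2r ?subr_ge0 // ltW //.
    by apply: (Hr y _).2; rewrite /ball /= distrC.
  apply: le_trans (cint y x xy _); last first.
    move=> z /andP[yz zx]; apply: (Hr z _).1; rewrite /ball /=.
    by rewrite (le_lt_trans _ yr) // distrC !ler0_norm ?subr_le0 // ?lerN2 ?lerB // (le_trans yz).
  rewrite lee_fin -opprB gE -mulrN opprB ler_wpM2r ?subr_ge0 // ltW //.
  by apply: (Hr y _).2; rewrite /ball /= distrC.
rewrite integral_nneseries //.
have mphie (B : set (measurableTypeR R)) : measurable B -> B `<=` D ->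
    measurable_fun B (fun x => (phi x + e)%:E).
  move=> mB BD; apply/measurable_EFinP; apply: measurable_funD => //.
  exact: measurable_funS mphi.
have phie0 x : D x -> (0 <= (phi x + e)%:E)%E.
  by move=> Dx; rewrite lee_fin addr_ge0 ?phi0 // ltW.
apply: (@le_trans _ _ (\sum_(0 <= k <oo)
   (\int[mu]_(x in E k) (phi x + e)%:E + (e / (2 ^ k.+1)%:R)%:E))%E).
  apply: lee_nneseries => [k _ _|k _].
    by apply: integral_ge0 => x _; exact: h_ge0.
  have [oU EU mUE] := HU k.
  rewrite ge0_integralZl_EFin //=; last 2 first.
    by apply/measurable_EFinP; exact: measurable_indic.
    exact: ltW.
  rewrite integral_indic //.
  apply: (@le_trans _ _ ((c k)%:E * (mu (E k) + (e / (2 ^ k.+1)%:R / c k)%:E))%E).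
    rewrite lee_pmul2l // ?lte_fin //.
    apply: (@le_trans _ _ (mu (E k `|` (U k `\` E k)))).
      apply: le_measure; rewrite ?inE //.
      - exact: measurableI.
      - by apply: measurableU => //; exact: measurableD.
      by move=> x [Ux _]; have [|] := pselect (E k x); [left|right].
    apply: le_trans (measureU2 lebesgue_measure (mE k) _) _.
      exact: measurableD.
    by apply: leeD2l; exact: ltW.
  rewrite ge0_muleDr //; last first.
    by rewrite lee_fin ltW // !divr_gt0 // ltr0n expn_gt0.
  rewrite -EFinM mulrC divfK ?gt_eqF //; apply: leeD2r.
  rewrite -integral_cst //=; apply: ge0_le_integral => //.
  - by move=> x _; rewrite lee_fin ltW.
  - by apply: mphie => //; exact: subIsetl.
  - move=> x [Dx]; rewrite /= in_itv /= => /andP[kx _].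
    by rewrite lee_fin /c -natr1 mulrDl mul1r lerD2r.
apply: le_trans (epsilon_trick _ _ _) _.
- by move=> k; apply: integral_ge0 => x [Dx _]; exact: phie0.
- exact: ltW.
rewrite -ge0_integral_bigcup //; last 3 first.
- rewrite -setIitvcc_split //; exact: mphie.
- by move=> x [k _ [Dx _]]; exact: phie0.
- apply/trivIsetP => i j _ _; apply: contraNeq => /set0P[x [[Dx]]] /=.
  rewrite !in_itv /= => xi [_ xj]; apply/eqP.
  have tr k : k%:R * e <= phi x < k.+1%:R * e -> Num.trunc (phi x / e) = k.
    by rewrite -ler_pdivlMr // -ltr_pdivrMr // => /truncn_def.
  by rewrite -(tr i xi) (tr j xj).
rewrite -setIitvcc_split //.
under eq_integral do rewrite EFinD.
rewrite ge0_integralD //; last 2 first.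
- exact/measurable_EFinP.
- by move=> x _; rewrite lee_fin ltW.
rewrite -addeA; apply: leeD2l; rewrite integral_cst // [X in (_ * X)%E]muD.
rewrite -EFinM -EFinD lee_fin.
by rewrite -[X in _ + X]mulr1 -mulrDr /e divfK // gt_eqF.
Qed.

(** * Affine-invariant lengths *)

Lemma measurable_invr (R : realType) (D : set R) : measurable_fun D (@GRing.inv R).
Proof.
(* Real powers are known to be measurable. The identity 1/x = x (x^2)^(-1) also holds at 0, where
   the inverse is 0 by convention. *)
apply: (@eq_measurable_fun _ _ _ _ _ (fun x : R => x * (x ^+ 2) `^ (-1))).
  move=> x _; rewrite powR_inv1 ?sqr_ge0 //.
  by have [->|x0] := eqVneq x 0; [rewrite mul0r invr0|field].
apply: measurable_funM; first exact: measurable_id.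
apply: (@measurableT_comp _ _ _ _ _ _ (@powR R ^~ (-1))) => //.
Qed.

Lemma measurable_funV (R : realType) (d : measure_display)
    (T : measurableType d) (D : set T) (f : T -> R) :
  measurable_fun D f -> measurable_fun D (fun x => (f x)^-1).
Proof.
by apply: (@measurableT_comp _ _ _ _ _ _ (@GRing.inv R)); exact: measurable_invr.
Qed.

Lemma measurable_sqrtr (R : realType) (D : set R) : measurable_fun D (@Num.sqrt R).
Proof.
apply: (@measurable_funS _ _ _ _ setT) => //.
by apply: nondecreasing_measurable => // x y; exact: ler_wsqrtr.
Qed.

Definition mx_measurable (R : realType) (d : measure_display)
    (T : measurableType d) (D : set T) (p q : nat) (F : T -> 'M[R]_(p, q)) :=
  forall i j, measurable_fun D (fun x => F x i j).

Lemma mx_measurable_cst (R : realType) (d : measure_display)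
    (T : measurableType d) (D : set T) (p q : nat) (A : 'M[R]_(p, q)) :
  mx_measurable D (fun=> A).
Proof. by move=> i j; exact: measurable_cst. Qed.

Lemma mx_measurableM (R : realType) (d : measure_display)
    (T : measurableType d) (D : set T) (p q r : nat)
    (F : T -> 'M[R]_(p, q)) (G : T -> 'M[R]_(q, r)) :
  mx_measurable D F -> mx_measurable D G ->
  mx_measurable D (fun x => F x *m G x).
Proof.
move=> mF mG i j; under eq_fun do rewrite mxE.
by apply: measurable_sum => k; exact: measurable_funM.
Qed.

Lemma measurable_det (R : realType) (d : measure_display)
    (T : measurableType d) (D : set T) (p : nat) (F : T -> 'M[R]_p) :
  mx_measurable D F -> measurable_fun D (fun x => \det (F x)).
Proof.
move=> mF; apply: measurable_sum => s.
apply: measurable_funM; first exact: measurable_cst.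
by apply: measurable_prod => i _; exact: mF.
Qed.

Lemma measurable_mxtrace (R : realType) (d : measure_display)
    (T : measurableType d) (D : set T) (p : nat) (F : T -> 'M[R]_p) :
  mx_measurable D F -> measurable_fun D (fun x => \tr (F x)).
Proof. by move=> mF; apply: measurable_sum => i; exact: mF. Qed.

Lemma mx_measurable_inv (R : realType) (d : measure_display)
    (T : measurableType d) (D : set T) (p : nat) (F : T -> 'M[R]_p) :
  (forall x, D x -> F x \in unitmx) -> mx_measurable D F ->
  mx_measurable D (fun x => invmx (F x)).
Proof.
move=> Fu mF i j.
apply: (@eq_measurable_fun _ _ _ _ _
    (fun x => (\det (F x))^-1 * cofactor (F x) j i)).
  by move=> x /set_mem Dx; rewrite /invmx Fu // !mxE.
apply: measurable_funM.
  by apply: measurable_funV; exact: measurable_det.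
apply: measurable_funM; first exact: measurable_cst.
apply: measurable_det => k l; under eq_fun do rewrite !mxE; exact: mF.
Qed.

Lemma measurable_mnorm2 (R : realType) (d : measure_display)
    (T : measurableType d) (D : set T) (p : nat) (F G : T -> 'M[R]_p) :
  (forall x, D x -> F x \in unitmx) -> mx_measurable D F ->
  mx_measurable D G -> measurable_fun D (fun x => mnorm2 (F x) (G x)).
Proof.
move=> Fu mF mG; apply: measurable_mxtrace.
by do !apply: mx_measurableM => //; exact: mx_measurable_inv.
Qed.

Lemma mx_measurable_schur (R : realType) (d : measure_display)
    (T : measurableType d) (D : set T) (p : nat) (F : T -> 'M[R]_p.+1) :
  mx_measurable D F -> mx_measurable D (fun x => schur (F x : 'M[R]_(1 + p))).
Proof.
move=> mF i j; under eq_fun do rewrite schur_entry.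
apply: measurable_funB; first exact: mF.
apply: measurable_funM.
  exact: measurable_funV.
by apply: measurable_funM; exact: mF.
Qed.

(** The definition of [posdef] quantifies over uncountably many vectors; the recursive criterion by
    corner and Schur complement involves finitely many measurable conditions. *)
Lemma measurable_posdef (R : realType) (d : measure_display)
    (T : measurableType d) (p : nat) (F : T -> 'M[R]_p) :
  (forall x, (F x)^T = F x) -> mx_measurable setT F ->
  measurable [set x | posdef (F x)].
Proof.
elim: p F => [|p IHp] F Fs mF.
  rewrite (_ : mkset _ = setT) //; apply/seteqP; split=> // x _.
  by split=> // y; rewrite (_ : y = 0) ?eqxx //; apply/matrixP => -[].
rewrite (_ : mkset _ = (fun x => F x 0 0) @^-1` `]0, +oo[ `&`
    [set x | posdef (schur (F x : 'M[R]_(1 + p)))]).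
  apply: measurableI; last first.
    by apply: IHp => [x|]; [exact: schur_sym|exact: mx_measurable_schur].
  by rewrite -[X in measurable X]setTI; apply: mF.
apply/seteqP; split=> x /=; rewrite in_itv /= andbT.
  by move/(posdef_schur (Fs x)).
by move=> h; apply/(posdef_schur (Fs x)).
Qed.

(** The derivative is the limit of difference quotients with step 1/(n+1). As g is controlled only
    on [[u, v]], it is first made continuous on the whole line by clamping its argument; at an inner
    point the clamping is invisible for large n. *)
Lemma measurable_derive1_itvoo (R : realType) (u v : R) (g : R -> R) :
  (forall t, t \in `[u, v] -> derivable g t 1) ->
  measurable_fun `]u, v[ (derive1 g).
Proof.
move=> dg.
have [uv|vu] := leP u v; last first.
  rewrite set_itv_ge; first exact: measurable_fun_set0.
  by rewrite bnd_simp -leNgt ltW.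
pose cl (t : R) := Num.max u (Num.min v t).
have cluv t : cl t \in `[u, v].
  by rewrite in_itv /= le_max lexx /= ge_max uv /= ge_min lexx.
have clK t : t \in `[u, v] -> cl t = t.
  rewrite in_itv /= => /andP[ut tv].
  by rewrite /cl (min_idPr tv) (max_idPr ut).
have cg : continuous (g \o cl).
  move=> t; apply: continuous_comp.
    apply: continuous_max; first exact: cst_continuous.
    by apply: continuous_min; [exact: cst_continuous|exact: cvg_id].
  by apply: differentiable_continuous; apply/derivable1_diffP; exact: dg.
have mg : measurable_fun setT (g \o cl) by exact: continuous_measurable_fun.
pose h n (t : R) := n.+1%:R * ((g \o cl) (t + n.+1%:R^-1) - (g \o cl) t).
apply: (@measurable_fun_cvg _ _ _ _ h).
  move=> n; apply: measurable_funM; first exact: measurable_cst.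
  apply: (@measurable_funS _ _ _ _ setT) => //.
  apply: measurable_funB => //.
  apply: (measurableT_comp mg).
  by apply: measurable_funD; [exact: measurable_id|exact: measurable_cst].
move=> t; rewrite /= => tuv.
have tuv' : t \in `[u, v].
  by move: tuv; rewrite !in_itv /= => /andP[/ltW -> /ltW ->].
have := dg t tuv'.
move=> /cvg_ex[l gl].
have -> : derive1 g t = l by rewrite derive1E; exact: cvg_lim.
pose q (e : R) := e^-1 *: ((g \o shift t) (e *: 1) - g t).
have qt : q n.+1%:R^-1 @[n --> \oo] --> l.
  apply: (cvgr_dnbhsP _ _ _).1 gl (fun n => n.+1%:R^-1) _.
  by split=> [n|]; [rewrite invr_neq0|exact: cvg_harmonic].
have vt : 0 < v - t by rewrite subr_gt0; move: tuv; rewrite in_itv /= => /andP[].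
have qh : \forall n \near \oo, q n.+1%:R^-1 = h n t.
  near=> n.
  have tn : n.+1%:R^-1 < v - t.
    by near: n; exact: (near_infty_natSinv_lt (PosNum vt)).
  have tn' : t + n.+1%:R^-1 \in `[u, v].
    move: tuv'; rewrite !in_itv /= => /andP[ut _].
    by rewrite (le_trans ut) ?lerDl //= -lerBrDl ltW.
  by rewrite /h /q /= (clK _ tuv') (clK _ tn') invrK /GRing.scale /= mulr1 [X in g X]addrC.
exact: cvg_trans (near_eq_cvg qh) qt.
Unshelve. all: by end_near. Qed.

(** * Calibration along curves in the coordinates [nu] *)

Lemma symm_of_coord (m : nat) (i j : 'I_m) :
  exists k, forall (R : realType) (x : 'cV[R]_(tri m)), symm_of x i j = x k 0.
Proof.
wlog ij : i j / (i <= j)%N.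
  move=> H; have [/H //|/ltnW/H[k hk]] := leqP i j.
  by exists k => R x; rewrite -symm_of_sym mxE hk.
have [k ek] := upper_idx_surj ij.
by exists k => R x; have := symm_of_upper x k; rewrite ek.
Qed.

Lemma is_derive_lincomb (R : realType) (p : nat) (a : 'I_p -> R)
    (f : 'I_p -> R -> R) (d : 'I_p -> R) (t : R) :
  (forall k, is_derive t 1 (f k) (d k)) ->
  is_derive t 1 (fun s => \sum_k a k * f k s) (\sum_k a k * d k).
Proof.
move=> df; have := is_derive_sum (fun k => is_deriveZ (a k) (df k)).
rewrite (_ : \sum_(i < p) _ = fun s => \sum_k a k * f k s) //.
by apply/funext => s; rewrite fct_sumE.
Qed.

Lemma is_derive_mx_congr (R : realType) (p : nat) (Q : 'M[R]_p)
    (F : R -> 'M[R]_p) (H : 'M[R]_p) (t : R) :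
  (forall i j, is_derive t 1 (fun s => F s i j) (H i j)) ->
  forall i j, is_derive t 1 (fun s => (Q *m F s *m Q^T) i j)
                            ((Q *m H *m Q^T) i j).
Proof.
move=> dF i j.
have E (A : 'M[R]_p) : (Q *m A *m Q^T) i j =
    \sum_k Q j k * \sum_l Q i l * A l k.
  rewrite mxE; apply: eq_bigr => k _; rewrite [RHS]mulrC mxE; congr (_ * _).
  by rewrite mxE.
rewrite E; under eq_fun do rewrite E.
by apply: is_derive_lincomb => k; apply: is_derive_lincomb => l.
Qed.

Lemma is_derive_symm_of (R : realType) (m : nat) (g : R -> 'cV[R]_(tri m))
    (t : R) : derivable g t 1 -> forall i j,
  is_derive t 1 (fun s => symm_of (g s) i j) (symm_of (derive1 g t) i j).
Proof.
move=> dg i j; have [k hk] := symm_of_coord i j.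
rewrite hk; under eq_fun do rewrite hk.
rewrite derive1E derive_mx // mxE; apply: derivableP.
exact: ((derivable_mxP _ _ _).1 dg).
Qed.

Lemma sum_mul_le_sqrt (R : realType) (p : nat) (a b : 'I_p -> R) :
  \sum_k a k * b k <= Num.sqrt (\sum_k a k ^+ 2) * Num.sqrt (\sum_k b k ^+ 2).
Proof.
set A := \sum_k a k ^+ 2; set B := \sum_k b k ^+ 2.
have A0 : 0 <= A by rewrite sumr_ge0 // => k _; rewrite sqr_ge0.
have B0 : 0 <= B by rewrite sumr_ge0 // => k _; rewrite sqr_ge0.
have z (c : 'I_p -> R) : \sum_k c k ^+ 2 = 0 -> forall k, c k = 0.
  move/eqP; rewrite psumr_eq0 => [/allP h k|k _]; last by rewrite sqr_ge0.
  by have := h k (mem_index_enum _); rewrite /= sqrf_eq0 => /eqP.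
have [AE|AN0] := eqVneq A 0.
  by rewrite AE sqrtr0 mul0r big1 // => k _; rewrite z ?mul0r.
have [BE|BN0] := eqVneq B 0.
  by rewrite BE sqrtr0 mulr0 big1 // => k _; rewrite (z b) ?mulr0.
set x := Num.sqrt A; set y := Num.sqrt B.
have x0 : 0 < x by rewrite sqrtr_gt0 lt_neqAle eq_sym AN0.
have y0 : 0 < y by rewrite sqrtr_gt0 lt_neqAle eq_sym BN0.
have xA : x ^+ 2 = A by rewrite sqr_sqrtr.
have yB : y ^+ 2 = B by rewrite sqr_sqrtr.
(* Each product is bounded by the weighted arithmetic-geometric mean inequality; the weights y/x and
   x/y make the bounds add up to exactly x y. *)
apply: (@le_trans _ _ (2^-1 * ((y / x) * A + (x / y) * B))); last first.
  rewrite -xA -yB le_eqVlt; apply/orP; left; apply/eqP; field.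
  by rewrite !gt_eqF.
rewrite /A /B !mulr_sumr -big_split /= mulr_sumr; apply: ler_sum => k _.
rewrite -subr_ge0.
have -> : 2^-1 * (y / x * a k ^+ 2 + x / y * b k ^+ 2) - a k * b k =
    2^-1 * (x * y) * (a k / x - b k / y) ^+ 2.
  by field; rewrite !gt_eqF.
by rewrite mulr_ge0 ?sqr_ge0 // mulr_ge0 ?invr_ge0 // mulr_ge0 // ltW.
Qed.

Definition speed (R : realType) (m : nat) (g : R -> 'cV[R]_(tri m)) (t : R) : R :=
  Num.sqrt (mnorm2 (symm_of (g t)) (symm_of (derive1 g t))).

Lemma measurable_speed (R : realType) (m : nat) (g : R -> 'cV[R]_(tri m))
    (u v : R) :
  (forall t, t \in `[u, v] -> derivable g t 1) ->
  (forall t, t \in `[u, v] -> posdef (symm_of (g t))) ->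
  measurable_fun `[u, v] (speed g).
Proof.
move=> dg pg; apply: (@measurable_fun_itv_cc _ u v false true).
have sub : `]u, v[ `<=` `[u, v]%classic by apply: subset_itv_oo_cc.
apply: (@measurableT_comp _ _ _ _ _ _ (@Num.sqrt R)) => //.
  exact: measurable_sqrtr.
apply: (@measurable_mnorm2 _ _ _ _ _ (fun t => symm_of (g t))
  (fun t => symm_of (derive1 g t))) => [t /sub tuv|i j|i j].
- exact: posdef_unit (pg _ tuv).
- have [k hk] := symm_of_coord i j; rewrite (_ : (fun t => _) = fun t => g t k 0); last
    exact/funext.
  apply: open_continuous_measurable_fun; first exact: interval_open.
  move=> t; rewrite inE => /sub tuv; apply: differentiable_continuous.
  by apply/derivable1_diffP; apply: (derivable_mxP _ _ _).1; exact: dg.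
- have [k hk] := symm_of_coord i j; rewrite (_ : (fun t => _) = fun t => derive1 g t k
    0); last first.
    by apply/funext => t; rewrite hk.
  apply: (@eq_measurable_fun _ _ _ _ _ (derive1 (fun s => g s k 0))).
    move=> t; rewrite inE => /sub tuv.
    by rewrite !derive1E derive_mx ?mxE //; exact: dg.
  apply: measurable_derive1_itvoo => t tuv.
  by apply: (derivable_mxP _ _ _).1; exact: dg.
Qed.

Lemma tr_congr_sym (R : realType) (p : nat) (Q A : 'M[R]_p) :
  A^T = A -> (Q *m A *m Q^T)^T = Q *m A *m Q^T.
Proof. by move=> As; rewrite !trmx_mul trmxK As mulmxA. Qed.

(* The weighted sum of log-pivots is a calibration: a function whose
   differential has norm at most [|a|] for the affine-invariant metric. *)
Lemma calibration_le (R : realType) (m : nat) (Q : 'M[R]_m) (a : 'I_m -> R)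
    (g : R -> 'cV[R]_(tri m)) (u v : R) :
  let F t := \sum_k a k * ln (pivot (Q *m symm_of (g t) *m Q^T) k) in
  u <= v -> Q \in unitmx ->
  (forall t, t \in `[u, v] -> derivable g t 1) ->
  (forall t, t \in `[u, v] -> posdef (symm_of (g t))) ->
  ((F v - F u)%:E <= (Num.sqrt (\sum_k a k ^+ 2))%:E *
    \int[lebesgue_measure]_(t in `[u, v]) (speed g t)%:E)%E.
Proof.
move=> F uv Qu dg pg; set al := Num.sqrt _.
have al0 : 0 <= al by exact: sqrtr_ge0.
have ms := measurable_speed dg pg.
rewrite -ge0_integralZl_EFin //; last 2 first.
- by move=> t _; rewrite lee_fin sqrtr_ge0.
- exact/measurable_EFinP.
have dF t : t \in `[u, v] -> exists d, is_derive t 1 F d /\ d <= al * speed g t.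
  move=> tuv; have pQ := posdef_congr Qu (pg t tuv).
  have [||||d [dP dle]] := @pivot_derive _ _
      (fun s => Q *m symm_of (g s) *m Q^T) (Q *m symm_of (derive1 g t) *m Q^T) t.
  - by move=> s; rewrite tr_congr_sym // symm_of_sym.
  - by rewrite tr_congr_sym // symm_of_sym.
  - by apply: is_derive_mx_congr; apply: is_derive_symm_of; exact: dg.
  - exact: pQ.
  exists (\sum_k a k * ((pivot (Q *m symm_of (g t) *m Q^T) k)^-1 * d k)); split.
    apply: is_derive_lincomb => k.
    exact: is_derive1_comp (is_derive1_ln (pivot_gt0 k pQ)) (dP k).
  apply: le_trans (sum_mul_le_sqrt _ _) _; rewrite ler_wpM2l // ler_wsqrtr //.
  rewrite -(mnorm2_congr _ Qu); last exact/posdef_unit/pg.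
  apply: le_trans dle; rewrite le_eqVlt; apply/orP; left; apply/eqP.
  by apply: eq_bigr => k _; rewrite mulrC.
(* [le_integral_derive] takes the derivative as a total function; outside [[u, v]] it gets the value
   0. *)
have /choice[d Hd] : forall t, exists d, t \in `[u, v] ->
    is_derive t 1 F d /\ d <= al * speed g t.
  move=> t; have [/dF[d]|_] := boolP (t \in `[u, v]); first by exists d.
  by exists 0.
apply: (@le_integral_derive _ u v F d) => //.
- by move=> t /Hd[].
- by apply: measurable_funM => //; exact: measurable_cst.
- by move=> t _; rewrite mulr_ge0 // sqrtr_ge0.
- by move=> t /Hd[].
Qed.

(** Only the open interval can be claimed: at a breakpoint the derivative of c is not determined by
    that of g. For integrals the endpoints are negligible. *)
Lemma speed_near (R : realType) (m : nat) (g c : R -> 'cV[R]_(tri m)) (x y : R) :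
  (forall t, x <= t <= y -> g t = c t) ->
  {in `]x, y[, speed c =1 speed g}.
Proof.
move=> gc t txy.
have E : \forall s \near t, c s = g s.
  have : \forall s \near t, s \in `]x, y[ by exact: near_in_itvoo.
  apply: filterS => s; rewrite in_itv /= => /andP[/ltW xs /ltW sy].
  by rewrite gc // xs sy.
rewrite /speed !derive1E (near_eq_derive _ E).
by rewrite (nbhs_singleton E).
Qed.

(** Induction on the subdivision, replacing c on each piece by its differentiable representative.
    Measurability of the speed is carried along because splitting the integral at a breakpoint
    requires it. *)
Lemma calibration_le_piecewise (R : realType) (m : nat) (Q : 'M[R]_m)
    (a : 'I_m -> R) (c : R -> 'cV[R]_(tri m)) (x : R) (s : seq R) :
  let F t := \sum_k a k * ln (pivot (Q *m symm_of (c t) *m Q^T) k) in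
  Q \in unitmx -> sorted <%R (x :: s) ->
  (forall t, x <= t <= last x s -> posdef (symm_of (c t))) ->
  (forall i, (i < size s)%N -> exists g : R -> 'cV[R]_(tri m),
     forall t, (x :: s)`_i <= t <= (x :: s)`_i.+1 ->
       g t = c t /\ derivable g t 1) ->
  measurable_fun `[x, last x s] (speed c) /\
  ((F (last x s) - F x)%:E <= (Num.sqrt (\sum_k a k ^+ 2))%:E *
    \int[lebesgue_measure]_(t in `[x, last x s]) (speed c t)%:E)%E.
Proof.
move=> F Qu; set al := Num.sqrt _.
have al0 : 0 <= al by exact: sqrtr_ge0.
have sp0 t : (0 <= (speed c t)%:E)%E by rewrite lee_fin sqrtr_ge0.
elim: s x => [|y s IHs] x /=.
  move=> _ _ _; rewrite subrr set_itv1; split; first exact: measurable_fun_set1.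
  by rewrite mule_ge0 ?lee_fin // integral_ge0.
move=> /andP[xy ss] pc dc.
have yl : y <= last y s.
  have /allP h := order_path_min (@lt_trans _ R) ss.
  by have := mem_last y s; rewrite inE => /orP[/eqP ->|/h/ltW].
have [||ms le2] := IHs y ss.
- by move=> t /andP[yt tl]; apply: pc; rewrite tl (le_trans (ltW xy)).
- by move=> i si; have := dc i.+1; apply.
have [g Hg] := dc 0 (ltn0Sn _).
have gc t : x <= t <= y -> g t = c t by move=> /Hg[].
have pg t : t \in `[x, y] -> posdef (symm_of (g t)).
  rewrite in_itv /= => /[dup] xty /gc ->; apply: pc.
  by move: xty => /andP[-> /le_trans ->].
have dg t : t \in `[x, y] -> derivable g t 1 by rewrite in_itv => /Hg[].
have mg := measurable_speed dg pg.
have sub : `]x, y[ `<=` `[x, y]%classic by apply: subset_itv_oo_cc.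
have mgo : measurable_fun `]x, y[ (speed g) by exact: measurable_funS mg.
have mco : measurable_fun `]x, y[ (speed c).
  have sE : {in `]x, y[%classic, speed g =1 speed c}.
    by move=> t; rewrite inE => txy; rewrite (speed_near gc).
  exact: eq_measurable_fun sE mgo.
have mc : measurable_fun `[x, y] (speed c).
  exact: (@measurable_fun_itv_cc _ x y false true).
have mc' : measurable_fun `[x, last y s] (speed c).
  have -> : `[x, last y s]%classic = `[x, y]%classic `|` `[y, last y s]%classic.
    apply/seteqP; split=> t; rewrite /= !in_itv /=.
      move=> /andP[xt tl]; case: (leP t y) => [ty|/ltW yt]; first by left; rewrite xt.
      by right; rewrite yt.
    move=> [] /andP[h1 h2]; first by rewrite h1 (le_trans h2).
    by rewrite h2 (le_trans (ltW xy)).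
  by apply/measurable_funU.
split=> //.
rewrite (@ge0_integral_itv_split _ _ x y (last y s)) ?(ltW xy) //; last first.
  exact/measurable_EFinP.
rewrite ge0_muleDr; last 2 first.
- exact: integral_ge0.
- exact: integral_ge0.
have -> : F (last y s) - F x = (F y - F x) + (F (last y s) - F y) by ring.
rewrite EFinD; apply: leeD => //.
have -> : (\int[lebesgue_measure]_(t in `[x, y]) (speed c t)%:E =
    \int[lebesgue_measure]_(t in `[x, y]) (speed g t)%:E)%E.
  exact: (@eq_integral_itv_bounded _ x y (speed g) (speed c) true false
    mco mgo (speed_near gc)).
have gx : g x = c x by apply: gc; rewrite lexx (ltW xy).
have gy : g y = c y by apply: gc; rewrite lexx (ltW xy).
by have := @calibration_le _ _ Q a g x y (ltW xy) Qu dg pg; rewrite gx gy; apply.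
Qed.

Lemma posdef_paramP (R : realType) (m : nat) (x : 'cV[R]_(tri m)) :
  posdef_param x <-> posdef (symm_of x).
Proof.
split=> [[A Ap <-]|xp]; first by rewrite nuK ?(posdef_sym Ap).
by exists (symm_of x) => //; rewrite symm_ofK.
Qed.

Lemma is_derive_nu (R : realType) (m : nat) (F : R -> 'M[R]_m) (H : 'M[R]_m)
    (t : R) :
  (forall i j, is_derive t 1 (fun s => F s i j) (H i j)) ->
  derivable (fun s => nu (F s)) t 1 /\ derive1 (fun s => nu (F s)) t = nu H.
Proof.
move=> dF; have dnu : derivable (fun s => nu (F s)) t 1.
  apply/derivable_mxP => k z; under eq_fun do rewrite mxE.
  by have [] := dF (tnth (upper_idx m) k).1 (tnth (upper_idx m) k).2.
split=> //; rewrite derive1E derive_mx //; apply/matrixP => k z; rewrite !mxE.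
under eq_fun do rewrite mxE.
by have [_ ->] := dF (tnth (upper_idx m) k).1 (tnth (upper_idx m) k).2.
Qed.

Definition geodesic (R : realType) (m : nat) (P : 'M[R]_m) (l : 'rV[R]_m)
    (t : R) : 'cV[R]_(tri m) :=
  nu (P *m diag_mx (\row_k expR (t * l 0 k)) *m P^T).

Lemma posdef_geodesic (R : realType) (m : nat) (P : 'M[R]_m) (l : 'rV[R]_m)
    (t : R) :
  P \in unitmx -> posdef (P *m diag_mx (\row_k expR (t * l 0 k)) *m P^T).
Proof.
move=> Pu; apply: posdef_congr => //; apply/posdef_diag => i.
by rewrite mxE expR_gt0.
Qed.

Lemma derive1_geodesic (R : realType) (m : nat) (P : 'M[R]_m) (l : 'rV[R]_m)
    (t : R) :
  derivable (geodesic P l) t 1 /\ derive1 (geodesic P l) t =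
    nu (P *m diag_mx (\row_k (l 0 k * expR (t * l 0 k))) *m P^T).
Proof.
apply: is_derive_nu; apply: is_derive_mx_congr => i j.
rewrite mxE; under eq_fun do rewrite mxE.
case: (i == j); last by rewrite mulr0n; exact: is_derive_cst.
rewrite mulr1n mxE; under eq_fun do rewrite mulr1n mxE.
have dl : is_derive t 1 (fun s : R => s * l 0 i) (l 0 i).
  have := is_deriveZ (l 0 i) (is_derive_id t (1 : R)).
  rewrite /GRing.scale /= mulr1.
  by rewrite (_ : (l 0 i) \*: _ = fun s => s * l 0 i) //; apply/funext => s; rewrite mulrC.
rewrite mulrC.
exact: is_derive1_comp (is_derive_expR _) dl.
Qed.

Lemma speed_geodesic (R : realType) (m : nat) (P : 'M[R]_m) (l : 'rV[R]_m)
    (t : R) : P \in unitmx ->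
  mnorm2 (symm_of (geodesic P l t)) (symm_of (derive1 (geodesic P l) t)) =
  \sum_k l 0 k ^+ 2.
Proof.
move=> Pu; have [_ ->] := derive1_geodesic P l t.
rewrite /geodesic !nuK; last 2 first.
- by rewrite tr_congr_sym // tr_diag_mx.
- by rewrite tr_congr_sym // tr_diag_mx.
(* With this square root of the diagonal factor, the point is (P E)(P E)^T and the velocity is (P E)
   diag(l) (P E)^T, so the speed is independent of t. *)
pose E := diag_mx (\row_k expR (t * l 0 k / 2)).
have Eu : E \in unitmx by apply/posdef_unit/posdef_diag => i; rewrite mxE expR_gt0.
have E2 k : expR (t * l 0 k / 2) * expR (t * l 0 k / 2) = expR (t * l 0 k).
  by rewrite -expRD; congr expR; field.
rewrite -(@mnorm2_diag _ _ (P *m E)) ?unitmx_mul ?Pu //.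
have -> : diag_mx (\row_k expR (t * l 0 k)) = E *m E.
  by rewrite mulmx_diag; congr diag_mx; apply/rowP => k; rewrite !mxE E2.
have -> : diag_mx (\row_k (l 0 k * expR (t * l 0 k))) = E *m diag_mx l *m E.
  rewrite !mulmx_diag; congr diag_mx; apply/rowP => k; rewrite !mxE -E2.
  by rewrite mulrA; congr (_ * _); rewrite mulrC.
by rewrite trmx_mul tr_diag_mx !mulmxA.
Qed.

Lemma affine_invariant_dist (R : realType) (m : nat) (P : 'M[R]_m)
    (l : 'rV[R]_m) (kappa : R) (G : 'cV[R]_(tri m) -> 'M[R]_(tri m)) :
  P \in unitmx -> 0 <= kappa ->
  (forall x h, posdef (symm_of x) ->
     (h^T *m G x *m h) 0 0 = kappa * mnorm2 (symm_of x) (symm_of h)) ->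
  riemannian_dist (@posdef_param R m) G (nu (P *m P^T))
    (nu (P *m diag_mx (\row_k expR (l 0 k)) *m P^T)) =
  (Num.sqrt (kappa * \sum_k l 0 k ^+ 2))%:E.
Proof.
move=> Pu k0 GE; set L := \sum_k _.
have L0 : 0 <= L by rewrite sumr_ge0 // => k _; rewrite sqr_ge0.
have gE0 : geodesic P l 0 = nu (P *m P^T).
  rewrite /geodesic (_ : diag_mx _ = 1%:M) ?mulmx1 //.
  by apply/matrixP => i j; rewrite !mxE mul0r expR0.
have gE1 : geodesic P l 1 = nu (P *m diag_mx (\row_k expR (l 0 k)) *m P^T).
  congr (nu (_ *m diag_mx _ *m _)); apply/rowP => k.
  by rewrite !mxE mul1r.
have lenE c : (forall t, 0 <= t <= 1 -> posdef_param (c t)) ->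
    curve_length G c = (\int[lebesgue_measure]_(t in `[0%R, 1%R])
      ((Num.sqrt kappa)%:E * (speed c t)%:E))%E.
  move=> cp; apply: eq_integral => t; rewrite inE /= in_itv /= => /cp/posdef_paramP tp.
  by rewrite GE // sqrtrM // EFinM.
apply/eqP; rewrite eq_le; apply/andP; split.
  apply: (@le_trans _ _ (curve_length G (geodesic P l))).
    apply: ereal_inf_lbound; exists (geodesic P l) => //; split=> //.
    - exists [:: 1]; split=> //=; first by rewrite ltr01.
      move=> [|//] _; exists (geodesic P l) => t _; split=> //.
      by have [] := derive1_geodesic P l t.
    - move=> t _; apply/posdef_paramP.
      by rewrite nuK; [exact: posdef_geodesic|rewrite tr_congr_sym // tr_diag_mx].
  rewrite lenE; last first.
    move=> t _; apply/posdef_paramP.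
    by rewrite nuK; [exact: posdef_geodesic|rewrite tr_congr_sym // tr_diag_mx].
  rewrite (eq_integral (fun=> (Num.sqrt (kappa * L))%:E)).
    by rewrite integral_cst //= lebesgue_measure_itv /= lte_fin ltr01 sube0 mule1.
  by move=> t _; rewrite /speed speed_geodesic // sqrtrM // EFinM.
apply: le_ereal_inf_tmp => _ [c [pd cp c0 c1] <-].
have cp' t : 0 <= t <= 1 -> posdef (symm_of (c t)) by move=> /cp/posdef_paramP.
rewrite lenE //.
have [s [ss s1 sc]] := pd.
have Qu : invmx P \in unitmx by rewrite unitmx_inv.
(* Congruence by P^-1 takes the endpoints to 1 and diag(e^l), whose pivots are 1 and e^(l_k). With
   weights l_k the calibration therefore increases by L = |l|^2. *)
have [||ms] := @calibration_le_piecewise _ _ (invmx P) (fun k => l 0 k) c 0 s Qu ss.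
- by rewrite s1.
- exact: sc.
rewrite s1 c0 c1 !nuK; last 2 first.
- by rewrite trmx_mul trmxK.
- by rewrite tr_congr_sym // tr_diag_mx.
rewrite s1 in ms.
have QPP (M : 'M[R]_m) : invmx P *m (P *m M *m P^T) *m (invmx P)^T = M.
  by rewrite !mulmxA mulVmx // mul1mx -mulmxA -trmx_mul mulVmx // trmx1 mulmx1.
have QP1 : invmx P *m (P *m P^T) *m (invmx P)^T = diag_mx (const_mx 1).
  by rewrite -[RHS]QPP diag_const_mx mulmx1.
rewrite QPP QP1.
under eq_bigr do rewrite pivot_diag mxE expRK -expr2.
rewrite -/L [X in _ - X]big1 ?subr0 => [H|k _]; last first.
  by rewrite pivot_diag mxE ln1 mulr0.
rewrite ge0_integralZl_EFin //; last 2 first.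
- by move=> t _; rewrite lee_fin sqrtr_ge0.
- exact/measurable_EFinP.
rewrite sqrtrM // EFinM; apply: lee_wpmul2l; first by rewrite lee_fin sqrtr_ge0.
(* The calibration gives L <= sqrt L times the length; dividing by sqrt L requires L to be
   nonzero. *)
have [L00|LN0] := eqVneq L 0.
  by rewrite L00 sqrtr0 integral_ge0 // => t _; rewrite lee_fin sqrtr_ge0.
have sL : 0 < Num.sqrt L by rewrite sqrtr_gt0 lt_neqAle eq_sym LN0.
rewrite -(@lee_pmul2l _ (Num.sqrt L)%:E) ?lte_fin //.
by rewrite -EFinM -expr2 sqr_sqrtr.
Qed.

(** * Iterated integrals *)

Lemma lebesgueRn_sigma_finite (R : realType) (n : nat) :
  sigma_finite setT (@lebesgueRn R n).
Proof.
pose A (k : nat) : set (measurableTypeR R) := `[- k%:R, k%:R]%classic.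
have mA k : measurable (A k) by exact: measurable_itv.
exists (fun k => [set t | forall i : 'I_n, A k (tnth t i)]).
  apply/seteqP; split=> // t _.
  exists (\max_(i < n) (Num.trunc `|tnth t i : R|).+1)%N => // i.
  rewrite /A /= in_itv /= -ler_norml.
  apply: (@le_trans _ _ (Num.trunc `|tnth t i : R|).+1%:R).
    by apply/ltW; exact: (truncnS_gt `|tnth t i : R|).
  by rewrite ler_nat (@leq_bigmax _ (fun i => (Num.trunc `|tnth t i : R|).+1)).
move=> k; split.
  rewrite (_ : mkset _ = \bigcap_(i in [set` 'I_n])
      ((fun t => tnth t i) @^-1` A k)).
    apply: fin_bigcap_measurable => // i _.
    by rewrite -[X in measurable X]setTI; apply: measurable_tnth.
  apply/seteqP; split => t /= h i; first by move=> _; exact: h.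
  by apply: h; rewrite /= inE.
rewrite (lebesgueRn_box (fun=> mA k)) -ge0_fin_numE ?prode_ge0 //.
apply: prode_fin_num => i _; rewrite lebesgue_measure_itv /=.
by case: ifP.
Qed.

HB.instance Definition _ (R : realType) (n : nat) :=
  Measure_isSigmaFinite.Build _ _ _ (@lebesgueRn R n)
    (@lebesgueRn_sigma_finite R n).

(* Integrands are functions of an untyped list of coordinates, so that the
   dimension can be split without casts. *)
Definition seq_integral (R : realType) (n : nat) (g : seq R -> \bar R) : \bar R :=
  (\int[@lebesgueRn R n]_t g (t : n.-tuple R))%E.

Definition seq_measurable (R : realType) (n : nat) (g : seq R -> \bar R) :=
  measurable_fun setT (fun t : n.-tuple (measurableTypeR R) => g t).

Lemma measurable_cat_tuple (R : realType) (d : measure_display)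
    (T : measurableType d) (p q : nat) (f : T -> p.-tuple (measurableTypeR R))
    (g : T -> q.-tuple (measurableTypeR R)) :
  measurable_fun setT f -> measurable_fun setT g ->
  measurable_fun setT (fun x => cat_tuple (f x) (g x)).
Proof.
move=> mf mg; apply/measurable_fun_tnthP => i.
pose z := (0 : measurableTypeR R).
have [ip|pi] := ltnP i p.
  rewrite (_ : _ \o _ = fun x => tnth (f x) (Ordinal ip)).
    exact: ((measurable_fun_tnthP _).1 mf).
  by apply/funext => x; rewrite /= !(tnth_nth z) /= nth_cat size_tuple ip.
have iq : (i - p < q)%N by rewrite ltn_subLR.
rewrite (_ : _ \o _ = fun x => tnth (g x) (Ordinal iq)).
  exact: ((measurable_fun_tnthP _).1 mg).
by apply/funext => x; rewrite /= !(tnth_nth z) /= nth_cat size_tuple ltnNge pi.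
Qed.

Lemma seq_measurable_cat (R : realType) (p q : nat) (g : seq R -> \bar R) :
  seq_measurable (p + q) g ->
  measurable_fun setT (fun st : p.-tuple (measurableTypeR R) *
    q.-tuple (measurableTypeR R) => g (st.1 ++ st.2)).
Proof.
move=> mg; apply: (measurableT_comp mg).
apply: (@measurable_cat_tuple _ _ _ p q fst snd); exact: measurable_fst || exact: measurable_snd.
Qed.

Lemma seq_measurable_cons (R : realType) (n : nat) (g : seq R -> \bar R) :
  seq_measurable n.+1 g ->
  measurable_fun setT (fun xt : measurableTypeR R *
    n.-tuple (measurableTypeR R) => g (xt.1 :: xt.2)).
Proof.
move=> mg; apply: (measurableT_comp mg).
exact: (@measurable_cons _ _ _ _ fst n snd).
Qed.

Lemma seq_integral_prod (R : realType) (n : nat) (g : seq R -> \bar R) :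
  (forall s, 0 <= g s)%E -> seq_measurable n.+1 g ->
  seq_integral n.+1 g =
  (\int[@lebesgue_measure R \x @lebesgueRn R n]_xt g (xt.1 :: xt.2))%E.
Proof.
move=> g0 mg; rewrite /seq_integral.
have mc : measurable_fun setT
    (fun xt : measurableTypeR R * n.-tuple (measurableTypeR R) =>
      [tuple of xt.1 :: xt.2]).
  exact: (@measurable_cons _ _ _ _ fst n snd).
transitivity (\int[(@lebesgue_measure R \x^ @lebesgueRn R n)]_xt g (xt.1 :: xt.2))%E.
  have := @ge0_integral_pushforward _ _ _ _ _ _ mc
    (@lebesgue_measure R \x^ @lebesgueRn R n)%E setT
    (fun t : n.+1.-tuple (measurableTypeR R) => g t) measurableT mg.
  rewrite preimage_setT; apply; by move=> t _; exact: g0.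
(* [lebesgueRn] is built from the product [\x^], while Tonelli's theorem is stated for [\x]; they
   agree on rectangles, hence everywhere by sigma-finiteness. *)
apply: eq_measure_integral => A mA _; apply/esym.
apply: product_measure_unique => // B C mB mC.
exact: product_measure2E.
Qed.

Lemma seq_integralS (R : realType) (n : nat) (g : seq R -> \bar R) :
  (forall s, 0 <= g s)%E -> seq_measurable n.+1 g ->
  seq_integral n.+1 g =
  (\int[@lebesgue_measure R]_x seq_integral n (fun s => g (x :: s)))%E.
Proof.
move=> g0 mg; rewrite seq_integral_prod //.
exact: (fubini_tonelli1 _ (seq_measurable_cons mg)).
Qed.

Lemma seq_integralSr (R : realType) (n : nat) (g : seq R -> \bar R) :
  (forall s, 0 <= g s)%E -> seq_measurable n.+1 g ->
  seq_integral n.+1 g =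
  seq_integral n (fun s => \int[@lebesgue_measure R]_x g (x :: s))%E.
Proof.
move=> g0 mg; rewrite seq_integral_prod //.
exact: (fubini_tonelli2 _ (seq_measurable_cons mg)).
Qed.

Lemma seq_integral0 (R : realType) (g : seq R -> \bar R) :
  seq_integral 0 g = g [::].
Proof.
rewrite /seq_integral [LHS]integral_dirac //.
  by rewrite diracT mul1e.
rewrite (_ : (fun t : 0.-tuple (measurableTypeR R) => g t) = cst (g [::])).
  exact: measurable_cst.
by apply/funext => t; rewrite tuple0.
Qed.

Lemma seq_measurable_curry (R : realType) (q : nat) (g : seq R -> \bar R)
    (s : seq R) :
  seq_measurable (size s + q) g -> seq_measurable q (fun t => g (s ++ t)).
Proof.
move=> mg.
exact: (measurable_fun_pair2 (in_tuple s) (seq_measurable_cat mg)).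
Qed.

Lemma seq_integral_cat (R : realType) (p q : nat) (g : seq R -> \bar R) :
  (forall s, 0 <= g s)%E -> seq_measurable (p + q) g ->
  seq_integral (p + q) g =
  seq_integral p (fun s => seq_integral q (fun t => g (s ++ t))).
Proof.
elim: p g => [|p IHp] g g0 mg; first by rewrite seq_integral0.
rewrite addSn seq_integralS // [RHS]seq_integralS //; first last.
- exact: (measurable_fun_fubini_tonelli_F _ (seq_measurable_cat mg)).
- by move=> s; apply: integral_ge0.
apply: eq_integral => x _; rewrite IHp //.
exact: (@seq_measurable_curry _ _ _ [:: x]).
Qed.

Lemma seq_integral_exchange (R : realType) (p q : nat)
    (h : seq R -> seq R -> \bar R) :
  (forall s t, 0 <= h s t)%E ->
  measurable_fun setT (fun st : p.-tuple (measurableTypeR R) *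
    q.-tuple (measurableTypeR R) => h st.1 st.2) ->
  seq_integral p (fun s => seq_integral q (fun t => h s t)) =
  seq_integral q (fun t => seq_integral p (fun s => h s t)).
Proof. by move=> h0 mh; exact: (fubini_tonelli _ mh). Qed.

(** * Translation invariance *)

Lemma lebesgue_measure_shift (R : realType) (c : R) (A : set R) :
  measurable A ->
  pushforward (@lebesgue_measure R)
    ((fun x => x + c) : measurableTypeR R -> measurableTypeR R) A =
  lebesgue_measure A.
Proof.
have mc : measurable_fun setT ((fun x => x + c) : measurableTypeR R -> measurableTypeR R).
  by apply: measurable_funD; [exact: measurable_id|exact: measurable_cst].
move=> mA; apply/esym/lebesgue_measure_unique => //= _ [[a b]] _ <-.
rewrite /= /pushforward.
have -> : (fun x => x + c) @^-1` `]a, b]%classic = `](a - c), (b - c)]%classic.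
  by apply/seteqP; split=> x /=; rewrite !in_itv /= ltrBlDr lerBrDr.
rewrite !lebesgue_measure_itv /= !lte_fin ltrD2r; case: ifP => // _.
by rewrite -!EFinB; congr (_%:E); ring.
Qed.

Lemma ge0_integral_shift (R : realType) (c : R) (f : R -> \bar R) :
  measurable_fun setT f -> (forall x, 0 <= f x)%E ->
  (\int[lebesgue_measure]_x f (x + c)%R = \int[lebesgue_measure]_x f x)%E.
Proof.
move=> mf f0.
have mc : measurable_fun setT ((fun x => x + c) : measurableTypeR R -> measurableTypeR R).
  by apply: measurable_funD; [exact: measurable_id|exact: measurable_cst].
have := @ge0_integral_pushforward _ _ _ _ _ _ mc (@lebesgue_measure R) setT f
  measurableT mf (fun x _ => f0 x).
rewrite preimage_setT => <-.
by apply: eq_measure_integral => A mA _; exact: lebesgue_measure_shift.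
Qed.

Definition seq_add (R : realType) (s w : seq R) : seq R :=
  [seq x.1 + x.2 | x <- zip s w].

Lemma size_seq_add (R : realType) (s w : seq R) :
  size w = size s -> size (seq_add s w) = size s.
Proof. by move=> sw; rewrite size_map size_zip sw minnn. Qed.

Lemma nth_seq_add (R : realType) (s w : seq R) (i : nat) :
  size w = size s -> (seq_add s w)`_i = s`_i + w`_i.
Proof.
move=> sw; have [is_|si] := ltnP i (size s).
  by rewrite (nth_map (0, 0)) ?size_zip ?sw ?minnn // nth_zip.
by rewrite !nth_default ?addr0 ?size_seq_add // sw.
Qed.

Lemma seq_measurable_add (R : realType) (n : nat) (g : seq R -> \bar R)
    (w : seq R) : size w = n -> seq_measurable n g ->
  seq_measurable n (fun s => g (seq_add s w)).
Proof.
move=> wn mg.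
have sz (t : n.-tuple R) : size (seq_add t w) == n.
  by rewrite size_seq_add size_tuple.
apply: (measurableT_comp (f := fun t : n.-tuple (measurableTypeR R) => g t)
  (g := fun t : n.-tuple (measurableTypeR R) => Tuple (sz t) : n.-tuple
      (measurableTypeR R))) => //.
apply/measurable_fun_tnthP => i.
rewrite (_ : _ \o _ = fun t : n.-tuple (measurableTypeR R) => (tnth t i : R) + w`_i).
  apply: measurable_funD; [exact: measurable_tnth|exact: measurable_cst].
apply/funext => t; rewrite /= !(tnth_nth (0 : R)) /= nth_seq_add ?size_tuple //.
Qed.

Lemma seq_integral_shift (R : realType) (n : nat) (g : seq R -> \bar R)
    (w : seq R) :
  (forall s, 0 <= g s)%E -> seq_measurable n g -> size w = n ->
  seq_integral n (fun s => g (seq_add s w)) = seq_integral n g.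
Proof.
elim: n g w => [|n IHn] g w g0 mg wn; first by rewrite !seq_integral0 (size0nil wn).
case: w wn => [//|c w [wn]].
have mg' : seq_measurable n.+1 (fun s => g (seq_add s (c :: w))).
  by apply: seq_measurable_add mg; rewrite /= wn.
rewrite (seq_integralS _ mg') // (seq_integralS g0 mg).
have mI : measurable_fun setT (fun x : R => seq_integral n (fun t => g (x :: t))).
  exact: (measurable_fun_fubini_tonelli_F _ (seq_measurable_cons mg)).
rewrite -(ge0_integral_shift c mI); last by move=> x; apply: integral_ge0.
apply: eq_integral => x _.
rewrite -(IHn (fun t => g (x + c :: t)) w) //.
exact: (@seq_measurable_curry _ _ _ [:: x + c]).
Qed.

(** * Gamma integrals *)

Lemma is_derive_continuous (R : realType) (F : R -> R) (f : R -> R) :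
  (forall x : R, is_derive x 1 F (f x)) -> continuous F.
Proof.
move=> dF x; apply: differentiable_continuous.
by apply/derivable1_diffP; have [] := dF x.
Qed.

Lemma is_derive_LRcontinuous (R : realType) (F f : R -> R) (a b : R) :
  (forall x : R, is_derive x 1 F (f x)) -> derivable_oo_LRcontinuous F a b.
Proof.
move=> dF; have cF := is_derive_continuous dF; split.
- by move=> x _; have [] := dF x.
- by apply: cvg_at_right_filter; exact: cF.
- by apply: cvg_at_left_filter; exact: cF.
Qed.

Lemma derive1_eq (R : realType) (F f : R -> R) :
  (forall x : R, is_derive x 1 F (f x)) -> derive1 F = f.
Proof. by move=> dF; apply/funext => x; rewrite derive1E; have [_ ->] := dF x. Qed.

Lemma integral_derive (R : realType) (F f : R -> R) (a b : R) : a < b ->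
  (forall x : R, is_derive x 1 F (f x)) -> continuous f ->
  (\int[lebesgue_measure]_(x in `[a, b]) (f x)%:E = (F b - F a)%:E)%E.
Proof.
move=> ab dF cf; rewrite (@continuous_FTC2 _ f F) //.
- exact: continuous_subspaceT.
- exact: is_derive_LRcontinuous dF.
- by move=> x _; rewrite (derive1_eq dF).
Qed.

(** Read off from the total mass of the normal density with mean -c and variance 1/k. *)
Lemma integral_gauss1 (R : realType) (k c : R) : 0 < k ->
  (\int[lebesgue_measure]_x (expR (- (2^-1 * (k * (x + c) ^+ 2))))%:E =
   ((2 * pi / k) `^ 2^-1)%:E)%E.
Proof.
move=> k0; pose s := Num.sqrt k^-1.
have s2 : s ^+ 2 = k^-1 by rewrite sqr_sqrtr // invr_ge0 ltW.
have s0 : s != 0 by rewrite gt_eqF // sqrtr_gt0 invr_gt0.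
have p0 := normal_peak_gt0 s0.
have kN0 := lt0r_neq0 k0.
have fE (x : R) : expR (- (2^-1 * (k * (x + c) ^+ 2))) = normal_fun (- c) s x.
  by rewrite /normal_fun s2 opprK; congr expR; field.
have := integral_normal_pdf (- c) s.
rewrite normal_pdfE //; under eq_integral do rewrite EFinM.
rewrite ge0_integralZl_EFin //; last 3 first.
- by move=> x _; rewrite lee_fin normal_fun_ge0.
- by apply/measurable_EFinP; exact: measurable_normal_fun.
- exact: ltW.
under eq_integral do rewrite -fE.
set I := (\int[_]_x _)%E => pI.
have -> : I = ((normal_peak s)^-1)%:E.
  have : (I = (normal_peak s)^-1%:E * ((normal_peak s)%:E * I))%E.
    by rewrite muleA -EFinM mulVf ?mul1e // gt_eqF.
  by rewrite pI mule1.
rewrite /normal_peak invrK s2 powR12_sqrt; last first.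
  by rewrite divr_ge0 ?(ltW k0) // mulr_ge0 ?pi_ge0.
by congr ((Num.sqrt _)%:E); rewrite -mulr_natl mulrA mulrAC.
Qed.

(** The half-line is exhausted by the images of [-K, K] under u |-> c e^u, so that the exponential
    substitution is only ever performed on compact intervals. *)
Lemma itv0y_bigcup_expR (R : realType) (c : R) : 0 < c ->
  `]0, +oo[%classic =
  \bigcup_k `[c * expR (- k.+1%:R), c * expR k.+1%:R]%classic.
Proof.
move=> c0; apply/seteqP; split=> x /=; rewrite in_itv /= andbT.
  move=> x0; have xc0 : 0 < x / c by rewrite divr_gt0.
  exists (Num.trunc `|ln (x / c)|) => //=; rewrite in_itv /=.
  have := ltW (truncnS_gt `|ln (x / c)|).
  rewrite ler_norml -ler_expR -[X in _ && X]ler_expR lnK ?posrE // => /andP[h1 h2].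
  by rewrite mulrC -ler_pdivlMr // h1 mulrC -ler_pdivrMr.
by move=> [k _] /=; rewrite in_itv /= => /andP[h _]; rewrite (lt_le_trans _ h)
    ?mulr_gt0 ?expR_gt0.
Qed.

Lemma cvg_integral_itv0y (R : realType) (c : R) (f : R -> R) : 0 < c ->
  measurable_fun `](0 : R), +oo[ f -> (forall x, 0 < x -> 0 <= f x) ->
  (\int[lebesgue_measure]_(x in `[(c * expR (- k.+1%:R))%R, (c * expR k.+1%:R)%R]) (f x)%:E
    @[k --> \oo] --> \int[lebesgue_measure]_(x in `]0%R, +oo[) (f x)%:E)%E.
Proof.
move=> c0 mf f0; rewrite (itv0y_bigcup_expR c0).
have F0 k (x : R) : x \in `[c * expR (- k.+1%:R), c * expR k.+1%:R] -> 0 < x.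
  by rewrite in_itv /= => /andP[h _]; rewrite (lt_le_trans _ h) ?mulr_gt0 ?expR_gt0.
apply: (@ge0_nondecreasing_set_cvg_integral _ _ _
    (fun k => `[c * expR (- k.+1%:R), c * expR k.+1%:R]%classic : set (measurableTypeR R))
    (fun x => (f x)%:E)) => //.
- move=> p q pq; apply/subsetPset => x /=; rewrite !in_itv /= => /andP[h1 h2].
  apply/andP; split; [apply: le_trans h1|apply: le_trans h2 _];
    by rewrite ler_pM2l // ler_expR ?lerN2 ler_nat ltnS.
- move=> k; apply/measurable_EFinP; apply: measurable_funS mf => //.
  by move=> x /= /F0; rewrite in_itv /= andbT.
- by move=> k x /F0 x0; rewrite lee_fin f0.
Qed.

(* The integrand of [Gamma q] after the substitution t = e^u. *)
Definition gamma_log (R : realType) (q u : R) : R := expR (q * u - expR u).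

Lemma is_derive_scale_expR (R : realType) (c a u : R) :
  is_derive u 1 (fun u => c * expR (a * u)) (c * a * expR (a * u)).
Proof.
have dl : is_derive u 1 (fun s : R => a * s) a.
  have := is_deriveZ a (is_derive_id u (1 : R)).
  by rewrite /GRing.scale /= mulr1.
have := is_deriveZ c (is_derive1_comp (is_derive_expR (a * u)) dl).
rewrite /GRing.scale /= => h; apply: is_derive_eq h _.
by rewrite mulrA mulrAC.
Qed.

Lemma continuous_scale_expR (R : realType) (c a : R) :
  continuous (fun u : R => c * expR (a * u)).
Proof. by apply: is_derive_continuous => u; exact: is_derive_scale_expR. Qed.

Lemma continuous_powR_pos (R : realType) (p x : R) : 0 < x ->
  {for x, continuous (fun x => x `^ p)}.
Proof.
move=> x0; apply: differentiable_continuous; apply/derivable1_diffP.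
by have [] := is_derive1_powR p x0.
Qed.

Lemma integral_scale_expR (R : realType) (c K : R) (G : R -> R) :
  0 < c -> 0 <= K -> (forall x, 0 < x -> {for x, continuous G}) ->
  (\int[lebesgue_measure]_(x in `[(c * expR (- K))%R, (c * expR K)%R]) (G x)%:E =
   \int[lebesgue_measure]_(u in `[(- K)%R, K])
     (G (c * expR u) * (c * expR u))%:E)%E.
Proof.
move=> c0 K0 cG.
have dF := fun u => is_derive_scale_expR c 1 u.
have dF1 := derive1_eq dF.
have cG' (a b : R) : {within `[c * expR (1 * a), c * expR (1 * b)], continuous G}.
  apply: continuous_in_subspaceT => x; rewrite inE /= in_itv /= => /andP[h _].
  by apply: cG; apply: lt_le_trans h; rewrite mulr_gt0 ?expR_gt0.
have cF' : continuous (fun u : R => c * 1 * expR (1 * u)) by exact: continuous_scale_expR.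
have -> : c * expR (- K) = c * expR (1 * (- K)) by rewrite mul1r.
have -> : c * expR K = c * expR (1 * K) by rewrite mul1r.
rewrite (@integration_by_substitution_increasing _ (fun u => c * expR (1 * u))) //.
- apply: eq_integral => u _.
  by rewrite dF1 mulrfctE /= mulr1 !mul1r.
- by rewrite lerNl (le_trans _ K0) // lerNl oppr0.
- by move=> x y _ _ xy; rewrite ltr_pM2l // ltr_expR !mul1r.
- by rewrite dF1 => x _; exact: cF'.
- by rewrite dF1; apply/cvg_ex; eexists; apply: cvg_at_right_filter; exact: cF'.
- by rewrite dF1; apply/cvg_ex; eexists; apply: cvg_at_left_filter; exact: cF'.
- exact: is_derive_LRcontinuous dF.
Qed.

Lemma integral_scale_expRN (R : realType) (c K : R) (G : R -> R) :
  0 < c -> 0 <= K -> (forall x, 0 < x -> {for x, continuous G}) ->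
  (\int[lebesgue_measure]_(x in `[(c * expR (- K))%R, (c * expR K)%R]) (G x)%:E =
   \int[lebesgue_measure]_(u in `[(- K)%R, K])
     (G (c * expR (- u)) * (c * expR (- u)))%:E)%E.
Proof.
move=> c0 K0 cG.
have dF := fun u => is_derive_scale_expR c (-1) u.
have dF1 := derive1_eq dF.
have cG' (a b : R) : {within `[c * expR (-1 * a), c * expR (-1 * b)], continuous G}.
  apply: continuous_in_subspaceT => x; rewrite inE /= in_itv /= => /andP[h _].
  by apply: cG; apply: lt_le_trans h; rewrite mulr_gt0 ?expR_gt0.
have cF' : continuous (fun u : R => c * (-1) * expR (-1 * u)) by exact: continuous_scale_expR.
have -> : c * expR (- K) = c * expR (-1 * K) by rewrite mulN1r.
have -> : c * expR K = c * expR (-1 * (- K)) by rewrite mulN1r opprK.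
rewrite (@integration_by_substitution_decreasing _ (fun u => c * expR (-1 * u))) //.
- apply: eq_integral => u _.
  by rewrite dF1 mulrfctE opprfctE /= !mulN1r mulrN1 mulNr opprK.
- by rewrite lerNl (le_trans _ K0) // lerNl oppr0.
- by move=> x y _ _ xy; rewrite ltr_pM2l // ltr_expR !mulN1r ltrN2.
- by rewrite dF1 => x _; exact: cF'.
- by rewrite dF1; apply/cvg_ex; eexists; apply: cvg_at_right_filter; exact: cF'.
- by rewrite dF1; apply/cvg_ex; eexists; apply: cvg_at_left_filter; exact: cF'.
- exact: is_derive_LRcontinuous dF.
Qed.

Lemma continuous_expR_comp (R : realType) (f : R -> R) (x : R) :
  {for x, continuous f} -> {for x, continuous (fun y => expR (f y))}.
Proof. by move=> cf; apply: continuous_comp => //; exact: continuous_expR. Qed.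

Lemma measurable_continuous_itv0y (R : realType) (G : R -> R) :
  (forall x, 0 < x -> {for x, continuous G}) ->
  measurable_fun `](0 : R), +oo[ G.
Proof.
move=> cG; apply: open_continuous_measurable_fun; first exact: interval_open.
by move=> x; rewrite inE /= in_itv /= andbT => /cG.
Qed.

Lemma continuous_gamma_log (R : realType) (q : R) : continuous (gamma_log q).
Proof.
move=> u; apply: (@continuous_expR_comp _ (fun u => q * u - expR u)).
apply: (@continuousB _ _ _ (fun u => q * u) expR).
  by apply: continuousM; [exact: cst_continuous|exact: cvg_id].
exact: continuous_expR.
Qed.

Lemma continuous_gamma_integrand (R : realType) (q x : R) : 0 < x ->
  {for x, continuous (fun t => t `^ (q - 1) * expR (- t))}.
Proof.
move=> x0; apply: continuousM; first exact: continuous_powR_pos.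
by apply: continuous_expR_comp; apply: continuousN; exact: cvg_id.
Qed.

Lemma gamma_logE (R : realType) (q u : R) :
  (expR u) `^ (q - 1) * expR (- expR u) * expR u = gamma_log q u.
Proof.
rewrite /gamma_log -expRM mulrAC -!expRD; congr expR; ring.
Qed.

Lemma cvg_gamma_log (R : realType) (q : R) :
  (\int[lebesgue_measure]_(u in `[(- k.+1%:R)%R, k.+1%:R]) (gamma_log q u)%:E
    @[k --> \oo] -->
   \int[lebesgue_measure]_(t in `]0%R, +oo[) (t `^ (q - 1) * expR (- t))%:E)%E.
Proof.
have := @cvg_integral_itv0y R 1 (fun t => t `^ (q - 1) * expR (- t)) ltr01
  (measurable_continuous_itv0y (@continuous_gamma_integrand R q)).
have -> : (fun k : nat => \int[lebesgue_measure]_(x in `[(1 * expR (- k.+1%:R))%R, (1 *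
    expR k.+1%:R)%R]) (x `^ (q - 1) * expR (- x))%:E)%E =
    (fun k : nat => \int[lebesgue_measure]_(u in `[(- k.+1%:R)%R, k.+1%:R]) (gamma_log q u)%:E)%E.
  apply/funext => k; rewrite integral_scale_expR //; last exact: continuous_gamma_integrand.
  by apply: eq_integral => u _; rewrite !mul1r gamma_logE.
by apply => x x0; rewrite mulr_ge0 ?powR_ge0 ?expR_ge0.
Qed.

Lemma exprn_le_expR (R : realType) (x : R) (n : nat) :
  0 <= x -> x ^+ n <= n`!%:R * expR x.
Proof.
case: n => [|n] x0; first by rewrite expr0 mul1r -expR0 ler_expR.
rewrite mulrC -ler_pdivrMr ?ltr0n ?fact_gt0 //.
by apply: le_trans (expR_ge1Dxn n x0); rewrite lerDr.
Qed.

(* The majorant is the derivative of the bounded function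
   [1 - 1 / (1 + e^(q u))]. *)
Lemma gamma_log_le (R : realType) (q : R) : 0 < q -> exists2 C, 0 < C &
  forall u, gamma_log q u <= C * (q * expR (q * u) / (1 + expR (q * u)) ^+ 2).
Proof.
move=> q0; pose N := (Num.trunc q).+1.
have qN : q <= N%:R by apply/ltW/truncnS_gt.
(* With y = e^u, the square (1 + e^(q u))^2 is at most 4 (1 + y)^(2N), hence at most 4 (2N)! e^(1 +
   y). The factor e^y cancels against the e^(-y) of [gamma_log], and 1/q cancels the q of the
   majorant. *)
pose C := 4 * ((N.*2)`!%:R * expR 1) / q.
have C0 : 0 < C by rewrite divr_gt0 // !mulr_gt0 ?expR_gt0 ?ltr0n ?fact_gt0.
exists C => // u; set y := expR u; have y0 : 0 < y by exact: expR_gt0.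
have e0 : 0 < 1 + expR (q * u) by rewrite addr_gt0 ?expR_gt0.
have h1 : expR (q * u) <= (1 + y) ^+ N.
  rewrite mulrC expRM -powR_mulrn ?addr_ge0 ?(ltW y0) //.
  have y1 : 0 <= 1 + y by rewrite addr_ge0 // ltW.
  apply: (@le_trans _ _ ((1 + y) `^ q)).
    by rewrite ge0_ler_powR ?nnegrE ?(ltW q0) ?(ltW y0) // lerDr.
  by apply: ler_powR => //; rewrite lerDl ltW.
have h2 : (1 + expR (q * u)) ^+ 2 <= 4 * ((N.*2)`!%:R * (expR 1 * expR y)).
  rewrite -expRD.
  apply: (@le_trans _ _ ((2 * (1 + y) ^+ N) ^+ 2)).
    rewrite ler_pXn2r ?nnegrE ?(ltW e0) //; last by rewrite mulr_ge0 ?exprn_ge0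
        ?addr_ge0 ?(ltW y0).
    rewrite mulr_natl mulr2n lerD // exprn_ege1 // lerDl ltW //.
  rewrite exprMn -exprM muln2 -natrX ler_pM2l //.
  by apply: exprn_le_expR; rewrite addr_ge0 ?(ltW y0).
rewrite /gamma_log expRD expRN -/y.
have -> : C * (q * expR (q * u) / (1 + expR (q * u)) ^+ 2) =
    expR (q * u) * (4 * ((N.*2)`!%:R * expR 1) / (1 + expR (q * u)) ^+ 2).
  by rewrite /C; field; rewrite !gt_eqF.
rewrite ler_pM2l ?expR_gt0 // ler_pdivlMr ?exprn_gt0 //.
by rewrite mulrC ler_pdivrMr ?expR_gt0 // -!mulrA.
Qed.

Lemma integral_gamma_log_le (R : realType) (q : R) : 0 < q ->
  exists C : R, forall k : nat,
  (\int[lebesgue_measure]_(u in `[(- k.+1%:R)%R, k.+1%:R]) (gamma_log q u)%:E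
    <= C%:E)%E.
Proof.
move=> q0; have [C C0 HC] := gamma_log_le q0.
exists C => k.
have e0 u : 0 < 1 + expR (q * u) by rewrite addr_gt0 ?expR_gt0.
pose f u := q * expR (q * u) / (1 + expR (q * u)) ^+ 2.
(* The antiderivative takes values between -1 and 0, so the integral of f over any interval is at
   most 1. *)
have dF (u : R) : is_derive u 1 (fun u => - (1 + expR (q * u))^-1) (f u).
  have d1 : is_derive u 1 (fun u => 1 + expR (q * u)) (q * expR (q * u)).
    have := is_deriveD (is_derive_cst (1 : R) u (1 : R)) (is_derive_scale_expR 1 q u).
    rewrite add0r mul1r; rewrite (_ : _ + _ = fun u => 1 + expR (q * u)) //.
    by apply/funext => x; rewrite addrfctE mul1r.
  have := is_deriveN (@is_deriveV _ (fun u => 1 + expR (q * u)) u _ 1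
    (lt0r_neq0 (e0 u)) d1).
  move=> h; apply: is_derive_eq h _; rewrite /f /GRing.scale /=; field.
  by rewrite gt_eqF.
have ce (u : R) : {for u, continuous (fun u => expR (q * u))}.
  apply: (@continuous_expR_comp _ (fun u => q * u)).
  by apply: continuousM; [exact: cst_continuous|exact: cvg_id].
have cf : continuous f.
  move=> u; apply: (@continuousM _ _ (fun u => q * expR (q * u))
      (fun u => ((1 + expR (q * u)) ^+ 2)^-1)).
    by apply: continuousM; [exact: cst_continuous|exact: ce].
  apply: (@continuousV _ _ (fun u => (1 + expR (q * u)) ^+ 2)); first by rewrite
      expf_neq0 // gt_eqF.
  apply: (@continuous_comp _ _ _ (fun u => 1 + expR (q * u)) (fun y => y ^+ 2)); last
      exact: exprn_continuous.
  by apply: continuousD; [exact: cst_continuous|exact: ce].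
apply: (@le_trans _ _ (\int[lebesgue_measure]_(u in `[(- k.+1%:R)%R, k.+1%:R])
    (C%:E * (f u)%:E))%E).
  apply: ge0_le_integral => //.
  - by move=> u _; rewrite lee_fin expR_ge0.
  - apply/measurable_EFinP; apply: (@measurable_funS _ _ _ _ setT) => //.
    by apply: continuous_measurable_fun; exact: continuous_gamma_log.
  - apply/measurable_EFinP; apply: measurable_funM; first exact: measurable_cst.
    apply: (@measurable_funS _ _ _ _ setT) => //.
    exact: continuous_measurable_fun.
  - by move=> u _; rewrite -EFinM lee_fin HC.
rewrite ge0_integralZl_EFin //; last 3 first.
- by move=> u _; rewrite lee_fin divr_ge0 ?exprn_ge0 ?mulr_ge0 ?expR_ge0 ?ltW.
- apply/measurable_EFinP; apply: (@measurable_funS _ _ _ _ setT) => //.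
  exact: continuous_measurable_fun.
- exact: ltW.
rewrite (integral_derive _ dF) //; last by rewrite gtrN.
rewrite -EFinM lee_fin ler_piMr ?(ltW C0) // opprK.
rewrite addrC lerBlDr.
apply: (@le_trans _ _ 1); last by rewrite lerDl invr_ge0 ltW.
by rewrite invf_le1 // lerDl expR_ge0.
Qed.

(** [Gamma] is a real-valued integral, which would silently be 0 if the integral were infinite;
    finiteness makes it the value of the extended one. *)
Lemma gamma_integral_fin (R : realType) (q : R) : 0 < q ->
  (\int[lebesgue_measure]_(t in `]0%R, +oo[) (t `^ (q - 1) * expR (- t))%:E =
   (Gamma q)%:E)%E.
Proof.
move=> q0; rewrite /Gamma /Rintegral fineK //.
rewrite ge0_fin_numE; last first.
  by apply: integral_ge0 => t _; rewrite lee_fin mulr_ge0 ?powR_ge0 ?expR_ge0.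
have [C HC] := integral_gamma_log_le q0.
apply: (@le_lt_trans _ _ C%:E); last exact: ltry.
by apply: cvge_le (@cvg_gamma_log R q); exact: nearW.
Qed.

Lemma Gamma_gt0 (R : realType) (q : R) : 0 < q -> 0 < Gamma q.
Proof.
move=> q0; rewrite -lte_fin -gamma_integral_fin //.
(* A lower bound of the integrand on [1, 2]: a power is monotone there, hence at least the smaller
   of its end values 1 and 2^(q-1). *)
pose m := Num.min (2 `^ (q - 1)) 1 * expR (- 2).
have m0 : 0 < m by rewrite mulr_gt0 ?expR_gt0 // lt_min powR_gt0 //=.
apply: (@lt_le_trans _ _ (\int[lebesgue_measure]_(t in `[1%R, 2%R]) m%:E)%E).
  rewrite integral_cst //= lebesgue_measure_itv /= lte_fin ltr1n -EFinB -EFinM lte_fin.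
  by rewrite mulr_gt0 // subr_gt0 ltr1n.
have mG := measurable_continuous_itv0y (@continuous_gamma_integrand R q).
have sub : `[1, 2] `<=` `](0 : R), +oo[%classic.
  by move=> x /=; rewrite !in_itv /= => /andP[x1 _]; rewrite (lt_le_trans _ x1).
apply: (@le_trans _ _ (\int[lebesgue_measure]_(t in `[1%R, 2%R])
    (t `^ (q - 1) * expR (- t))%:E)%E).
  apply: ge0_le_integral => //.
  - by move=> t _; rewrite lee_fin ltW.
  - by apply/measurable_EFinP; apply: measurable_funS mG.
  - move=> t; rewrite /= in_itv /= => /andP[t1 t2]; rewrite lee_fin.
    apply: ler_pM; rewrite ?expR_ge0 ?ler_expR ?lerN2 //.
    have t0 : 0 < t by exact: lt_le_trans t1.
    have [q1|q1] := leP 0 (q - 1).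
      rewrite ge_min; apply/orP; right.
      by rewrite -[leLHS](powRr0 t) ler_powR.
    have [p pE] : exists p, q - 1 = - p by exists (1 - q); rewrite opprB.
    rewrite pE oppr_lt0 in q1; rewrite ge_min; apply/orP; left; rewrite pE !powRN.
    rewrite lef_pV2 ?posrE ?powR_gt0 // ge0_ler_powR ?nnegrE ?(ltW t0) ?(ltW q1) //.
apply: ge0_subset_integral => //; first exact/measurable_EFinP.
by move=> t _; rewrite lee_fin mulr_ge0 ?powR_ge0 ?expR_ge0.
Qed.

Lemma inv_gamma_integral (R : realType) (q al : R) : 0 < q -> 0 < al ->
  (\int[lebesgue_measure]_(x in `]0%R, +oo[)
     (x `^ (- q - 1) * expR (- (2^-1 * (al / x))))%:E =
   ((2 / al) `^ q * Gamma q)%:E)%E.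
Proof.
(* The substitution x = c e^(-u) with c = al/2 turns al / (2 x) into e^u, and so the integrand into
   a multiple of [gamma_log q]. *)
move=> q0 al0; pose c := al / 2; have c0 : 0 < c by rewrite divr_gt0.
pose G (x : R) := x `^ (- q - 1) * expR (- (2^-1 * (al / x))).
have cG x : 0 < x -> {for x, continuous G}.
  move=> x0; apply: continuousM; first exact: continuous_powR_pos.
  apply: continuous_expR_comp; apply: continuousN.
  apply: continuousM; first exact: cst_continuous.
  apply: continuousM; first exact: cst_continuous.
  by apply: continuousV; [rewrite gt_eqF|exact: cvg_id].
have GE (u : R) : G (c * expR (- u)) * (c * expR (- u)) = (2 / al) `^ q * gamma_log q u.
  have p0 : 0 < c * expR (- u) by rewrite mulr_gt0 ?expR_gt0.
  have pw x : 0 < x -> x `^ (- q - 1) * x = x `^ (- q).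
    move=> x0; rewrite -{2}(powRr1 (ltW x0)) -powRD ?subrK //.
    by rewrite (gt_eqF x0) implybT.
  rewrite /G mulrAC pw // powRM ?expR_ge0 ?(ltW c0) // -expRM.
  have -> : c `^ (- q) = (2 / al) `^ q.
    rewrite powRN -[2 / al]invrK invf_div -/c -[in RHS](powR_inv1 (ltW c0)) -powRrM.
    by rewrite mulN1r powRN.
  rewrite -mulrA -expRD /gamma_log; congr (_ * expR _).
  have -> : al / (c * expR (- u)) = 2 * expR u.
    by rewrite expRN /c; field; rewrite gt_eqF ?expR_gt0 // gt_eqF.
  by rewrite mulKf //; ring.
have := @cvg_integral_itv0y R c G c0 (measurable_continuous_itv0y cG).
have -> : (fun k : nat => \int[lebesgue_measure]_(x in `[(c * expR (- k.+1%:R))%R, (c *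
    expR k.+1%:R)%R]) (G x)%:E)%E =
    (fun k : nat => ((2 / al) `^ q)%:E * \int[lebesgue_measure]_(u in `[(- k.+1%:R)%R,
        k.+1%:R]) (gamma_log q u)%:E)%E.
  apply/funext => k; rewrite integral_scale_expRN //.
  under eq_integral do rewrite GE EFinM.
  rewrite ge0_integralZl_EFin ?powR_ge0 //.
  - by move=> u _; rewrite lee_fin expR_ge0.
  - apply/measurable_EFinP; apply: (@measurable_funS _ _ _ _ setT) => //.
    by apply: continuous_measurable_fun; exact: continuous_gamma_log.
move=> HG; have {}HG := HG (fun x x0 => mulr_ge0 (powR_ge0 _ _) (expR_ge0 _)).
have H : (((2 / al) `^ q)%:E * \int[lebesgue_measure]_(u in `[(- k.+1%:R)%R, k.+1%:R])
    (gamma_log q u)%:E)%E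
    @[k --> \oo] --> (((2 / al) `^ q)%:E * \int[lebesgue_measure]_(t in `]0%R, +oo[) (t
        `^ (q - 1) * expR (- t))%:E)%E.
  exact: cvgeZl (@cvg_gamma_log R q).
rewrite gamma_integral_fin // -EFinM in H.
exact: cvg_unique HG H.
Qed.

(** * Gaussian integrals *)

Lemma mx_measurable_tr (R : realType) (d : measure_display)
    (T : measurableType d) (D : set T) (p q : nat) (F : T -> 'M[R]_(p, q)) :
  mx_measurable D F -> mx_measurable D (fun x => (F x)^T).
Proof. by move=> mF i j; under eq_fun do rewrite mxE; exact: mF. Qed.

Lemma mx_measurableD (R : realType) (d : measure_display)
    (T : measurableType d) (D : set T) (p q : nat) (F G : T -> 'M[R]_(p, q)) :
  mx_measurable D F -> mx_measurable D G ->
  mx_measurable D (fun x => F x + G x).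
Proof.
by move=> mF mG i j; under eq_fun do rewrite mxE; exact: measurable_funD.
Qed.

Definition col_of_seq (R : realType) (m : nat) (s : seq R) : 'cV[R]_m :=
  \col_(i < m) s`_i.

Lemma mx_measurable_col_of_seq (R : realType) (n : nat) (d : measure_display)
    (T : measurableType d) (f : T -> n.-tuple (measurableTypeR R)) :
  measurable_fun setT f ->
  mx_measurable setT (fun x => col_of_seq n (f x : seq R)).
Proof.
move=> mf i j; under eq_fun do rewrite mxE.
rewrite (_ : (fun x => _) = fun x => tnth (f x) i : R).
  exact: ((measurable_fun_tnthP _).1 mf).
by apply/funext => x; rewrite (tnth_nth (0 : R)).
Qed.

Lemma eq_seq_integral (R : realType) (n : nat) (f g : seq R -> \bar R) :
  (forall t, size t = n -> f t = g t) -> seq_integral n f = seq_integral n g.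
Proof. by move=> fg; apply: eq_integral => t _; rewrite fg // size_tuple. Qed.

Definition qform (R : realType) (m : nat) (K : 'M[R]_m) (x : 'cV[R]_m) : R :=
  (x^T *m K *m x) 0 0.

Lemma measurable_qform (R : realType) (d : measure_display)
    (T : measurableType d) (D : set T) (m : nat) (K : T -> 'M[R]_m)
    (x : T -> 'cV[R]_m) :
  mx_measurable D K -> mx_measurable D x ->
  measurable_fun D (fun t => qform (K t) (x t)).
Proof.
move=> mK mx; apply: (mx_measurableM (F := fun t => (x t)^T *m K t)) => //.
by apply: mx_measurableM => //; exact: mx_measurable_tr.
Qed.

(** Completing the square in the first coordinate. *)
Lemma qform_schur (R : realType) (m : nat) (K : 'M[R]_(1 + m)) (x : R)
    (y : 'cV[R]_m) : K^T = K -> K 0 0 != 0 ->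
  qform K (col_mx x%:M y) =
  K 0 0 * (x + ((schur_elim K)^T *m y) 0 0) ^+ 2 + qform (schur K) y.
Proof.
move=> Ks K0; rewrite {1}(schurE Ks K0) /qform; set v := schur_elim K.
have -> : (col_mx x%:M y)^T *m (unitri v *m block_mx (K 0 0)%:M 0 0 (schur K)
      *m (unitri v)^T) *m col_mx x%:M y =
    ((unitri v)^T *m col_mx x%:M y)^T *m block_mx (K 0 0)%:M 0 0 (schur K)
      *m ((unitri v)^T *m col_mx x%:M y).
  by rewrite trmx_mul trmxK !mulmxA.
rewrite tr_unitri mul_block_col !mul1mx mul0mx add0r quad_block.
by rewrite !mxE /= mulr1n.
Qed.

Lemma measurable_expRNhalf (R : realType) (d : measure_display)
    (T : measurableType d) (D : set T) (f : T -> R) :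
  measurable_fun D f -> measurable_fun D (fun x => expR (- (2^-1 * f x))).
Proof.
move=> mf; apply: (measurableT_comp (@measurable_expR R)).
by apply: measurable_funN; apply: measurable_funM => //; exact: measurable_cst.
Qed.

Lemma det_posdef_gt0 (R : realType) (m : nat) (A : 'M[R]_m) :
  posdef A -> 0 < \det A.
Proof.
elim: m A => [|m IHm] A Ap; first by rewrite det_mx00.
have [a0 Sp] := (posdef_schur (posdef_sym Ap)).1 Ap.
by rewrite (det_schur (posdef_sym Ap) (lt0r_neq0 a0)) mulr_gt0 ?IHm.
Qed.

Lemma measurable_gauss (R : realType) (m : nat) (K : 'M[R]_m) :
  seq_measurable m (fun s => (expR (- (2^-1 * qform K (col_of_seq m s))))%:E).
Proof.
apply/measurable_EFinP; apply: measurable_expRNhalf; apply: measurable_qform.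
  exact: mx_measurable_cst.
exact: mx_measurable_col_of_seq.
Qed.

(** Once the square is completed, the integral over the first variable does not depend on the
    others; the one-dimensional factors multiply to the determinant because the pivots do. *)
Lemma seq_integral_gauss0 (R : realType) (m : nat) (K : 'M[R]_m) : posdef K ->
  seq_integral m (fun s => (expR (- (2^-1 * qform K (col_of_seq m s))))%:E) =
  (((2 * pi) ^+ m / \det K) `^ 2^-1)%:E.
Proof.
elim: m K => [|m IHm] K Kp.
  rewrite seq_integral0 det_mx00 expr0 divr1 powR1.
  by rewrite /qform mxE big_ord0 mulr0 oppr0 expR0.
have [K0 Sp] := (posdef_schur (posdef_sym Kp)).1 Kp.
have K0N := lt0r_neq0 K0; have Ks := posdef_sym Kp.
rewrite seq_integralSr //; last first.
  exact: measurable_gauss.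
rewrite (@eq_seq_integral _ _ _ (fun s => ((2 * pi / K 0 0) `^ 2^-1)%:E *
    (expR (- (2^-1 * qform (schur (K : 'M[R]_(1 + m))) (col_of_seq m s))))%:E)%E); last first.
  move=> s sm; rewrite -(@integral_gauss1 _ (K 0 0) (((schur_elim (K : 'M[R]_(1 +
      m)))^T *m col_of_seq m s) 0 0)) //.
  rewrite -ge0_integralZr //; last first.
    apply/measurable_EFinP; apply: measurable_expRNhalf.
    apply: measurable_funM; first exact: measurable_cst.
    apply: measurable_funX; apply: measurable_funD; first exact: measurable_id.
    exact: measurable_cst.
  apply: eq_integral => x _; rewrite -EFinM -expRD; congr (expR _)%:E.
  rewrite -opprD -mulrDr -qform_schur //; congr (- (_ * qform K _)).
  apply/colP => i; rewrite !mxE; case: splitP => j ij; rewrite !mxE ij //.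
  by rewrite !ord1 /= mulr1n.
rewrite /seq_integral ge0_integralZl_EFin ?powR_ge0 //; last exact: measurable_gauss.
rewrite [X in (_ * X)%E](IHm _ Sp) -EFinM -powRM; last 2 first.
- by rewrite divr_ge0 ?(ltW K0) // mulr_ge0 ?pi_ge0.
- by rewrite divr_ge0 ?(ltW (det_posdef_gt0 Sp)) // exprn_ge0 // mulr_ge0 ?pi_ge0.
congr ((_ `^ _)%:E); rewrite (det_schur Ks K0N) exprS invfM; ring.
Qed.

Lemma col_of_seq_add (R : realType) (m : nat) (s w : seq R) : size w = size s ->
  col_of_seq m (seq_add s w) = col_of_seq m s + col_of_seq m w.
Proof. by move=> sw; apply/colP => i; rewrite !mxE nth_seq_add. Qed.

Lemma seq_integral_gauss (R : realType) (m : nat) (K : 'M[R]_m) (mu : 'cV[R]_m) :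
  posdef K ->
  seq_integral m (fun s => (expR (- (2^-1 * qform K (col_of_seq m s - mu))))%:E) =
  (((2 * pi) ^+ m / \det K) `^ 2^-1)%:E.
Proof.
move=> Kp; rewrite -(seq_integral_gauss0 Kp).
pose w := [tuple - mu i 0 | i < m].
rewrite -[RHS](seq_integral_shift (w := w) _ (measurable_gauss K)); last 2 first.
- by move=> s; rewrite lee_fin expR_ge0.
- exact: size_tuple.
apply: eq_seq_integral => s sm; rewrite col_of_seq_add ?sm ?size_tuple //.
have -> : col_of_seq m w = - mu.
  by apply/colP => i; rewrite !mxE -tnth_nth tnth_mktuple.
by [].
Qed.

(** * The normalizing constant *)

(** The coordinates of a matrix of size 1 + m are its corner, the rest of its first row, then the
    coordinates of its lower block: the order of enumeration fits the Schur decomposition. *)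
Lemma upper_seqS (m : nat) :
  upper_seq m.+1 = [seq (ord0, j) | j <- enum 'I_m.+1] ++
    [seq (lift ord0 ij.1, lift ord0 ij.2) | ij <- upper_seq m].
Proof.
pose P (n : nat) (ij : 'I_n * 'I_n) := (ij.1 <= ij.2)%N.
have row (E1 E2 : seq 'I_m) :
    seq.filter (P m.+1) [seq (i, j) | i <- map (lift ord0) E1, j <- ord0 :: map (lift ord0) E2] =
    [seq (lift ord0 ij.1, lift ord0 ij.2) | ij <- seq.filter (P m) [seq (i, j) | i <-
        E1, j <- E2]].
  elim: E1 => [//|i E1 IH] /=; rewrite filter_cat filter_cat map_cat -IH.
  congr (_ ++ _); rewrite -map_comp !filter_map -!map_comp; congr map.
rewrite /upper_seq [in LHS]enum_ordSl allpairs_cons filter_cat -/(P m.+1).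
congr (_ ++ _); last exact: row.
rewrite -enum_ordSl filter_map; congr map.
by rewrite (eq_filter (a2 := predT)) ?filter_predT.
Qed.

Definition vech (R : realType) (m : nat) (A : 'M[R]_m) : seq R :=
  [seq A ij.1 ij.2 | ij <- upper_seq m].

Definition symm_of_seq (R : realType) (m : nat) (s : seq R) : 'M[R]_m :=
  symm_of (col_of_seq (tri m) s).

Lemma size_vech (R : realType) (m : nat) (A : 'M[R]_m) : size (vech A) = tri m.
Proof. by rewrite size_map; exact/eqP/size_upper_seq. Qed.

Lemma nth_vech (R : realType) (m : nat) (A : 'M[R]_m) (k : 'I_(tri m)) :
  (vech A)`_k = A (tnth (upper_idx m) k).1 (tnth (upper_idx m) k).2.
Proof.
rewrite (nth_map (tnth (upper_idx m) k)) ?(eqP (size_upper_seq m)) //.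
by rewrite -(tnth_nth _ (upper_idx m)).
Qed.

Lemma col_of_seq_vech (R : realType) (m : nat) (A : 'M[R]_m) :
  col_of_seq (tri m) (vech A) = nu A.
Proof. by apply/colP => k; rewrite !mxE nth_vech. Qed.

Lemma vechK (R : realType) (m : nat) (A : 'M[R]_m) :
  A^T = A -> symm_of_seq m (vech A) = A.
Proof. by move=> As; rewrite /symm_of_seq col_of_seq_vech nuK. Qed.

Lemma symm_of_seqK (R : realType) (m : nat) (s : seq R) :
  size s = tri m -> vech (symm_of_seq m s) = s.
Proof.
move=> sm; apply: (@eq_from_nth _ 0); rewrite size_vech ?sm // => i im.
by rewrite (nth_vech _ (Ordinal im)) symm_of_upper mxE.
Qed.

Lemma vech_block (R : realType) (m : nat) (a : R) (b : 'cV[R]_m) (S : 'M[R]_m) :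
  vech (block_mx a%:M b^T b S : 'M[R]_m.+1) =
  a :: [seq b i 0 | i <- enum 'I_m] ++ vech S.
Proof.
rewrite /vech upper_seqS enum_ordSl map_cat /= -!map_comp.
set B := block_mx _ _ _ _.
have E00 : B (lshift m 0) (lshift m 0) = a by rewrite block_mxEul mxE eqxx mulr1n.
have E01 j : B (lshift m 0) (rshift 1 j) = b j 0 by rewrite block_mxEur mxE.
have E11 i j : B (rshift 1 i) (rshift 1 j) = S i j by rewrite block_mxEdr.
have e0 : lshift m (0 : 'I_1) = ord0 :> 'I_m.+1 by exact/val_inj.
have el i : rshift 1 i = lift ord0 i :> 'I_m.+1 by exact/val_inj.
rewrite e0 in E00 E01; congr (_ :: _ ++ _) => //.
- by apply: eq_map => i /=; rewrite -E01 el.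
- by apply: eq_map => i /=; rewrite -E11 !el.
Qed.

Lemma symm_of_seqS (R : realType) (m : nat) (a : R) (b r : seq R) :
  size b = m -> size r = tri m ->
  symm_of_seq m.+1 (a :: b ++ r) =
  block_mx a%:M (col_of_seq m b)^T (col_of_seq m b) (symm_of_seq m r) :> 'M[R]_(1 + m).
Proof.
move=> bm rm; set A := RHS.
have As : A^T = A.
  by rewrite /A tr_block_mx tr_scalar_mx trmxK symm_of_sym.
rewrite -[RHS](vechK As) /A vech_block symm_of_seqK //; congr (symm_of_seq _ (a :: _ ++ _)).
have sz : size [seq col_of_seq m b i 0 | i <- enum 'I_m] = m.
  by rewrite size_map size_enum_ord.
apply: (@eq_from_nth _ 0); first by rewrite sz bm.
move=> i; rewrite bm => im.
by rewrite (nth_map (Ordinal im)) ?size_enum_ord // mxE nth_enum_ord.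
Qed.

Lemma triS (m : nat) : tri m.+1 = (m + tri m).+1.
Proof.
rewrite /tri -[in RHS]addSn.
have -> : (m.+1 * m.+2 = m.+1.*2 + m * m.+1)%N by rewrite -muln2; ring.
by rewrite halfD odd_double /= doubleK.
Qed.

(** The unnormalized density, extended by 0 off the cone, so that Tonelli's theorem and translations
    apply on the full coordinate space without tracking domains. *)
Definition iw_kernel (R : realType) (m : nat) (e : R) (S X : 'M[R]_m) : R :=
  if `[< posdef X >] then
    \det X `^ (- e) * expR (- (2^-1 * \tr (S *m invmx X))) else 0.

Lemma iw_kernel_ge0 (R : realType) (m : nat) (e : R) (S X : 'M[R]_m) :
  0 <= iw_kernel e S X.
Proof. by rewrite /iw_kernel; case: ifP => // _; rewrite mulr_ge0 ?powR_ge0 ?expR_ge0. Qed.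

Lemma iw_kernelT (R : realType) (m : nat) (e : R) (S X : 'M[R]_m) : posdef X ->
  iw_kernel e S X = \det X `^ (- e) * expR (- (2^-1 * \tr (S *m invmx X))).
Proof. by move=> Xp; rewrite /iw_kernel asboolT. Qed.

Lemma iw_kernelF (R : realType) (m : nat) (e : R) (S X : 'M[R]_m) :
  ~ posdef X -> iw_kernel e S X = 0.
Proof. by move=> Xp; rewrite /iw_kernel asboolF. Qed.

(** Lets formulas that contain [invmx] be handled on the cone alone, where the matrices are
    invertible. *)
Lemma measurable_fun_posdef_supp (R : realType) (d : measure_display)
    (T : measurableType d) (m : nat) (F : T -> 'M[R]_m) (f : T -> R) :
  (forall x, (F x)^T = F x) -> mx_measurable setT F ->
  (forall x, ~ posdef (F x) -> f x = 0) ->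
  measurable_fun [set x | posdef (F x)] f -> measurable_fun setT f.
Proof.
move=> Fs mF f0 mf; have mD := measurable_posdef Fs mF.
rewrite (_ : f = f \_ [set x | posdef (F x)]); first exact/(measurable_restrictT _ mD).
apply/funext => x; rewrite patchE; case: ifPn => //.
by rewrite notin_setE => /f0.
Qed.

Lemma mx_measurable_funS (R : realType) (d : measure_display)
    (T : measurableType d) (D : set T) (p q : nat) (F : T -> 'M[R]_(p, q)) :
  mx_measurable setT F -> mx_measurable D F.
Proof. by move=> mF i j; apply: (@measurable_funS _ _ _ _ setT). Qed.

Lemma mx_measurable_invmx_posdef (R : realType) (d : measure_display)
    (T : measurableType d) (m : nat) (F : T -> 'M[R]_m) :
  mx_measurable setT F ->
  mx_measurable [set x | posdef (F x)] (fun x => invmx (F x)).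
Proof.
move=> mF; apply: mx_measurable_inv; first by move=> x; exact: posdef_unit.
exact: mx_measurable_funS.
Qed.

Lemma measurable_iw_kernel (R : realType) (d : measure_display)
    (T : measurableType d) (m : nat) (e : R) (S : 'M[R]_m) (F : T -> 'M[R]_m) :
  (forall x, (F x)^T = F x) -> mx_measurable setT F ->
  measurable_fun setT (fun x => iw_kernel e S (F x)).
Proof.
move=> Fs mF; apply: (measurable_fun_posdef_supp Fs mF) => [x|].
  exact: iw_kernelF.
apply: (@eq_measurable_fun _ _ _ _ _ (fun x => \det (F x) `^ (- e) *
    expR (- (2^-1 * \tr (S *m invmx (F x)))))).
  by move=> x /set_mem /= Fp; rewrite iw_kernelT.
apply: measurable_funM.
  apply: (measurableT_comp (f := fun y : R => y `^ (- e))) => //.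
  by apply: measurable_det; exact: mx_measurable_funS.
apply: measurable_expRNhalf; apply: measurable_mxtrace; apply: mx_measurableM.
  exact: mx_measurable_cst.
exact: mx_measurable_invmx_posdef.
Qed.

Lemma mx_measurable_symm_of (R : realType) (d : measure_display)
    (T : measurableType d) (D : set T) (m : nat) (x : T -> 'cV[R]_(tri m)) :
  mx_measurable D x -> mx_measurable D (fun t => symm_of (x t)).
Proof.
move=> mx i j; under eq_fun do rewrite mxE.
under eq_fun do rewrite big_mkcond; apply: measurable_sum => k.
by case: (_ || _); [exact: mx|exact: measurable_cst].
Qed.

Lemma qformZ (R : realType) (m : nat) (a : R) (K : 'M[R]_m) (x : 'cV[R]_m) :
  qform (a *: K) x = a * qform K x.
Proof. by rewrite /qform -scalemxAr -scalemxAl mxE. Qed.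

Lemma qformZr (R : realType) (m : nat) (a : R) (K : 'M[R]_m) (x : 'cV[R]_m) :
  qform K (a *: x) = a ^+ 2 * qform K x.
Proof.
have -> : qform K (a *: x) = (a *: (a *: (x^T *m K *m x))) 0 0.
  by rewrite scalemxAr !scalemxAl -linearZ.
by rewrite 2!mxE expr2 mulrA.
Qed.

(** Factoring both matrices by [schurE] and cycling the trace leaves two block diagonal matrices
    with the single unitriangular factor of w - v between them. The quadratic form comes from w - v,
    which is -1/a times the vector y of the overview. *)
Lemma mxtrace_schur (R : realType) (m : nat) (S X : 'M[R]_(1 + m)) :
  S^T = S -> X^T = X -> S 0 0 != 0 -> X 0 0 != 0 -> schur X \in unitmx ->
  \tr (S *m invmx X) = S 0 0 / X 0 0 +
    qform ((S 0 0 / X 0 0 ^+ 2) *: invmx (schur X))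
      (dlsubmx X - (X 0 0 / S 0 0) *: dlsubmx S) +
    \tr (schur S *m invmx (schur X)).
Proof.
move=> Ss Xs s0 x0 Xu; set w := schur_elim S; set v := schur_elim X.
have DXu : (block_mx (X 0 0)%:M 0 0 (schur X) : 'M[R]_(1 + m)) \in unitmx.
  by rewrite unitmxE det_lblock det_scalar1 unitrM unitfE x0 -unitmxE.
rewrite {1}(schurE Ss s0) {1}(schurE Xs x0) -/w -/v.
rewrite invmx_congr ?unitri_unit // invmx_block_diag // invmx_unitri tr_unitri.
rewrite mulmxA mxtrace_mulC !mulmxA.
rewrite unitriD -!mulmxA [X in _ *m (_ *m X)]mulmxA -tr_unitri -[(unitri w)^T *m _]trmx_mul.
rewrite unitriD !mulmxA unitri_congr mulmx_block !(mulmx0, mul0mx, addr0, add0r).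
rewrite mxtrace_block -scalar_mxM mxtrace_scalar mulr1n -addrA; congr (_ + _).
rewrite mulmxDl mxtraceD; congr (_ + _).
rewrite -scalemxAl mxtraceZ -mulmxA mxtrace_mulC /mxtrace big_ord1.
have -> : - v + w = - (X 0 0)^-1 *: (dlsubmx X - (X 0 0 / S 0 0) *: dlsubmx S).
  rewrite /v /w /schur_elim scalerBr scaleNr scalerA; congr (_ + _).
  by rewrite -scaleNr; congr (_ *: _); field; rewrite s0.
rewrite -/(qform _ _) qformZ qformZr.
by field.
Qed.

Lemma block_mx11_00 (R : realType) (m : nat) (a : R) (b : 'rV[R]_m)
    (c : 'cV[R]_m) (S : 'M[R]_m) :
  (block_mx a%:M b c S : 'M[R]_(1 + m)) 0 0 = a.
Proof. by rewrite -(lshift0 m 0) block_mxEul mxE eqxx mulr1n. Qed.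

(** The identity also holds off the cone: for a > 0 the matrix is positive definite exactly when its
    Schur complement is, so both sides vanish together. *)
Lemma iw_kernel_block (R : realType) (m : nat) (e : R) (S : 'M[R]_(1 + m))
    (a : R) (b : 'cV[R]_m) (C : 'M[R]_m) :
  S^T = S -> 0 < S 0 0 -> C^T = C -> 0 < a ->
  iw_kernel e S (block_mx a%:M b^T b C) =
  a `^ (- e) * expR (- (2^-1 * (S 0 0 / a))) *
  (expR (- (2^-1 * qform ((S 0 0 / a ^+ 2) *: invmx (C - a^-1 *: (b *m b^T)))
     (b - (a / S 0 0) *: dlsubmx S))) *
   iw_kernel e (schur S) (C - a^-1 *: (b *m b^T))).
Proof.
move=> Ss s0 Cs a0; set X := block_mx _ _ _ _.
have X00 : X 0 0 = a by rewrite block_mx11_00.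
have Xs : X^T = X by rewrite tr_block_mx tr_scalar_mx trmxK Cs.
have SX : schur X = C - a^-1 *: (b *m b^T).
  by rewrite /schur X00 block_mxKdr block_mxKdl block_mxKur.
rewrite -SX; have [Xp|Xp] := pselect (posdef X); last first.
  rewrite iw_kernelF // iw_kernelF ?mulr0 // => Sp; apply: Xp.
  by apply/(posdef_schur Xs); rewrite X00.
have [_ Sp] := (posdef_schur Xs).1 Xp.
rewrite !iw_kernelT // (mxtrace_schur Ss Xs) ?X00 ?gt_eqF // ?posdef_unit //.
rewrite (det_schur Xs) ?X00 ?gt_eqF // block_mxKdl.
rewrite powRM ?(ltW a0) ?(ltW (det_posdef_gt0 Sp)) // !mulrDr !opprD !expRD.
by ring.
Qed.

Lemma iw_kernel_block_le0 (R : realType) (m : nat) (e : R) (S : 'M[R]_(1 + m))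
    (a : R) (b : 'cV[R]_m) (C : 'M[R]_m) :
  a <= 0 -> iw_kernel e S (block_mx a%:M b^T b C) = 0.
Proof.
move=> a0; rewrite iw_kernelF // => /posdef00.
by rewrite block_mx11_00 ltNge a0.
Qed.

Lemma symm_of_seq_add (R : realType) (m : nat) (s w : seq R) :
  size w = size s ->
  symm_of_seq m (seq_add s w) = symm_of_seq m s + symm_of_seq m w.
Proof.
move=> sw; apply/matrixP => i j; rewrite /symm_of_seq col_of_seq_add // !mxE -big_split.
by apply: eq_bigr => k _; rewrite mxE.
Qed.

Lemma mx_measurable_symm_of_seq (R : realType) (m : nat) (d : measure_display)
    (T : measurableType d) (f : T -> (tri m).-tuple (measurableTypeR R)) :
  measurable_fun setT f ->
  mx_measurable setT (fun x => symm_of_seq m (f x : seq R)).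
Proof.
by move=> mf; apply: mx_measurable_symm_of; exact: mx_measurable_col_of_seq.
Qed.

Lemma mx_measurableB_cst (R : realType) (d : measure_display)
    (T : measurableType d) (D : set T) (p q : nat) (F : T -> 'M[R]_(p, q)) (A : 'M[R]_(p, q)) :
  mx_measurable D F -> mx_measurable D (fun x => F x - A).
Proof. by move=> mF; apply: mx_measurableD => //; exact: mx_measurable_cst. Qed.

Lemma mx_measurableZ (R : realType) (d : measure_display)
    (T : measurableType d) (D : set T) (p q : nat) (a : R) (F : T -> 'M[R]_(p, q)) :
  mx_measurable D F -> mx_measurable D (fun x => a *: F x).
Proof.
move=> mF i j; under eq_fun do rewrite mxE.
by apply: measurable_funM; [exact: measurable_cst|exact: mF].
Qed.

Lemma seq_integralZl (R : realType) (n : nat) (k : R) (f : seq R -> R) :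
  0 <= k -> (forall s, 0 <= f s) -> seq_measurable n (fun s => (f s)%:E) ->
  seq_integral n (fun s => (k * f s)%:E) =
  (k%:E * seq_integral n (fun s => (f s)%:E))%E.
Proof.
move=> k0 f0 mf; rewrite /seq_integral -ge0_integralZl_EFin //.
by move=> t _; rewrite lee_fin f0.
Qed.

Lemma powR_scale (R : realType) (a : R) (m : nat) (e : R) : 0 < a ->
  a `^ (m%:R - e) = a `^ (- e) * a ^+ m.
Proof.
move=> a0; rewrite -powR_mulrn ?(ltW a0) // -powRD ?(addrC m%:R) //.
by rewrite (gt_eqF a0) implybT.
Qed.

(** The Gaussian integral over b has matrix (al / a^2) X^-1, where X is the Schur complement. Its
    value contributes a^m, whence the exponent m - e, and (det X)^(1/2), whence e - 1/2. *)
Lemma seq_integral_iw_pivot (R : realType) (m : nat) (e : R)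
    (S : 'M[R]_(1 + m)) (a : R) : posdef S -> 0 < a ->
  seq_integral m (fun b => seq_integral (tri m) (fun r =>
    (iw_kernel e (S : 'M[R]_m.+1) (symm_of_seq m.+1 (a :: b ++ r)))%:E)) =
  ((a `^ (m%:R - e) * expR (- (2^-1 * (S 0 0 / a))))%:E *
   ((((2 * pi / S 0 0) ^+ m) `^ 2^-1)%:E *
    seq_integral (tri m) (fun r =>
      (iw_kernel (e - 2^-1) (schur S) (symm_of_seq m r))%:E)))%E.
Proof.
move=> Sp a0; have Ss := posdef_sym Sp; have [al0 Tp] := (posdef_schur Ss).1 Sp.
set al := S 0 0 in al0 *; set T := schur S.
pose k := a `^ (- e) * expR (- (2^-1 * (al / a))).
have k0 : 0 <= k by rewrite mulr_ge0 ?powR_ge0 ?expR_ge0.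
pose g := (a / al) *: dlsubmx S.
pose E (b r : seq R) := expR (- (2^-1 * qform ((al / a ^+ 2) *: invmx (symm_of_seq m r))
     (col_of_seq m b - g))) * iw_kernel e T (symm_of_seq m r).
have E0 b r : 0 <= E b r by rewrite mulr_ge0 ?expR_ge0 ?iw_kernel_ge0.
have mE (d : measure_display) (U : measurableType d)
    (f : U -> m.-tuple (measurableTypeR R)) (h : U -> (tri m).-tuple (measurableTypeR R)) :
    measurable_fun setT f -> measurable_fun setT h ->
    measurable_fun setT (fun u => (k * E (f u) (h u))%:E).
  move=> mf mh; apply/measurable_EFinP; apply: measurable_funM; first exact: measurable_cst.
  apply: (measurable_fun_posdef_supp (fun u => symm_of_sym _) (mx_measurable_symm_of_seq mh)).
    by move=> u Up; rewrite /E iw_kernelF ?mulr0.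
  apply: measurable_funM; last first.
    apply: (@measurable_funS _ _ _ _ setT) => //; apply: measurable_iw_kernel.
      by move=> u; exact: symm_of_sym.
    exact: mx_measurable_symm_of_seq.
  apply: measurable_expRNhalf; apply: measurable_qform.
    apply: mx_measurableZ; apply: mx_measurable_invmx_posdef.
    exact: mx_measurable_symm_of_seq.
  apply: mx_measurableB_cst; apply: mx_measurable_funS.
  exact: mx_measurable_col_of_seq.
transitivity (seq_integral m (fun b => seq_integral (tri m) (fun r => (k * E b r)%:E))).
  apply: eq_seq_integral => b bm.
  have szb : size b == m by apply/eqP.
  (* For fixed b, the translation of the block that replaces it by the Schur complement as the
     variable of integration. *)
  rewrite -[RHS](seq_integral_shift (w := vech (- (a^-1 *: (col_of_seq m b *m
      (col_of_seq m b)^T))))).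
  - apply: eq_seq_integral => r rm; rewrite symm_of_seqS //.
    rewrite (@iw_kernel_block R m e S a _ _ Ss al0 (symm_of_sym _) a0).
    rewrite /E symm_of_seq_add ?size_vech // vechK //.
    by rewrite linearN /= linearZ /= trmx_mul trmxK.
  - by move=> r; rewrite lee_fin mulr_ge0.
  - exact: (mE _ _ (fun=> Tuple szb) (fun r => r)).
  - exact: size_vech.
(* After the translation b occurs only in the Gaussian factor, so it is integrated first. *)
rewrite (seq_integral_exchange (h := fun b r => (k * E b r)%:E)); first last.
- apply: (mE _ _ fst snd); exact: measurable_fst || exact: measurable_snd.
- by move=> s t; rewrite lee_fin mulr_ge0.
rewrite -seq_integralZl //; first last.
- apply/measurable_EFinP; apply: measurable_iw_kernel => [u|]; first exact: symm_of_sym.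
  by apply: mx_measurable_symm_of_seq.
- by move=> s; exact: iw_kernel_ge0.
- exact: powR_ge0.
rewrite -seq_integralZl //; first last.
- apply/measurable_EFinP; apply: measurable_funM; first exact: measurable_cst.
  apply: measurable_iw_kernel => [u|]; first exact: symm_of_sym.
  by apply: mx_measurable_symm_of_seq.
- by move=> s; rewrite mulr_ge0 ?powR_ge0 ?iw_kernel_ge0.
- by rewrite mulr_ge0 ?powR_ge0 ?expR_ge0.
apply: eq_seq_integral => r rm; set X := symm_of_seq m r.
have [Xp|Xp] := pselect (posdef X); last first.
  rewrite iw_kernelF // !mulr0; under (@eq_seq_integral R m) => b _.
    rewrite /E -/X iw_kernelF // !mulr0; over.
  exact: integral0.
pose K := (al / a ^+ 2) *: invmx X.
have c0 : 0 < al / a ^+ 2 by rewrite divr_gt0 ?exprn_gt0.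
have Kp : posdef K.
  have [Is Ip] := posdef_inv Xp; split; first by rewrite /K linearZ /= Is.
  move=> x x0; rewrite -/(qform _ _) qformZ mulr_gt0 //; exact: Ip.
rewrite (@eq_seq_integral _ _ _ (fun b => ((k * iw_kernel e T X) *
    expR (- (2^-1 * qform K (col_of_seq m b - g))))%:E)); last first.
  by move=> b bm; rewrite /E -/X -/K; congr (_%:E); ring.
rewrite seq_integralZl; first last.
- apply/measurable_EFinP; apply: measurable_expRNhalf; apply: measurable_qform.
    exact: mx_measurable_cst.
  apply: mx_measurableB_cst; exact: mx_measurable_col_of_seq.
- by move=> s; exact: expR_ge0.
- by rewrite mulr_ge0 ?iw_kernel_ge0.
rewrite seq_integral_gauss // -EFinM !iw_kernelT //; congr (_%:E).
have dX := det_posdef_gt0 Xp.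
have -> : (2 * pi) ^+ m / \det K = (2 * pi / al) ^+ m * ((a ^+ m) ^+ 2 * \det X).
  rewrite /K detZ det_inv // !exprMn !exprVn -!exprM mulnC.
  by field; rewrite ?expf_neq0 ?gt_eqF.
have p0 : 0 <= 2 * pi / al by rewrite divr_ge0 ?(ltW al0) // mulr_ge0 ?pi_ge0.
rewrite powRM ?exprn_ge0 // ?mulr_ge0 ?exprn_ge0 ?(ltW a0) ?(ltW dX) //.
rewrite powRM ?exprn_ge0 // ?(ltW a0) ?(ltW dX) //.
have am : 0 <= a ^+ m by rewrite exprn_ge0 ?(ltW a0).
have -> : ((a ^+ m) ^+ 2) `^ 2^-1 = a ^+ m.
  by rewrite (powR12_sqrt (sqr_ge0 _)) sqrtr_sqr (ger0_norm am).
rewrite powR_scale // opprB (addrC 2^-1) powRD; last by rewrite (gt_eqF dX) implybT.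
rewrite /k; ring.
Qed.

Lemma powRDp (R : realType) (a x y : R) : 0 < a -> a `^ (x + y) = a `^ x * a `^ y.
Proof. by move=> a0; rewrite powRD // (gt_eqF a0) implybT. Qed.

Lemma multiGammaS (R : realType) (m : nat) (z : R) :
  multiGamma m.+1 z = pi `^ (m%:R / 2) * Gamma (z - m%:R / 2) * multiGamma m z.
Proof.
rewrite /multiGamma big_nat_recr //=.
have -> : pi `^ ((m.+1 * (m.+1 - 1))%:R / 4) =
    pi `^ (m%:R / 2) * pi `^ ((m * (m - 1))%:R / 4) :> R.
  rewrite -powRD; last by rewrite (gt_eqF (pi_gt0 _)) implybT.
  congr (_ `^ _); case: m => [|m]; first by rewrite !mul0n !mul0r addr0.
  by rewrite !subSS !subn0 !natrM -!natr1; field.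
have -> : z + (1 - m.+1%:R) / 2 = z - m%:R / 2 by rewrite -natr1; field.
by ring.
Qed.

(** The hypothesis says z > (m - 1)/2, which makes the arguments of all the Gamma factors
    positive. *)
Lemma multiGamma_gt0 (R : realType) (m : nat) (z : R) :
  m%:R / 2 < z + 2^-1 -> 0 < multiGamma m z.
Proof.
elim: m => [|m IHm] mz.
  by rewrite /multiGamma big_geq // mulr1 powR_gt0 ?pi_gt0.
rewrite multiGammaS; apply: mulr_gt0.
  rewrite mulr_gt0 ?powR_gt0 ?pi_gt0 // Gamma_gt0 //.
  by move: mz; rewrite -natr1; lra.
by apply: IHm; move: mz; rewrite -natr1; lra.
Qed.

Lemma seq_integral_iw (R : realType) (n m : nat) (S : 'M[R]_m) :
  (m <= n)%N -> posdef S ->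
  seq_integral (tri m) (fun s =>
    (iw_kernel ((n + m + 1)%:R / 2) S (symm_of_seq m s))%:E) =
  (2 `^ ((n * m)%:R / 2) * multiGamma m (n%:R / 2) *
   \det S `^ (- (n%:R / 2)))%:E.
Proof.
elim: m S => [|m IHm] S mn Sp.
  rewrite (_ : tri 0 = 0%N) // seq_integral0 iw_kernelT; last first.
    split; first exact: symm_of_sym.
    by move=> x; rewrite (_ : x = 0) ?eqxx //; apply/matrixP => -[].
  rewrite !det_mx00 !powR1 /mxtrace big_ord0 mulr0 oppr0 expR0 muln0 mul0r powRr0.
  by rewrite /multiGamma big_geq // mul0n mul0r powRr0 !mulr1.
have Ss := posdef_sym Sp; have [al0 Tp] := (posdef_schur Ss).1 Sp.
set al := S 0 0 in al0 *; set T := schur S in Tp.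
(* The dimension is m + 1 here, so m < n and q > 0. The power of a left by the previous lemma is m -
   (n + m + 2)/2 = - q - 1. *)
pose q : R := (n%:R - m%:R) / 2.
have q0 : 0 < q by rewrite divr_gt0 // subr_gt0 ltr_nat.
pose C := ((2 * pi / al) ^+ m) `^ 2^-1 * (2 `^ ((n * m)%:R / 2) *
  multiGamma m (n%:R / 2) * \det T `^ (- (n%:R / 2))).
have mg0 : 0 < multiGamma m (n%:R / 2 : R).
  apply: multiGamma_gt0; apply: (@le_lt_trans _ _ (n%:R / 2)); last by rewrite ltrDl invr_gt0.
  by rewrite ler_pM2r ?invr_gt0 // ler_nat ltnW.
have C0 : 0 <= C.
  apply: mulr_ge0; rewrite ?powR_ge0 //; apply: mulr_ge0; rewrite ?powR_ge0 //.
  by rewrite mulr_ge0 ?powR_ge0 // ltW.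
set g := fun s => _.
have g0 s : (0 <= g s)%E by rewrite lee_fin iw_kernel_ge0.
have mg : seq_measurable (m + tri m).+1 g.
  rewrite -triS; apply/measurable_EFinP; apply: measurable_iw_kernel => [u|].
    exact: symm_of_sym.
  exact: mx_measurable_symm_of_seq.
rewrite triS seq_integralS //.
transitivity (\int[lebesgue_measure]_(a in `]0%R, +oo[)
    (C%:E * (a `^ (- q - 1) * expR (- (2^-1 * (al / a))))%:E))%E.
  rewrite [RHS]integral_mkcond; apply: eq_integral => a _.
  rewrite seq_integral_cat //; last exact: (@seq_measurable_curry _ _ _ [:: a]).
  rewrite patchE mem_setE in_itv /= andbT; have [a0|a0] := ltP 0 a.
    rewrite /g (@seq_integral_iw_pivot R m _ S a Sp a0).
    (* The exponent for dimension m + 1 lowered by 1/2 is the one for dimension m with the same n,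
       as the induction hypothesis requires. *)
    have -> : (n + m.+1 + 1)%:R / 2 - 2^-1 = (n + m + 1)%:R / 2 :> R.
      by rewrite !natrD -natr1; field.
    rewrite (IHm T (ltnW mn) Tp) -!EFinM; congr (_%:E).
    rewrite mulrC; congr (_ * (_ `^ _ * _)).
    by rewrite /q !natrD -natr1; field.
  under (@eq_seq_integral R m) => b bm.
    under (@eq_seq_integral R (tri m)) => r rm.
      rewrite /g symm_of_seqS // iw_kernel_block_le0 //; over.
    rewrite /seq_integral integral0; over.
  by rewrite /seq_integral integral0.
rewrite ge0_integralZl_EFin //; last 2 first.
- by move=> a _; rewrite lee_fin mulr_ge0 ?powR_ge0 ?expR_ge0.
- apply/measurable_EFinP; apply: measurable_funM.
    apply: (measurableT_comp (f := fun y : R => y `^ (- q - 1))) => //.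
  apply: measurable_expRNhalf; apply: measurable_funM; first exact: measurable_cst.
  exact: measurable_funV.
rewrite inv_gamma_integral // -EFinM; congr (_%:E).
rewrite multiGammaS (det_schur Ss) ?gt_eqF // -/al -/T /C.
have dT := det_posdef_gt0 Tp.
rewrite powRM ?(ltW al0) ?(ltW dT) //.
have -> : n%:R / 2 - m%:R / 2 = q by rewrite /q; field.
have e1 : ((2 * pi / al) ^+ m) `^ 2^-1 = 2 `^ (m%:R / 2) * pi `^ (m%:R / 2) * al `^ (-
    (m%:R / 2)).
  rewrite -powR_mulrn ?divr_ge0 ?(ltW al0) ?mulr_ge0 ?pi_ge0 // -powRrM.
  rewrite powRM ?invr_ge0 ?(ltW al0) ?mulr_ge0 ?pi_ge0 // powRM ?pi_ge0 //.
  by rewrite -(powR_inv1 (ltW al0)) -powRrM mulN1r.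
have e2 : (2 / al) `^ q = 2 `^ q * al `^ (- q).
  by rewrite powRM ?invr_ge0 ?(ltW al0) // -(powR_inv1 (ltW al0)) -powRrM mulN1r.
have e3 : 2 `^ ((n * m.+1)%:R / 2) = 2 `^ ((n * m)%:R / 2) * (2 `^ (m%:R / 2) * 2 `^ q) :> R.
  rewrite -powRDp // -powRDp //; congr (_ `^ _).
  by rewrite /q mulnS natrD; field.
have e4 : al `^ (- (n%:R / 2)) = al `^ (- (m%:R / 2)) * al `^ (- q).
  by rewrite -powRDp //; congr (_ `^ _); rewrite /q; field.
rewrite e1 e2 e3 e4; ring.
Qed.

(** * Second moments from moment generating functions *)

(** The second derivative is assumed at 0 only, so L'Hopital's rule is applied just once. The
    resulting quotient (f1 t - f1 (-t)) / (2 t) is the mean of two difference quotients of f1 at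
    0. *)
Lemma second_difference_cvg (R : realType) (f f1 : R -> R) (del A : R) :
  0 < del -> (forall t : R, `|t| < del -> is_derive t 1 f (f1 t)) ->
  is_derive (0 : R) 1 f1 A ->
  (f t + f (- t) - 2 * f 0) / t ^+ 2 @[t --> 0^'+] --> A.
Proof.
move=> del0 df df1.
have itvE (t : R) : t \in `]0, del[ -> [/\ 0 < t, `|t| < del & `|- t| < del].
  by rewrite in_itv normrN /= => /andP[t0 td]; rewrite ger0_norm ?(ltW t0).
have fc : {for 0, continuous f}.
  apply: differentiable_continuous; apply/derivable1_diffP.
  by have [] := df 0 (eq_ind_r (fun x => x < del) del0 (normr0 _)).
have oc : {for (0:R), continuous (fun t : R => f (- t))}.
  apply: (@continuous_comp _ _ _ (fun t : R => - t) f); first exact: opp_continuous.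
  by rewrite oppr0.
apply: (@lhopital_at_right R (fun t => f t + f (- t) - 2 * f 0)
  (fun t => f1 t - f1 (- t)) (fun t => t ^+ 2) (fun t => 2 * t) 0 del A del0).
- move=> t /itvE[_ t1 t2].
  have d1 : is_derive t 1 (fun t => f (- t)) (f1 (- t) * -1).
    by apply: (is_derive1_comp (df _ t2)).
  have := is_deriveB (is_deriveD (df _ t1) d1) (is_derive_cst (2 * f 0) t 1).
  by rewrite subr0 mulrN1.
- move=> t _; have := is_deriveM (is_derive_id t (1:R)) (is_derive_id t (1:R)).
  by move=> h; apply: is_derive_eq h _; rewrite /GRing.scale /= mulr1 -mulr2n mulr_natl.
- apply: cvg_at_right_filter; rewrite -[X in _ --> X](subrr (2 * f 0)).
  apply: cvgB; last exact: cvg_cst.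
  rewrite mulr_natl mulr2n; apply: cvgD => //.
  by rewrite -[X in _ --> f X]oppr0; exact: oc.
- apply: cvg_at_right_filter; rewrite -[X in _ --> X](expr0n _ 2).
  exact: exprn_continuous.
- by move=> t /itvE[t0 _ _]; rewrite mulf_neq0 // gt_eqF.
have [d1 e1] := df1.
have h : (f1 t - f1 0) / t @[t --> 0^'] --> A.
  rewrite (_ : (fun t => _) = fun h => h^-1 *: (f1 (h *: 1 + 0) - f1 0)).
    by rewrite -e1; exact: d1.
  by apply/funext => t; rewrite addr0 [_%:A]mulr1 /GRing.scale /= mulrC.
have hr : (f1 t - f1 0) / t @[t --> 0^'+] --> A by exact: cvg_dnbhs_at_right.
have hl : (f1 (- t) - f1 0) / (- t) @[t --> 0^'+] --> A.
  by apply/cvg_at_rightNP; rewrite oppr0 (_ : _ \o _ = fun t => (f1 t - f1 0) / t);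
    [exact: cvg_dnbhs_at_left|apply/funext => t; rewrite /= opprK].
have -> : A = 2^-1 * (A + A) by field.
have : 2^-1 * ((f1 t - f1 0) / t + (f1 (- t) - f1 0) / (- t)) @[t --> 0^'+] --> 2^-1 * (A + A).
  by apply: cvgM; [exact: cvg_cst|exact: cvgD].
apply: cvg_trans; apply: near_eq_cvg; near=> t.
have t0 : 0 < t by near: t; exact: nbhs_right_gt.
by field; rewrite gt_eqF.
Unshelve. all: by end_near. Qed.

Lemma expR_sub_le (R : realType) (w : R) : 0 <= w ->
  expR w - expR (- w) <= 2 * w * expR w.
Proof.
move=> w0; have := expR_ge1Dx (- w - w); rewrite expRD => h.
have e0 := expR_gt0 w; have eN : expR (- w) * expR w = 1 by rewrite expRN mulVf ?gt_eqF.
have : (1 + (- w - w)) * expR w <= expR (- w) * expR (- w) * expR w.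
  by rewrite ler_pM2r.
by rewrite -mulrA eN mulr1; lra.
Qed.

(** The numerator is (2 sinh(t s/2))^2, at most t^2 s^2 e^(t s) for s >= 0; then s^2 is absorbed by
    (eps s)^2 <= 2 e^(eps s). The majorant is independent of t, as dominated convergence
    requires. *)
Lemma cosh_second_difference (R : realType) (eps t s : R) :
  0 < t -> t <= eps ->
  0 <= (expR (t * s) + expR (- t * s) - 2) / t ^+ 2 <=
    2 / eps ^+ 2 * (expR ((2 * eps) * s) + expR (- (2 * eps) * s)).
Proof.
move=> t0 te; have e0 : 0 < eps by exact: lt_le_trans te.
wlog s0 : s / 0 <= s.
  move=> H; have [/H //|/ltW s0] := leP 0 s.
  by have := H (- s); rewrite oppr_ge0 !mulNr !mulrN !opprK [_ + expR (t * s)]addrC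
    [_ + expR (2 * eps * s)]addrC; apply.
pose w := t * s / 2; have w0 : 0 <= w by rewrite !mulr_ge0 ?(ltW t0) // invr_ge0.
have eN : expR w * expR (- w) = 1 by rewrite expRN mulfV ?gt_eqF ?expR_gt0.
have -> : expR (t * s) + expR (- t * s) - 2 = (expR w - expR (- w)) ^+ 2.
  have -> : t * s = w + w by rewrite /w; field.
  have -> : - t * s = - w - w by rewrite /w; field.
  by rewrite !expRD sqrrB eN -!expr2 mulr2n; ring.
rewrite divr_ge0 ?sqr_ge0 //= ler_pdivrMr ?exprn_gt0 //.
have h1 : (expR w - expR (- w)) ^+ 2 <= (2 * w * expR w) ^+ 2.
  rewrite ler_pXn2r ?nnegrE ?expR_sub_le //.
    by rewrite subr_ge0 ler_expR; lra.
  by rewrite mulr_ge0 ?expR_ge0 // (mulr_ge0 _ w0).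
apply: le_trans h1 _.
have h2 : (eps * s) ^+ 2 <= 2 * expR (eps * s).
  by apply: (@exprn_le_expR R (eps * s) 2); rewrite mulr_ge0 ?(ltW e0).
have h3 : expR (2 * w) <= expR (eps * s).
  by rewrite ler_expR /w mulrC divfK // ler_wpM2r.
have -> : (2 * w * expR w) ^+ 2 = t ^+ 2 * (s ^+ 2 * expR (2 * w)).
  have -> : expR (2 * w) = expR w * expR w by rewrite -expRD; congr expR; ring.
  have -> : 2 * w = t * s by rewrite /w; field.
  ring.
rewrite mulrC ler_pM2r ?exprn_gt0 //.
have e20 : 0 < eps ^+ 2 by rewrite exprn_gt0.
rewrite (mulrC 2 (eps ^+ 2)^-1) -[_^-1 * 2 * _]mulrA ler_pdivlMl // mulrA -exprMn.
apply: (@le_trans _ _ (2 * expR (eps * s) * expR (eps * s))).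
  by apply: ler_pM; rewrite ?sqr_ge0 ?expR_ge0.
rewrite -mulrA -expRD ler_pM2l //.
have -> : 2 * eps * s = eps * s + eps * s by ring.
by rewrite lerDl expR_ge0.
Qed.

(** Integrability and value are kept together because linear combinations of integrals need both. *)
Definition has_integral (R : realType) (d : measure_display)
    (T : measurableType d) (mu : {measure set T -> \bar R}) (D : set T)
    (f : T -> R) (v : R) : Prop :=
  mu.-integrable D (fun x => (f x)%:E) /\
  (\int[mu]_(x in D) (f x)%:E = v%:E)%E.

Lemma has_integralD (R : realType) (d : measure_display)
    (T : measurableType d) (mu : {measure set T -> \bar R}) (D : set T)
    (f g : T -> R) (v w : R) : measurable D ->
  has_integral mu D f v -> has_integral mu D g w ->
  has_integral mu D (fun x => f x + g x) (v + w).
Proof.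
move=> mD [fi fv] [gi gw]; split.
  exact: (@integrableD _ _ _ _ _ mD _ _ fi gi).
by rewrite EFinD -fv -gw -integralD_EFin.
Qed.

Lemma has_integralZ (R : realType) (d : measure_display)
    (T : measurableType d) (mu : {measure set T -> \bar R}) (D : set T)
    (k : R) (f : T -> R) (v : R) : measurable D ->
  has_integral mu D f v -> has_integral mu D (fun x => k * f x) (k * v).
Proof.
move=> mD [fi fv]; split; first exact: (@integrableZl _ _ _ _ _ mD k _ fi).
by rewrite EFinM -fv -integralZl.
Qed.

Lemma eq_has_integral (R : realType) (d : measure_display)
    (T : measurableType d) (mu : {measure set T -> \bar R}) (D : set T)
    (f g : T -> R) (v : R) : measurable D -> (forall x, D x -> f x = g x) ->
  has_integral mu D f v -> has_integral mu D g v.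
Proof.
move=> mD fg [fi fv]; split.
  by apply: eq_integrable fi => // x /set_mem/fg->.
by rewrite -fv; apply: eq_integral => x /set_mem/fg->.
Qed.

Lemma has_integral_ge0 (R : realType) (d : measure_display)
    (T : measurableType d) (mu : {measure set T -> \bar R}) (D : set T)
    (f : T -> R) (v : R) : measurable D -> measurable_fun D f ->
  (forall x, D x -> 0 <= f x) ->
  (\int[mu]_(x in D) (f x)%:E = v%:E)%E -> has_integral mu D f v.
Proof.
move=> mD mf f0 fv; split=> //; apply/integrableP; split.
  exact/measurable_EFinP.
rewrite (eq_integral (fun x => (f x)%:E)); first by rewrite fv ltry.
by move=> x /set_mem/f0 fx; rewrite gee0_abs ?lee_fin.
Qed.

(** Second differences of psi are integrals of second differences of e^(t s). Both have limits along
    a sequence tending to 0, and dominated convergence identifies them; integrability of the limit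
    comes with it. *)
Lemma second_moment (R : realType) (d : measure_display)
    (T : measurableType d) (mu : {measure set T -> \bar R}) (D : set T)
    (p s : T -> R) (psi psi1 : R -> R) (del A : R) :
  measurable D -> measurable_fun D p -> measurable_fun D s ->
  (forall x, D x -> 0 <= p x) -> 0 < del ->
  (forall t : R, `|t| < del ->
     (\int[mu]_(x in D) (p x * expR (t * s x))%:E = (psi t)%:E)%E) ->
  (forall t : R, `|t| < del -> is_derive t 1 psi (psi1 t)) ->
  is_derive (0 : R) 1 psi1 A ->
  has_integral mu D (fun x => s x ^+ 2 * p x) A.
Proof.
move=> mD mp ms p0 del0 Ipsi dpsi dpsi1.
have me t : measurable_fun D (fun x => p x * expR (t * s x)).
  apply: measurable_funM => //; apply: (measurableT_comp (@measurable_expR R)).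
  by apply: measurable_funM => //; exact: measurable_cst.
have HI (t : R) : `|t| < del -> has_integral mu D (fun x => p x * expR (t * s x)) (psi t).
  move=> td; apply: has_integral_ge0 => //; last exact: Ipsi.
  by move=> x Dx; rewrite mulr_ge0 ?expR_ge0 ?p0.
(* The majorant uses the exponential moments at 2 eps and -2 eps, which must lie within radius
   del. *)
pose eps := del / 4; have eps0 : 0 < eps by rewrite divr_gt0.
pose t_ (k : nat) := eps * harmonic k.
have t0 k : 0 < t_ k by rewrite mulr_gt0 // invr_gt0.
have te k : t_ k <= eps.
  by rewrite ger_pMr // invf_le1 // ler1n.
have tc : t_ k @[k --> \oo] --> (0 : R).
  rewrite -[X in _ --> X](mulr0 eps); apply: cvgM; [exact: cvg_cst|exact: cvg_harmonic].
have ed : eps < del by rewrite /eps; lra.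
have td k : `|t_ k| < del by rewrite ger0_norm ?(ltW (t0 k)) // (le_lt_trans (te k)).
pose F t x := (expR (t * s x) + expR (- t * s x) - 2) / t ^+ 2 * p x.
have HF k : has_integral mu D (F (t_ k)) ((psi (t_ k) + psi (- t_ k) - 2 * psi 0) / t_ k ^+ 2).
  have h0 := @HI 0 (eq_ind_r (fun x => x < del) del0 (normr0 _)).
  have hN : `|- t_ k| < del by rewrite normrN.
  have h2 := has_integralZ (t_ k ^+ 2)^-1 mD (has_integralD mD (has_integralD mD
    (HI _ (td k)) (HI _ hN)) (has_integralZ (-2) mD h0)).
  have -> : (psi (t_ k) + psi (- t_ k) - 2 * psi 0) / t_ k ^+ 2 =
      (t_ k ^+ 2)^-1 * (psi (t_ k) + psi (- t_ k) + -2 * psi 0) by ring.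
  apply: eq_has_integral h2 => // x Dx.
  by rewrite /F mul0r expR0; ring.
pose g x := 2 / eps ^+ 2 * (p x * expR ((2 * eps) * s x) + p x * expR (- (2 * eps) * s x)).
(* The pointwise limit is the same second-difference lemma, applied to t |-> e^(t s x). *)
have Fpt x : F (t_ k) x @[k --> \oo] --> s x ^+ 2 * p x.
  apply: cvgM; last exact: cvg_cst.
  have d1 (t : R) : is_derive t 1 (fun t => expR (t * s x)) (s x * expR (t * s x)).
    have := is_derive_scale_expR 1 (s x) t; rewrite mul1r (mulrC t).
    rewrite (_ : (fun u => 1 * _) = fun t => expR (t * s x)) //.
    by apply/funext => u; rewrite mul1r mulrC.
  have d2 : is_derive (0 : R) 1 (fun t => s x * expR (t * s x)) (s x ^+ 2).
    have := is_deriveZ (s x) (d1 0).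
    by rewrite /GRing.scale /= mul0r expR0 mulr1 -expr2.
  have := second_difference_cvg del0 (fun t _ => d1 t) d2.
  move=> /cvg_at_rightP/(_ t_ (conj t0 tc)).
  rewrite mul0r expR0 mulr1; apply: cvg_trans; apply: near_eq_cvg; apply: nearW => k.
  by rewrite mulNr.
have [] := @dominated_convergence _ _ _ mu D mD (fun k x => (F (t_ k) x)%:E)
  (fun x => (s x ^+ 2 * p x)%:E) (fun x => (g x)%:E).
- by move=> k; have [/measurable_int] := HF k.
- by apply/measurable_EFinP; apply: measurable_funM => //; exact: measurable_funX.
- by apply: aeW => x Dx; apply: cvg_EFin; [exact: nearW|exact: Fpt].
- have e2d : `|2 * eps| < del by rewrite ger0_norm ?mulr_ge0 ?(ltW eps0) // /eps; lra.
  have e2N : `|- (2 * eps)| < del by rewrite normrN.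
  by have [] := has_integralZ (2 / eps ^+ 2) mD (has_integralD mD (HI _ e2d) (HI _ e2N)).
- apply: aeW => x k Dx; have /andP[h1 h2] := cosh_second_difference (s x) (t0 k) (te k).
  rewrite abse_EFin lee_fin /F normrM (ger0_norm h1) (ger0_norm (p0 _ Dx)).
  apply: le_trans (ler_wpM2r (p0 _ Dx) h2) _.
  by rewrite le_eqVlt /g; apply/orP; left; apply/eqP; ring.
move=> ie _ Ic; split=> //.
have := second_difference_cvg del0 dpsi dpsi1.
move=> /cvg_at_rightP/(_ t_ (conj t0 tc)) Ac.
apply: (cvg_unique _ Ic) => //; apply: cvg_EFin.
  by apply: nearW => k /=; have [_ ->] := HF k.
by apply: cvg_trans Ac; apply: near_eq_cvg; apply: nearW => k /=; have [_ ->] := HF k.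
Qed.

Lemma is_deriveZ_R (R : realType) (c : R) (f : R -> R) (t df : R) :
  is_derive t 1 f df -> is_derive t 1 (fun t => c * f t) (c * df).
Proof. by move=> h; exact: (is_deriveZ c h). Qed.

Lemma is_derive_affine (R : realType) (mu t : R) :
  is_derive t 1 (fun t : R => 1 + t * mu) mu.
Proof.
have := is_deriveD (is_derive_cst (1 : R) t (1 : R)) (is_deriveZ mu (is_derive_id t (1 : R))).
rewrite add0r /GRing.scale /= mulr1; rewrite (_ : _ + _ = fun t => 1 + t * mu) //.
by apply/funext => u; rewrite addrfctE /= mulrC.
Qed.

Lemma is_derive_lnp1 (R : realType) (mu t : R) : 0 < 1 + t * mu ->
  is_derive t 1 (fun t => ln (1 + t * mu)) (mu / (1 + t * mu)).
Proof.
move=> h.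
by have := @is_derive1_comp _ (@ln R) (fun t => 1 + t * mu) _ _ _ (is_derive1_ln h)
  (is_derive_affine mu t); rewrite mulrC.
Qed.

Definition mgf_log (R : realType) (m : nat) (c : R) (mu : 'rV[R]_m) (t : R) : R :=
  \sum_k c * (t * mu 0 k - ln (1 + t * mu 0 k)).

Definition mgf_log1 (R : realType) (m : nat) (c : R) (mu : 'rV[R]_m) (t : R) : R :=
  \sum_k c * (mu 0 k - mu 0 k / (1 + t * mu 0 k)).

Lemma is_derive_mgf_log (R : realType) (m : nat) (c : R) (mu : 'rV[R]_m) (t : R) :
  (forall k, 0 < 1 + t * mu 0 k) ->
  is_derive t 1 (mgf_log c mu) (mgf_log1 c mu t).
Proof.
move=> h; have := @is_derive_sum R R R m (fun k t => c * (t * mu 0 k - ln (1 + t * mu 0 k))) t 1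
  (fun k => c * (mu 0 k - mu 0 k / (1 + t * mu 0 k))).
rewrite (_ : \sum_(i < m) _ = mgf_log c mu); last by apply/funext => u; rewrite fct_sumE.
apply => k; apply: (is_deriveZ_R c).
apply: is_deriveB; last exact: is_derive_lnp1.
have := is_derive_affine (mu 0 k) t.
have -> : (fun t => 1 + t * mu 0 k) = cst 1 + (fun t => t * mu 0 k) by [].
move=> h1; have := is_deriveB h1 (is_derive_cst (1 : R) t (1 : R)).
by rewrite addrC addKr subr0.
Qed.

Lemma is_derive_mgf_log1 (R : realType) (m : nat) (c : R) (mu : 'rV[R]_m) :
  is_derive (0 : R) 1 (mgf_log1 c mu) (c * \sum_k mu 0 k ^+ 2).
Proof.
have := @is_derive_sum R R R m (fun k t => c * (mu 0 k - mu 0 k / (1 + t * mu 0 k))) 0 1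
  (fun k => c * mu 0 k ^+ 2).
rewrite (_ : \sum_(i < m) (fun t => _) = mgf_log1 c mu); last by apply/funext => u;
    rewrite fct_sumE.
rewrite mulr_sumr; apply => k.
apply: is_deriveZ_R.
have d1 := is_derive_affine (mu 0 k) 0.
have nz : 1 + 0 * mu 0 k != 0 by rewrite mul0r addr0 oner_neq0.
have := is_deriveB (is_derive_cst (mu 0 k) (0 : R) (1 : R))
  (is_deriveZ (mu 0 k) (@is_deriveV _ (fun t => 1 + t * mu 0 k) 0 _ 1 nz d1)).
move=> H; apply: is_derive_eq H _.
by rewrite /GRing.scale /= mul0r addr0; field.
Qed.

Lemma is_derive_mgf (R : realType) (m : nat) (c : R) (mu : 'rV[R]_m) (t : R) :
  (forall k, 0 < 1 + t * mu 0 k) ->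
  is_derive t 1 (fun t => expR (mgf_log c mu t))
    (mgf_log1 c mu t * expR (mgf_log c mu t)).
Proof.
move=> h; have := is_derive1_comp (is_derive_expR (mgf_log c mu t)) (is_derive_mgf_log c h).
by rewrite mulrC.
Qed.

(** At 0 both [mgf_log] and its derivative vanish, the score being centred, so the second derivative
    of the exponential is that of [mgf_log]. *)
Lemma is_derive2_mgf (R : realType) (m : nat) (c : R) (mu : 'rV[R]_m) :
  is_derive (0 : R) 1 (fun t => mgf_log1 c mu t * expR (mgf_log c mu t))
    (c * \sum_k mu 0 k ^+ 2).
Proof.
have l0 : mgf_log c mu 0 = 0.
  by rewrite /mgf_log big1 // => k _; rewrite mul0r addr0 ln1 subr0 mulr0.
have l10 : mgf_log1 c mu 0 = 0.
  by rewrite /mgf_log1 big1 // => k _; rewrite mul0r addr0 divr1 subrr mulr0.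
have h : forall k, 0 < 1 + 0 * mu 0 k by move=> k; rewrite mul0r addr0 ltr01.
have := is_deriveM (is_derive_mgf_log1 c mu) (is_derive_mgf c h).
move=> H; apply: is_derive_eq H _.
by rewrite /GRing.scale /= l0 l10 expR0 mul0r add0r mul1r.
Qed.

(** * The Fisher matrix *)

Lemma symm_of_tnth (R : realType) (m : nat) (x : (tri m).-tuple R) :
  symm_of (\col_k tnth x k) = symm_of_seq m x.
Proof. by congr symm_of; apply/colP => k; rewrite !mxE (tnth_nth 0). Qed.

Lemma posdef_sampleE (R : realType) (m : nat) :
  @posdef_sample R m = [set x | posdef (symm_of_seq m (x : seq R))].
Proof. by apply/seteqP; split=> x; rewrite /posdef_sample /= -symm_of_tnth. Qed.

Lemma measurable_posdef_sample (R : realType) (m : nat) :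
  measurable (@posdef_sample R m).
Proof.
rewrite posdef_sampleE; apply: measurable_posdef => [x|]; first exact: symm_of_sym.
exact: (@mx_measurable_symm_of_seq _ _ _ _ id).
Qed.

Definition iw_norm (R : realType) (m n : nat) : R :=
  2 `^ ((n * m)%:R / 2) * multiGamma m (n%:R / 2).

Lemma iw_norm_gt0 (R : realType) (m n : nat) : (m <= n)%N -> 0 < iw_norm R m n.
Proof.
move=> mn; rewrite mulr_gt0 ?powR_gt0 // multiGamma_gt0 //.
apply: (@le_lt_trans _ _ (n%:R / 2)); last by rewrite ltrDl invr_gt0.
by rewrite ler_pM2r ?invr_gt0 // ler_nat.
Qed.

Lemma inv_wishart_kernel (R : realType) (m n : nat) (X S : 'M[R]_m) : posdef X ->
  inv_wishart n X S = \det S `^ (n%:R / 2) / iw_norm R m n *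
    iw_kernel ((n + m + 1)%:R / 2) S X.
Proof. by move=> Xp; rewrite iw_kernelT // /inv_wishart -/(iw_norm _ _ _); ring. Qed.

Lemma integral_iw_kernel (R : realType) (m n : nat) (S : 'M[R]_m) :
  (m <= n)%N -> posdef S ->
  (\int[@lebesgueRn R (tri m)]_(x in @posdef_sample R m)
     (iw_kernel ((n + m + 1)%:R / 2) S (symm_of_seq m (x : seq R)))%:E =
   (iw_norm R m n * \det S `^ (- (n%:R / 2)))%:E)%E.
Proof.
move=> mn Sp; rewrite -(seq_integral_iw mn Sp) integral_mkcond.
apply: eq_integral => x _; rewrite patchE; case: ifPn => // /negP xp.
rewrite iw_kernelF // => h; apply: xp; rewrite posdef_sampleE; exact/mem_set.
Qed.

Lemma inv_wishart_coordE (R : realType) (m n : nat) (S : 'M[R]_m) x : S^T = S ->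
  posdef_sample x -> inv_wishart_coord n (nu S) x =
  \det S `^ (n%:R / 2) / iw_norm R m n *
    iw_kernel ((n + m + 1)%:R / 2) S (symm_of_seq m (x : seq R)).
Proof.
move=> Ss; rewrite posdef_sampleE /= => xp.
by rewrite /inv_wishart_coord symm_of_tnth nuK // inv_wishart_kernel.
Qed.

Lemma measurable_iw_sample (R : realType) (m : nat) (e : R) (S : 'M[R]_m) :
  measurable_fun (@posdef_sample R m)
    (fun x => iw_kernel e S (symm_of_seq m (x : seq R))).
Proof.
apply: (@measurable_funS _ _ _ _ setT) => //; apply: measurable_iw_kernel => [x|].
  exact: symm_of_sym.
exact: (@mx_measurable_symm_of_seq _ _ _ _ id).
Qed.

Lemma has_integral_iw_kernel (R : realType) (m n : nat) (S : 'M[R]_m) :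
  (m <= n)%N -> posdef S ->
  has_integral (@lebesgueRn R (tri m)) (@posdef_sample R m)
    (fun x => iw_kernel ((n + m + 1)%:R / 2) S (symm_of_seq m (x : seq R)))
    (iw_norm R m n * \det S `^ (- (n%:R / 2))).
Proof.
move=> mn Sp; apply: has_integral_ge0; last exact: integral_iw_kernel.
- exact: measurable_posdef_sample.
- exact: measurable_iw_sample.
- by move=> x _; exact: iw_kernel_ge0.
Qed.

Lemma measurable_inv_wishart_coord (R : realType) (m n : nat) (S : 'M[R]_m) :
  S^T = S -> measurable_fun (@posdef_sample R m) (inv_wishart_coord n (nu S)).
Proof.
move=> Ss; have mk : measurable_fun (@posdef_sample R m)
    (fun x => \det S `^ (n%:R / 2) / iw_norm R m n *
       iw_kernel ((n + m + 1)%:R / 2) S (symm_of_seq m (x : seq R))).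
  by apply: measurable_funM; [exact: measurable_cst|exact: measurable_iw_sample].
apply: eq_measurable_fun mk => x /set_mem xp.
by rewrite inv_wishart_coordE.
Qed.

Lemma inv_wishart_is_density (R : realType) (m n : nat) (S : 'M[R]_m) :
  (m <= n)%N -> posdef S ->
  is_density (@lebesgueRn R (tri m)) (@posdef_sample R m)
    (inv_wishart_coord n (nu S)).
Proof.
move=> mn Sp; have Ss := posdef_sym Sp; have dS := det_posdef_gt0 Sp.
have Z0 := iw_norm_gt0 R mn; have mD := @measurable_posdef_sample R m.
have hi := has_integralZ (\det S `^ (n%:R / 2) / iw_norm R m n) mD
  (has_integral_iw_kernel mn Sp).
split=> //.
- exact: measurable_inv_wishart_coord.
- move=> x xp; rewrite inv_wishart_coordE //.
  by rewrite mulr_ge0 ?iw_kernel_ge0 ?divr_ge0 ?powR_ge0 ?(ltW Z0).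
- have [_ ->] := eq_has_integral mD (fun x xp => esym (inv_wishart_coordE n Ss xp)) hi.
  by congr (_%:E); rewrite powRN; field; rewrite !gt_eqF ?powR_gt0.
Qed.

(** * The exponential family along a line of parameters *)

Lemma powR_prod (R : realType) (m : nat) (a : R) (x : 'I_m -> R) :
  (forall k, 0 < x k) -> (\prod_k x k) `^ a = expR (\sum_k a * ln (x k)).
Proof.
move=> x0; suff [] : 0 < \prod_k x k /\
  (\prod_k x k) `^ a = expR (\sum_k a * ln (x k)) by [].
apply: (big_ind2 (fun u v => 0 < u /\ u `^ a = expR v)).
- by rewrite powR1 expR0.
- move=> u1 v1 u2 v2 [u10 e1] [u20 e2]; split; first exact: mulr_gt0.
  by rewrite powRM ?ltW // e1 e2 expRD.
- by move=> k _; rewrite /powR gt_eqF.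
Qed.

(** The derivative of the log-density at S in the direction H, in closed form;
    [is_derive_ln_inv_wishart] justifies the name. *)
Definition score_lin (R : realType) (m n : nat) (S H X : 'M[R]_m) : R :=
  n%:R / 2 * \tr (invmx S *m H) - 2^-1 * \tr (H *m invmx X).

Lemma invmx_mul_congr (R : realType) (m : nat) (P : 'M[R]_m) (d : 'rV[R]_m) :
  P \in unitmx -> invmx (P *m P^T) *m (P *m diag_mx d *m P^T) =
  (invmx P)^T *m diag_mx d *m P^T.
Proof.
move=> Pu; rewrite -{1}[P]mulmx1 invmx_congr ?unitmx1 // invmx1 mulmx1.
by rewrite !mulmxA mulmxKV.
Qed.

Lemma mxtrace_invmx_congr (R : realType) (m : nat) (P : 'M[R]_m) (d : 'rV[R]_m) :
  P \in unitmx -> \tr (invmx (P *m P^T) *m (P *m diag_mx d *m P^T)) = \sum_k d 0 k.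
Proof.
move=> Pu; rewrite invmx_mul_congr // mxtrace_mulC mulmxA -trmx_mul mulVmx //.
by rewrite trmx1 mul1mx mxtrace_diag.
Qed.

Lemma congr_pencil (R : realType) (m : nat) (P : 'M[R]_m) (d : 'rV[R]_m) (t : R) :
  P *m P^T + t *: (P *m diag_mx d *m P^T) =
  P *m diag_mx (\row_k (1 + t * d 0 k)) *m P^T.
Proof.
have -> : diag_mx (\row_k (1 + t * d 0 k)) = 1%:M + t *: diag_mx d.
  apply/matrixP => i j; rewrite !mxE; case: eqP => [->|_];
    by rewrite ?mulr1n ?mulr0n ?mulr0 ?addr0.
by rewrite mulmxDr mulmxDl mulmx1 -scalemxAr -scalemxAl.
Qed.

Lemma posdef_pencil (R : realType) (m : nat) (P : 'M[R]_m) (d : 'rV[R]_m) (t : R) :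
  P \in unitmx -> (forall k, 0 < 1 + t * d 0 k) ->
  posdef (P *m P^T + t *: (P *m diag_mx d *m P^T)).
Proof.
move=> Pu h; rewrite congr_pencil; apply/posdef_congrE => //.
by apply/posdef_diag => k; rewrite mxE.
Qed.

Lemma det_pencil (R : realType) (m : nat) (P : 'M[R]_m) (d : 'rV[R]_m) (t : R) :
  \det (P *m P^T + t *: (P *m diag_mx d *m P^T)) =
  \det (P *m P^T) * \prod_k (1 + t * d 0 k).
Proof.
rewrite congr_pencil !det_mulmx det_tr det_diag mulrAC; congr (_ * _).
by apply: eq_bigr => k _; rewrite mxE.
Qed.

Lemma pencil_radius (R : realType) (m : nat) (d : 'rV[R]_m) :
  exists2 del : R, 0 < del &
    forall t, `|t| < del -> forall k, 0 < 1 + t * d 0 k.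
Proof.
(* N bounds every |d_k|, and the summand 1 keeps it invertible when d = 0. *)
pose N := 1 + \sum_k `|d 0 k|.
have N0 : 0 < N by rewrite ltr_pwDl // sumr_ge0.
exists N^-1; first by rewrite invr_gt0.
move=> t tN k; have dN : `|d 0 k| <= N.
  rewrite /N (bigD1 k) //= addrCA lerDl addr_ge0 // sumr_ge0 //.
have : `|t * d 0 k| < 1.
  rewrite normrM; apply: (@le_lt_trans _ _ (`|t| * N)); first by rewrite ler_wpM2l.
  by rewrite -ltr_pdivlMr // div1r.
by rewrite ltr_norml => /andP[h _]; lra.
Qed.

(** This identity serves twice: integrated over X it yields the moment generating function of the
    score, and its logarithmic derivative at t = 0 yields the score itself. *)
Lemma inv_wishart_pencil (R : realType) (m n : nat) (P X : 'M[R]_m)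
    (d : 'rV[R]_m) (t : R) :
  P \in unitmx -> posdef X -> (forall k, 0 < 1 + t * d 0 k) ->
  let S := P *m P^T in let H := P *m diag_mx d *m P^T in
  inv_wishart n X (S + t *: H) =
  inv_wishart n X S * expR (t * score_lin n S H X - mgf_log (n%:R / 2) d t).
Proof.
move=> Pu Xp h S H; have dX := det_posdef_gt0 Xp.
have dS : 0 < \det S by rewrite det_mulmx det_tr -expr2 exprn_even_gt0 //= -unitfE -unitmxE.
have pr0 : 0 <= \prod_k (1 + t * d 0 k) by apply: prodr_ge0 => k _; rewrite ltW.
rewrite /score_lin mxtrace_invmx_congr // /inv_wishart.
rewrite det_pencil powRM ?(ltW dS) // powR_prod //.
rewrite mulmxDl mxtraceD -scalemxAl mxtraceZ.
set a := \tr (S *m _); set b := \tr (H *m _); set sm := \sum_k d 0 k.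
set sl := \sum_k _ * ln _.
have phiE : mgf_log (n%:R / 2) d t = t * (n%:R / 2 * sm) - sl.
  by rewrite /sm /sl !mulr_sumr -sumrB; apply: eq_bigr => k _ /=; ring.
have -> : t * (n%:R / 2 * sm - 2^-1 * b) - mgf_log (n%:R / 2) d t = sl - 2^-1 * (t * b).
  by rewrite phiE; ring.
by rewrite mulrDr opprD !expRD; ring.
Qed.

Lemma fisher_quadratic (R : realType) (m n : nat) (S H : 'M[R]_m) :
  (m <= n)%N -> posdef S -> H^T = H ->
  has_integral (@lebesgueRn R (tri m)) (@posdef_sample R m)
    (fun x => score_lin n S H (symm_of_seq m (x : seq R)) ^+ 2 *
       inv_wishart_coord n (nu S) x) (n%:R / 2 * mnorm2 S H).
Proof.
move=> mn Sp Hs; have Ss := posdef_sym Sp.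
have mD := @measurable_posdef_sample R m.
have [dp mp p0 _] := inv_wishart_is_density mn Sp.
have [P [d [Pu SE HE]]] := simultaneous_diag Sp Hs.
have [del del0 Hdel] := pencil_radius d.
pose c : R := n%:R / 2.
have -> : n%:R / 2 * mnorm2 S H = c * \sum_k d 0 k ^+ 2.
  by rewrite SE HE mnorm2_diag.
apply: (@second_moment _ _ _ _ _ _ _ (fun t => expR (mgf_log c d t))
  (fun t => mgf_log1 c d t * expR (mgf_log c d t)) del) => //.
- apply: measurable_funB; first exact: measurable_cst.
  apply: measurable_funM; first exact: measurable_cst.
  apply: measurable_mxtrace; apply: mx_measurableM; first exact: mx_measurable_cst.
  rewrite posdef_sampleE; apply: mx_measurable_invmx_posdef.
  exact: (@mx_measurable_symm_of_seq _ _ _ _ id).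
- move=> t td; have h := Hdel t td.
  have Stp : posdef (S + t *: H) by rewrite SE HE; exact: posdef_pencil.
  (* The total mass 1 of the density at S + t H, multiplied by e^(mgf_log), is the exponential
     moment of the score at t. *)
  have [_ mt pt It] := inv_wishart_is_density mn Stp.
  have [_] := has_integralZ (expR (mgf_log c d t)) mD (has_integral_ge0 mD mt pt It).
  rewrite mulr1 => <-; apply: eq_integral => x /set_mem xp.
  rewrite posdef_sampleE /= in xp; rewrite /inv_wishart_coord symm_of_tnth !nuK //.
    rewrite SE HE inv_wishart_pencil // expRD expRN -/c.
    by congr (_%:E); field; rewrite gt_eqF ?expR_gt0.
  exact: posdef_sym.
- by move=> t /Hdel h; exact: is_derive_mgf.
- exact: is_derive2_mgf.
Qed.

Lemma inv_wishart_gt0 (R : realType) (m n : nat) (X S : 'M[R]_m) :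
  (m <= n)%N -> posdef X -> posdef S -> 0 < inv_wishart n X S.
Proof.
move=> mn Xp Sp; rewrite inv_wishart_kernel // iw_kernelT //.
have Z0 := iw_norm_gt0 R mn.
by rewrite !mulr_gt0 ?invr_gt0 ?powR_gt0 ?expR_gt0 ?det_posdef_gt0.
Qed.

Lemma is_derive_line (R : realType) (k : nat) (f : 'cV[R]_k -> R)
    (a v : 'cV[R]_k) (df : R) :
  is_derive (0 : R) 1 (fun h : R => f (h *: v + a)) df -> is_derive a v f df.
Proof.
case=> d1 d2; apply: DeriveDef; first exact/derivable1P.
rewrite -d2 /derive; set g1 := (fun h => _); set g2 := (fun h => _).
suff -> : g1 = g2 by [].
by apply/funext => h; rewrite /g1 /g2 /= scale0r add0r addr0 [_%:A]mulr1.
Qed.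

Lemma symm_of_line (R : realType) (m : nat) (t : R) (x y : 'cV[R]_(tri m)) :
  symm_of (t *: x + y) = symm_of y + t *: symm_of x.
Proof.
apply/matrixP => i j; rewrite !mxE mulr_sumr -big_split /=.
by apply: eq_bigr => k _; rewrite !mxE addrC.
Qed.

Lemma is_derive_ln_inv_wishart (R : realType) (m n : nat) (S : 'M[R]_m)
    (v : 'cV[R]_(tri m)) (x : (tri m).-tuple R) :
  (m <= n)%N -> posdef S -> posdef_sample x ->
  is_derive (nu S) v (fun z => ln (inv_wishart_coord n z x))
    (score_lin n S (symm_of v) (symm_of_seq m x)).
Proof.
move=> mn Sp xp; set H := symm_of v; set X := symm_of_seq m x.
have Xp : posdef X by move: xp; rewrite posdef_sampleE.
have Ss := posdef_sym Sp; have Hs : H^T = H by exact: symm_of_sym.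
have [P [d [Pu SE HE]]] := simultaneous_diag Sp Hs.
have [del del0 Hdel] := pencil_radius d.
apply: is_derive_line.
pose c : R := n%:R / 2.
(* Near t = 0 the log-density along the line is linear in t up to [mgf_log], whose derivative at 0
   vanishes. *)
apply: (@near_eq_is_derive R R R
  (fun t : R => ln (inv_wishart n X S) + (t * score_lin n S H X - mgf_log c d t))).
  near=> t.
  have h : forall k, 0 < 1 + t * d 0 k.
    by apply: Hdel; near: t; exact: (@pseudometric_normed_Zmodule.nbhs0_lt R R).
  rewrite /inv_wishart_coord symm_of_tnth -/X symm_of_line nuK // -/H.
  have p0 := inv_wishart_gt0 mn Xp Sp.
  move: p0; rewrite SE HE inv_wishart_pencil // => p0.
  by rewrite lnM ?posrE ?expR_gt0 // expRK.
have h0 : forall k, 0 < 1 + 0 * d 0 k by move=> k; rewrite mul0r addr0 ltr01.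
have dl : is_derive (0 : R) 1 (fun t : R => t * score_lin n S H X) (score_lin n S H X).
  have := is_deriveZ_R (score_lin n S H X) (is_derive_id 0 (1 : R)).
  by rewrite mulr1; under eq_fun do rewrite mulrC.
have := is_deriveD (is_derive_cst (ln (inv_wishart n X S)) (0 : R) (1 : R))
  (is_deriveB dl (is_derive_mgf_log c h0)).
have -> : mgf_log1 c d 0 = 0.
  by rewrite /mgf_log1 big1 // => k _; rewrite mul0r addr0 divr1 subrr mulr0.
by rewrite add0r subr0.
Unshelve. all: by end_near. Qed.

(** * Vectorization, the Kronecker product and the Fisher matrix *)

Lemma index_allpairs_pair (T1 T2 : eqType) (s : seq T1) (t : seq T2) (x : T1) (y : T2) :
  x \in s -> y \in t ->
  index (x, y) [seq (a, b) | a <- s, b <- t] = (index x s * size t + index y t)%N.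
Proof.
move=> xs yt; elim: s xs => [//|a s IH]; rewrite in_cons allpairs_cons index_cat.
have pinj : injective (pair a : T2 -> T1 * T2) by move=> u v [].
have [->|xa] /= := eqVneq x a.
  by rewrite (mem_map pinj) yt eqxx index_map.
move=> xs; rewrite eq_sym (negbTE xa) size_map IH //.
case: ifP => [/mapP[b _ [e _]]|_]; first by rewrite e eqxx in xa.
by rewrite mulSn addnA.
Qed.

(** [vec] numbers pairs by their rank in an enumeration, [tensmx] by an arithmetic formula; both
    turn out to be row-major, which is what lets the two be combined. *)
Lemma mxvec_index_val (p q : nat) (i : 'I_p) (j : 'I_q) :
  mxvec_index i j = (i * q + j)%N :> nat.
Proof.
rewrite /mxvec_index /=.
have -> : nat_of_ord (enum_rank (i, j)) = index (i, j) (enum (('I_p * 'I_q)%type : finType)).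
  by rewrite -{2}(nth_enum_rank (i, j) (i, j)) index_uniq ?enum_uniq // -cardT.
rewrite enumT unlock /= /prod_enum index_allpairs_pair ?mem_enum //.
by rewrite !index_enum_ord size_enum_ord.
Qed.

Lemma mxvec_index_tens (p q : nat) (i : 'I_p) (j : 'I_q) :
  mxvec_index i j = mxtens_index (i, j).
Proof. by apply/val_inj; rewrite /= -mxvec_index_val. Qed.

Lemma vecE (R : realType) (m : nat) (A : 'M[R]_m) (i j : 'I_m) :
  vec A (mxvec_index i j) 0 = A j i.
Proof. by rewrite mxE mxvecE mxE. Qed.

Lemma sum_mxvec_index (R : realType) (p q : nat) (f : 'I_(p * q) -> R) :
  \sum_k f k = \sum_(i < p) \sum_(j < q) f (mxvec_index i j).
Proof.
rewrite (reindex _ (curry_mxvec_bij _ _)) /=.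
by rewrite (pair_bigA _ (fun i j => f (mxvec_index i j))); apply: eq_bigr => -[].
Qed.

Lemma tensmx_vec (R : realType) (m : nat) (A B F : 'M[R]_m) :
  tensmx A B *m vec F = vec (B *m F *m A^T).
Proof.
apply/colP => k; case/mxvec_indexP: k => i j.
rewrite vecE mxE sum_mxvec_index mxE; apply: eq_bigr => k _.
rewrite mxE mulr_suml; apply: eq_bigr => l _.
by rewrite vecE mxvec_index_tens mxvec_index_tens tensmxE mxE; ring.
Qed.

Lemma vec_dot (R : realType) (m : nat) (E G : 'M[R]_m) :
  ((vec E)^T *m vec G) 0 0 = \tr (E^T *m G).
Proof.
rewrite mxE sum_mxvec_index; apply: eq_bigr => i _.
by rewrite mxE; apply: eq_bigr => j _; rewrite !mxE !mxvecE !mxE.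
Qed.

Lemma duplication_mx_vec (R : realType) (m : nat) (h : 'cV[R]_(tri m)) :
  duplication_mx R m *m h = vec (symm_of h).
Proof.
have [_ /(_ erefl) D] := duplication_mxP (duplication_mx R m).
by rewrite -(D _ (symm_of_sym _)) symm_ofK.
Qed.

Definition minner (R : realType) (m : nat) (A H K : 'M[R]_m) : R :=
  \tr (invmx A *m H *m (invmx A *m K)).

Lemma duplication_mx_form (R : realType) (m : nat) (S : 'M[R]_m)
    (h k : 'cV[R]_(tri m)) : S^T = S ->
  (h^T *m ((duplication_mx R m)^T *m tensmx (invmx S) (invmx S) *m
    duplication_mx R m) *m k) 0 0 = minner S (symm_of h) (symm_of k).
Proof.
move=> Ss; have As : (invmx S)^T = invmx S by rewrite trmx_inv Ss.
rewrite -!mulmxA duplication_mx_vec (mulmxA h^T) -trmx_mul duplication_mx_vec.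
rewrite tensmx_vec vec_dot symm_of_sym As /minner.
by rewrite !mulmxA mxtrace_mulC !mulmxA.
Qed.

Lemma mx_entry_form (R : realType) (m : nat) (M : 'M[R]_m) (i j : 'I_m) :
  M i j = ((delta_mx i 0 : 'cV[R]_m)^T *m M *m (delta_mx j 0 : 'cV[R]_m)) 0 0.
Proof. by rewrite trmx_delta -rowE -colE !mxE. Qed.

Lemma minnerC (R : realType) (m : nat) (A H K : 'M[R]_m) :
  minner A H K = minner A K H.
Proof. exact: mxtrace_mulC. Qed.

Lemma mnorm2D (R : realType) (m : nat) (A H K : 'M[R]_m) :
  mnorm2 A (H + K) = mnorm2 A H + mnorm2 A K + 2 * minner A H K.
Proof.
rewrite /mnorm2 !mulmxDr !mulmxDl !mxtraceD -!/(minner _ _ _) (minnerC A K H).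
by ring.
Qed.

Lemma score_linD (R : realType) (m n : nat) (S H K X : 'M[R]_m) :
  score_lin n S (H + K) X = score_lin n S H X + score_lin n S K X.
Proof. by rewrite /score_lin mulmxDr mulmxDl !mxtraceD; ring. Qed.

Lemma fisher_bilinear (R : realType) (m n : nat) (S H K : 'M[R]_m) :
  (m <= n)%N -> posdef S -> H^T = H -> K^T = K ->
  has_integral (@lebesgueRn R (tri m)) (@posdef_sample R m)
    (fun x => score_lin n S H (symm_of_seq m (x : seq R)) *
       score_lin n S K (symm_of_seq m (x : seq R)) *
       inv_wishart_coord n (nu S) x) (n%:R / 2 * minner S H K).
Proof.
move=> mn Sp Hs Ks; have mD := @measurable_posdef_sample R m.
have HKs : (H + K)^T = H + K by rewrite linearD /= Hs Ks.
have := has_integralZ 2^-1 mD (has_integralD mD (fisher_quadratic mn Sp HKs)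
  (has_integralZ (-1) mD (has_integralD mD (fisher_quadratic mn Sp Hs)
      (fisher_quadratic mn Sp Ks)))).
have -> : 2^-1 * (n%:R / 2 * mnorm2 S (H + K) +
    -1 * (n%:R / 2 * mnorm2 S H + n%:R / 2 * mnorm2 S K)) = n%:R / 2 * minner S H K.
  by rewrite mnorm2D; field.
apply: eq_has_integral => // x _; rewrite score_linD; by field.
Qed.

Lemma inv_wishart_score (R : realType) (m n : nat) (S : 'M[R]_m) i x :
  (m <= n)%N -> posdef S -> posdef_sample x ->
  score (@inv_wishart_coord R m n) (nu S) i x =
  score_lin n S (symm_of (delta_mx i 0)) (symm_of_seq m (x : seq R)).
Proof.
move=> mn Sp xp.
by have [_ ] := is_derive_ln_inv_wishart (delta_mx i 0) mn Sp xp.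
Qed.

Lemma fisher_has_integral (R : realType) (m n : nat) (S : 'M[R]_m) i j :
  (m <= n)%N -> posdef S ->
  has_integral (@lebesgueRn R (tri m)) (@posdef_sample R m)
    (fun x => score (@inv_wishart_coord R m n) (nu S) i x *
       score (@inv_wishart_coord R m n) (nu S) j x *
       inv_wishart_coord n (nu S) x)
    (n%:R / 2 * minner S (symm_of (delta_mx i 0)) (symm_of (delta_mx j 0))).
Proof.
move=> mn Sp; apply: eq_has_integral (fisher_bilinear mn Sp (symm_of_sym _) (symm_of_sym _)).
  exact: measurable_posdef_sample.
by move=> x xp; rewrite !inv_wishart_score.
Qed.

Lemma inv_wishart_fisher_defined (R : realType) (m n : nat) (S : 'M[R]_m) :
  (m <= n)%N -> posdef S ->
  fisher_defined (@lebesgueRn R (tri m)) (@posdef_sample R m)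
    (@inv_wishart_coord R m n) (nu S).
Proof.
move=> mn Sp; split=> [x i xp|i j].
  by have [] := is_derive_ln_inv_wishart (delta_mx i 0) mn Sp xp.
by have [] := fisher_has_integral i j mn Sp.
Qed.

Lemma inv_wishart_fisher_matrix (R : realType) (m n : nat) (S : 'M[R]_m) :
  (m <= n)%N -> posdef S ->
  fisher_matrix (@lebesgueRn R (tri m)) (@posdef_sample R m)
    (@inv_wishart_coord R m n) (nu S) =
  (n%:R / 2) *: ((duplication_mx R m)^T *m tensmx (invmx S) (invmx S) *m
     duplication_mx R m).
Proof.
move=> mn Sp; apply/matrixP => i j.
rewrite mxE /Rintegral (fisher_has_integral i j mn Sp).2 /= mxE.
by rewrite [in RHS]mx_entry_form duplication_mx_form //; exact: posdef_sym.
Qed.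

Lemma inv_wishart_fisher_form (R : realType) (m n : nat) (x h : 'cV[R]_(tri m)) :
  (m <= n)%N -> posdef (symm_of x) ->
  (h^T *m fisher_matrix (@lebesgueRn R (tri m)) (@posdef_sample R m)
    (@inv_wishart_coord R m n) x *m h) 0 0 =
  n%:R / 2 * mnorm2 (symm_of x) (symm_of h).
Proof.
move=> mn xp; rewrite -{1}(symm_ofK x) inv_wishart_fisher_matrix //.
rewrite -scalemxAr -scalemxAl mxE duplication_mx_form //; exact: posdef_sym.
Qed.

(** * Matrix logarithms and the distance *)

Lemma cvg_mx_entry (R : realType) (m : nat) (f : nat -> 'M[R]_m) (A : 'M[R]_m) :
  (forall i j, f n i j @[n --> \oo] --> A i j) -> f n @[n --> \oo] --> A.
Proof.
move=> fA P [B HB sB]; rewrite nbhs_filterE.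
have : \forall n \near \oo, forall ij : 'I_m * 'I_m, B ij.1 ij.2 (f n ij.1 ij.2).
  by apply: filter_forall => ij; exact: fA (HB _ _).
by apply: filterS => n h; apply: sB => i j; exact: (h (i, j)).
Qed.

Lemma orthogonal_trmx (R : realType) (m : nat) (Q : 'M[R]_m) :
  Q *m Q^T = 1%:M -> Q^T *m Q = 1%:M.
Proof. exact: mulmx1C. Qed.

Lemma orthogonal_unit (R : realType) (m : nat) (Q : 'M[R]_m) :
  Q *m Q^T = 1%:M -> Q \in unitmx.
Proof. by case/mulmx1_unit. Qed.

Lemma expr_orthogonal (R : realType) (m : nat) (Q : 'M[R]_m) (l : 'rV[R]_m) (k : nat) :
  Q *m Q^T = 1%:M ->
  (Q *m diag_mx l *m Q^T) ^+ k = Q *m diag_mx (\row_i l 0 i ^+ k) *m Q^T.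
Proof.
move=> QQ; elim: k => [|k IH].
  rewrite expr0; have -> : diag_mx (\row_i l 0 i ^+ 0) = 1%:M.
    by apply/matrixP => i j; rewrite !mxE expr0.
  by rewrite mulmx1 QQ.
rewrite exprS IH -[LHS]/(_ *m _) !mulmxA -(mulmxA _ Q^T Q) orthogonal_trmx // mulmx1.
rewrite -(mulmxA Q) mulmx_diag; congr (_ *m diag_mx _ *m _).
by apply/rowP => i; rewrite !mxE exprS.
Qed.

(** Each entry of the partial sums is a fixed linear combination of partial sums of the scalar
    exponential series at the eigenvalues. *)
Lemma mxexp_orthogonal (R : realType) (m : nat) (Q : 'M[R]_m) (l : 'rV[R]_m) :
  Q *m Q^T = 1%:M ->
  mxexp (Q *m diag_mx l *m Q^T) = Q *m diag_mx (\row_i expR (l 0 i)) *m Q^T.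
Proof.
move=> QQ; rewrite /mxexp; apply: cvg_lim; first exact: norm_hausdorff.
apply: cvg_mx_entry => i j.
have congrE (d : 'rV[R]_m) : (Q *m diag_mx d *m Q^T) i j = \sum_k Q i k * Q j k * d 0 k.
  rewrite mxE; apply: eq_bigr => k _.
  by rewrite mul_mx_diag !mxE; ring.
have -> : (fun n => series (fun k => (k`!)%:R^-1 *: (Q *m diag_mx l *m Q^T) ^+ k) n i j) =
    (fun n => \sum_k Q i k * Q j k * series (exp_coeff (l 0 k)) n).
  apply/funext => n; rewrite /series /= summxE.
  rewrite (eq_bigr (fun r => \sum_k (r`!)%:R^-1 * (Q i k * Q j k * l 0 k ^+ r))); last first.
    move=> r _; rewrite mxE.
    have := expr_orthogonal l r QQ; set E := (_ ^+ r) => ->.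
    by rewrite congrE mulr_sumr; apply: eq_bigr => k _; rewrite mxE.
  rewrite exchange_big /=; apply: eq_bigr => k _.
  by rewrite mulr_sumr; apply: eq_bigr => r _; rewrite /exp_coeff /=; ring.
rewrite congrE; apply: cvg_big => [|k _]; first exact: add_continuous.
rewrite mxE; apply: cvgM; first exact: cvg_cst.
exact: is_cvg_series_exp_coeff.
Qed.

Lemma mulmx_orthogonal (R : realType) (m : nat) (Q : 'M[R]_m) (a b : 'rV[R]_m) :
  Q *m Q^T = 1%:M ->
  Q *m diag_mx a *m Q^T *m (Q *m diag_mx b *m Q^T) =
  Q *m diag_mx (\row_i (a 0 i * b 0 i)) *m Q^T.
Proof.
move=> QQ; rewrite -mulmx_diag !mulmxA.
by rewrite -(mulmxA _ Q^T Q) orthogonal_trmx // mulmx1.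
Qed.

Lemma trmx_congr_diag (R : realType) (m : nat) (Q : 'M[R]_m) (d : 'rV[R]_m) :
  (Q *m diag_mx d *m Q^T)^T = Q *m diag_mx d *m Q^T.
Proof. by rewrite !trmx_mul trmxK tr_diag_mx mulmxA. Qed.

Lemma mxtrace_orthogonal (R : realType) (m : nat) (Q : 'M[R]_m) (d : 'rV[R]_m) :
  Q *m Q^T = 1%:M -> \tr (Q *m diag_mx d *m Q^T) = \sum_k d 0 k.
Proof.
move=> QQ; rewrite mxtrace_mulC mulmxA orthogonal_trmx // mul1mx.
exact: mxtrace_diag.
Qed.

Lemma frobenius_orthogonal (R : realType) (m : nat) (Q : 'M[R]_m) (l : 'rV[R]_m) :
  Q *m Q^T = 1%:M ->
  frobenius (Q *m diag_mx l *m Q^T) = Num.sqrt (\sum_k l 0 k ^+ 2).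
Proof.
move=> QQ; rewrite /frobenius trmx_congr_diag mulmx_orthogonal //.
rewrite mxtrace_orthogonal //; congr Num.sqrt.
by apply: eq_bigr => k _; rewrite mxE expr2.
Qed.

Lemma char_poly_orthogonal (R : realType) (m : nat) (Q : 'M[R]_m) (d : 'rV[R]_m) :
  Q *m Q^T = 1%:M ->
  char_poly (Q *m diag_mx d *m Q^T) = \prod_k ('X - (d 0 k)%:P).
Proof.
move=> QQ; have : char_poly (diag_mx d) = \prod_k ('X - (d 0 k)%:P).
  rewrite char_poly_trig ?diag_mx_is_trig //.
  by apply: eq_bigr => k _; rewrite mxE eqxx mulr1n.
move=> <-; rewrite /char_poly /char_poly_mx !map_mxM /=.
set q := map_mx _ Q; set qt := map_mx _ Q^T.
have qq : q *m qt = 1%:M by rewrite -map_mxM QQ map_mx1.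
have -> : 'X%:M - q *m map_mx polyC (diag_mx d) *m qt =
    q *m ('X%:M - map_mx polyC (diag_mx d)) *m qt.
  by rewrite mulmxBr mulmxBl mul_mx_scalar -scalemxAl qq scalemx1.
by rewrite !det_mulmx mulrAC -det_mulmx qq det1 mul1r.
Qed.

Lemma posdef_spectral (R : realType) (m : nat) (A : 'M[R]_m) : posdef A ->
  exists Q : 'M[R]_m, exists d : 'rV[R]_m, [/\ Q *m Q^T = 1%:M,
    A = Q *m diag_mx d *m Q^T & forall k, 0 < d 0 k].
Proof.
move=> Ap; have [Q [d [QQ AE]]] := real_spectral (posdef_sym Ap).
exists Q, d; split=> //; apply/posdef_diag.
by move: Ap; rewrite AE => /posdef_congrE; apply; exact: orthogonal_unit QQ.
Qed.

Lemma mxsqrtP (R : realType) (m : nat) (A : 'M[R]_m) : posdef A ->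
  posdef (mxsqrt A) /\ mxsqrt A *m mxsqrt A = A.
Proof.
move=> Ap; have [Q [d [QQ AE d0]]] := posdef_spectral Ap.
pose B := Q *m diag_mx (\row_k Num.sqrt (d 0 k)) *m Q^T.
rewrite /mxsqrt; case: xgetP => [//|/(_ B)[]]; split.
  apply/posdef_congrE; first exact: orthogonal_unit.
  by apply/posdef_diag => k; rewrite mxE sqrtr_gt0.
rewrite mulmx_orthogonal // AE; congr (_ *m diag_mx _ *m _).
by apply/rowP => k; rewrite !mxE -expr2 sqr_sqrtr // ltW.
Qed.

Lemma mxlogP (R : realType) (m : nat) (A : 'M[R]_m) : posdef A ->
  (mxlog A)^T = mxlog A /\ mxexp (mxlog A) = A.
Proof.
move=> Ap; have [Q [d [QQ AE d0]]] := posdef_spectral Ap.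
rewrite /mxlog; case: xgetP => [//|/(_ (Q *m diag_mx (\row_k ln (d 0 k)) *m Q^T))[]].
split; first exact: trmx_congr_diag.
rewrite mxexp_orthogonal // AE; congr (_ *m diag_mx _ *m _).
by apply/rowP => k; rewrite !mxE lnK // posrE.
Qed.

(** [mxlog M] is a symmetric logarithm picked by [xget], so it is this matrix that is diagonalized.
    Exponentiating exhibits the e^(l_i) as roots of the characteristic polynomial of M; they agree
    with the lambda_k up to a permutation, which does not affect the sum. *)
Lemma frobenius_mxlog (R : realType) (m : nat) (M : 'M[R]_m) (lambda : 'I_m -> R) :
  posdef M -> char_poly M = \prod_k ('X - (lambda k)%:P) ->
  frobenius (mxlog M) = Num.sqrt (\sum_k ln (lambda k) ^+ 2).
Proof.
move=> Mp cM; have [Ls eL] := mxlogP Mp.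
have [Q [l [QQ LE]]] := real_spectral Ls.
rewrite LE frobenius_orthogonal //; congr Num.sqrt.
have ME : M = Q *m diag_mx (\row_i expR (l 0 i)) *m Q^T.
  by rewrite -[LHS]eL LE mxexp_orthogonal.
move: cM; rewrite ME char_poly_orthogonal //.
have big_seq (f : 'I_m -> R) : \prod_k ('X - (f k)%:P) =
    \prod_(x <- [seq f k | k <- enum 'I_m]) ('X - x%:P).
  by rewrite big_map big_enum.
rewrite [X in X = _ -> _]big_seq big_seq => /prod_XsubC_eq pe.
have sum_seq (f : 'I_m -> R) : \sum_k ln (f k) ^+ 2 =
    \sum_(x <- [seq f k | k <- enum 'I_m]) ln x ^+ 2.
  by rewrite big_map big_enum.
rewrite sum_seq -(perm_big _ pe) -sum_seq.
by apply: eq_bigr => k _; rewrite mxE expRK.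
Qed.

Lemma inv_wishart_dist (R : realType) (m n : nat) (P : 'M[R]_m) (l : 'rV[R]_m) :
  (m <= n)%N -> P \in unitmx ->
  fisher_rao_dist (@lebesgueRn R (tri m)) (@posdef_sample R m)
    (@inv_wishart_coord R m n) (@posdef_param R m)
    (nu (P *m P^T)) (nu (P *m diag_mx (\row_k expR (l 0 k)) *m P^T)) =
  (Num.sqrt (n%:R / 2 * \sum_k l 0 k ^+ 2))%:E.
Proof.
move=> mn Pu; apply: affine_invariant_dist => //.
by move=> x h; exact: inv_wishart_fisher_form.
Qed.

Theorem mainTheorem7 (R : realType) (m n : nat) (hm : (1 <= m)%N)
    (hmn : (m <= n)%N) :
  let mu : {measure set ((tri m).-tuple (measurableTypeR R)) -> \bar R} :=
    @lebesgueRn R (tri m) in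
  let Pm := @posdef_sample R m in
  let p := @inv_wishart_coord R m n in
  (forall Sigma : 'M[R]_m, posdef Sigma ->
     [/\ is_density mu Pm (p (nu Sigma)),
         fisher_defined mu Pm p (nu Sigma) &
         fisher_matrix mu Pm p (nu Sigma) =
           (n%:R / 2) *: ((duplication_mx R m)^T *m
             (tensmx (invmx Sigma) (invmx Sigma)) *m duplication_mx R m)]) /\
  (forall Sigma1 Sigma2 : 'M[R]_m, posdef Sigma1 -> posdef Sigma2 ->
     let M := invmx (mxsqrt Sigma1) *m Sigma2 *m invmx (mxsqrt Sigma1) in
     fisher_rao_dist mu Pm p (@posdef_param R m) (nu Sigma1) (nu Sigma2) =
       (Num.sqrt (n%:R / 2) * frobenius (mxlog M))%:E /\
     exists lambda : 'I_m -> R,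
       char_poly M = \prod_(k < m) ('X - (lambda k)%:P) /\
       Num.sqrt (n%:R / 2) * frobenius (mxlog M) =
       Num.sqrt (n%:R / 2 * \sum_(k < m) ln (lambda k) ^+ 2)).
Proof.
move=> mu Pm p; split=> [Sigma Sp|S1 S2 S1p S2p M].
  split; first exact: inv_wishart_is_density.
    exact: inv_wishart_fisher_defined.
  exact: inv_wishart_fisher_matrix.
have [Bp BB] := mxsqrtP S1p; move: (mxsqrt S1) @M Bp BB => B M Bp BB.
have Bu := posdef_unit Bp; have Bs := posdef_sym Bp.
have Mp : posdef M.
  rewrite /M -[X in _ *m X]trmxK trmx_inv Bs.
  by apply/posdef_congrE; rewrite ?unitmx_inv.
have [Q [d [QQ ME d0]]] := posdef_spectral Mp.
have cM : char_poly M = \prod_k ('X - (d 0 k)%:P) by rewrite ME char_poly_orthogonal.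
have fE := frobenius_mxlog Mp cM.
have n0 : 0 <= n%:R / 2 :> R by rewrite divr_ge0.
have sE : Num.sqrt (n%:R / 2) * frobenius (mxlog M) =
    Num.sqrt (n%:R / 2 * \sum_k ln (d 0 k) ^+ 2) by rewrite (sqrtrM _ n0) fE.
split; last by exists (fun k => d 0 k).
(* B is the square root of S1 and M = Q diag(d) Q^T. As S2 = B M B, the matrix P = B Q brings both
   endpoints to the form that [inv_wishart_dist] expects, with l_k = ln d_k. *)
have S1E : S1 = (B *m Q) *m (B *m Q)^T.
  by rewrite trmx_mul mulmxA -(mulmxA B) QQ mulmx1 Bs.
have S2E : S2 = (B *m Q) *m diag_mx (\row_k expR ((\row_k ln (d 0 k)) 0 k)) *m (B *m Q)^T.
  have -> : \row_k expR ((\row_k ln (d 0 k)) 0 k) = d.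
    by apply/rowP => k; rewrite !mxE lnK // posrE.
  have -> : S2 = B *m M *m B by rewrite /M !mulmxA mulmxV // mul1mx mulmxKV.
  by rewrite ME trmx_mul Bs !mulmxA.
rewrite S1E S2E inv_wishart_dist //; last by rewrite unitmx_mul Bu orthogonal_unit.
by rewrite sE; congr ((Num.sqrt (_ * _))%:E); apply: eq_bigr => k _; rewrite mxE.
Qed.
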